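(* Assume $k \ge pq$. Then, as complex vector spaces, $$H^\ell(\mathfrak{so}(p,q), \mathrm{SO}(p)\times \mathrm{SO}(q); \mathcal{P}_k) \cong \begin{cases} 0 & \text{if } \ell \neq pq,\\ \big(\mathcal{P}_k/(q_{1,p+1},\ldots,q_{p,p+q})\big)^K\,\mathrm{vol} & \text{if } \ell = pq,\end{cases}$$ where $(q_{1,p+1},\ldots,q_{p,p+q})$ is the ideal generated by all $q_{\alpha\mu}$, $1\le\alpha\le p$, $p+1\le\mu\le p+q$.
   Context: Let $p,q,k\ge 1$. Let $V=\mathbb{R}^{p,q}$ with orthogonal basis $e_1,\ldots,e_{p+q}$, $(e_\alpha,e_\alpha)=1$ for $1\le\alpha\le p$, $(e_\mu,e_\mu)=-1$ for $p+1\le\mu\le p+q$; indices $\alpha$ run over $1,\ldots,p$ and $\mu$ over $p+1,\ldots,p+q$. Let $V_+=\mathrm{span}(e_\alpha)$, $V_-=\mathrm{span}(e_\mu)$, $K=\mathrm{SO}(p)\times\mathrm{SO}(q)$. Write $\mathfrak{so}(p,q)=\mathfrak{k}\oplus\mathfrak{p}_0$ (orthogonal for the Killing form); $\mathfrak{p}_0\cong V_+\otimes V_-$ as a $K$-module, with basis $e_{\alpha\mu}=-e_\alpha\wedge e_\mu$ and dual basis $\omega_{\alpha\mu}$ of $\mathfrak{p}_0^*$ (here $u\wedge v$ acts by $w\mapsto (u,w)v-(v,w)u$). $\mathcal{P}_k=\mathrm{Pol}((V\otimes\mathbb{C})^k)$ is the ring of complex polynomials in the coordinates $z_{\alpha i},z_{\mu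 i}$ ($1\le i\le k$) of $k$-tuples of vectors (the $i$-th vector is the $i$-th column of the $(p+q)\times k$ matrix of coordinates); it is the Fock model of the (suitably twisted) Weil representation, and $K$ acts by $(g f)(\mathbf{v})=f(g^{-1}\mathbf{v})$. The relative Lie algebra complex is $C^\ell=\big(\bigwedge^\ell\mathfrak{p}_0^*\otimes\mathcal{P}_k\big)^K$ with differential $$d=\sum_{i=1}^k\sum_{\alpha=1}^p\sum_{\mu=p+1}^{p+q}A(\omega_{\alpha\mu})\otimes\Big(\frac{\partial^2}{\partial z_{\alpha i}\partial z_{\mu i}}-z_{\alpha i}z_{\mu i}\Big),$$ where $A(\omega)$ is left exterior multiplication by $\omega$; $H^\ell(\mathfrak{so}(p,q),K;\mathcal{P}_k)$ is its cohomology. Define $q_{\alpha\mu}=\sum_{i=1}^k z_{\alpha i}z_{\mu i}\in\mathcal{P}_k$ and $\mathrm{vol}=\omega_{1,p+1}\wedge\cdots\wedge\omega_{p,p+q}$ (the wedge of all $\omega_{\alpha\mu}$), which is $K$-invariant. *)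

(* Defs.v *)
From HB Require Import structures.
From mathcomp Require Import all_boot all_order all_algebra.
From mathcomp Require Import generic_quotient ring_quotient.
From mathcomp Require Import complex mpoly.
From mathcomp Require Import boolp reals.

Set Implicit Arguments.
Unset Strict Implicit.
Unset Printing Implicit Defensive.

Import GRing.Theory.
Local Open Scope ring_scope.
Local Open Scope complex_scope.
Local Open Scope quotient_scope.

Record submodule (K : pzRingType) (U : lmodType K) := Submodule {
  submod_carrier :> U -> Prop;
  submod0 : submod_carrier 0;
  submodP : forall (a : K) (u v : U),
    submod_carrier u -> submod_carrier v -> submod_carrier (a *: u + v) }.

Section Submodule.
Variables (K : pzRingType) (U : lmodType K).
Implicit Type W : submodule U.

Definition submod_pred W : {pred U} := fun u => `[< W u >].

Lemma submod_predP W u : reflect (W u) (u \in submod_pred W).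
Proof. exact: asboolP. Qed.

Lemma submod_pred_closed W : GRing.submod_closed (submod_pred W).
Proof.
split; first by apply/submod_predP; exact: submod0.
by move=> a u v /submod_predP uW /submod_predP vW; apply/submod_predP/submodP.
Qed.

HB.instance Definition _ W :=
  GRing.isSubmodClosed.Build K U (submod_pred W)
    (GRing.submod_closed_semi (submod_pred_closed W)).

Definition submod_type W := {u : U | u \in submod_pred W}.

HB.instance Definition _ W := SubType.on (submod_type W).
HB.instance Definition _ W := Choice.on (submod_type W).
HB.instance Definition _ W :=
  [SubChoice_isSubLmodule of submod_type W by <:].

Definition quot_module W := Quotient.quot (submod_pred W).

HB.instance Definition _ W := GRing.Zmodule.on (quot_module W).
HB.instance Definition _ W :=
  EqQuotient.on (quot_module W).

Section Scale.
Variable W : submodule U.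
Local Notation Q := (quot_module W).

Lemma quot_eqP (u v : U) : reflect (W (u - v)) (\pi_Q u == \pi_Q v).
Proof.
by have := @submod_predP W (u - v); rewrite Quotient.idealrBE.
Qed.

Lemma quot_piD (u v : U) : \pi_Q (u + v) = \pi_Q u + \pi_Q v.
Proof. exact: (Quotient.pi_add (submod_pred W)). Qed.

Definition quot_scale (a : K) (x : Q) : Q := \pi_Q (a *: repr x).

Lemma quot_scaleE a u : quot_scale a (\pi_Q u) = \pi_Q (a *: u).
Proof.
apply/eqP/quot_eqP; rewrite -scalerBr -[_ *: _]addr0.
apply: submodP; last exact: submod0.
by apply/quot_eqP; rewrite reprK.
Qed.

Lemma quot_scaleA a b (x : Q) :
  quot_scale a (quot_scale b x) = quot_scale (a * b) x.
Proof. by elim/quotW: x => x; rewrite (quot_scaleE b) 2!quot_scaleE scalerA. Qed.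

Lemma quot_scale1 : left_id 1 quot_scale.
Proof. by elim/quotW => x; rewrite quot_scaleE scale1r. Qed.

Lemma quot_scaleDr : right_distributive quot_scale +%R.
Proof.
move=> a; elim/quotW=> x; elim/quotW=> y.
by rewrite -quot_piD !quot_scaleE scalerDr quot_piD.
Qed.

Lemma quot_scaleDl (x : Q) : {morph quot_scale^~ x : a b / a + b}.
Proof.
by elim/quotW: x => x a b; rewrite !quot_scaleE scalerDl quot_piD.
Qed.

HB.instance Definition _ := GRing.Zmodule_isLmodule.Build K Q
  quot_scaleA quot_scale1 quot_scaleDr quot_scaleDl.

Lemma quot_piZ (a : K) (u : U) : \pi_Q (a *: u) = a *: \pi_Q u.
Proof. by rewrite -quot_scaleE. Qed.

End Scale.

End Submodule.

Section Subquotient.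
Variables (K : pzRingType) (U : lmodType K) (Z B : submodule U).

Definition restrict_submod : submodule (submod_type Z).
Proof.
refine (@Submodule _ _ (fun z => B (val z)) _ _).
  exact: submod0.
by move=> a u v uB vB; apply: submodP.
Defined.

(* The quotient of Z by its submodule Z :&: B. *)
Definition subquotient := quot_module restrict_submod.

HB.instance Definition _ := GRing.Lmodule.on subquotient.

End Subquotient.

Section Exterior.
Variables (C : comNzRingType) (E : finType) (M : lmodType C).

(* The exterior algebra on generators w_a (a : E), tensored with M: the
   function x stands for the sum over S of w_S (x) x(S), where w_S is the wedge
   of the w_a, a in S, in the order of enum E. *)
Definition ext := {ffun {set E} -> M}.

HB.instance Definition _ := GRing.Lmodule.on ext.

(* Left exterior multiplication by the generator w_a. *)
Definition extmul (a : E) (x : ext) : ext :=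
  [ffun S : {set E} => if a \in S then
    (-1) ^+ #|[set b in S | (enum_rank b < enum_rank a)%N]| *: x (S :\ a)
  else 0].

(* Left exterior multiplication by the linear form \sum_a w a * w_a. *)
Definition formmul (w : E -> C) (x : ext) : ext :=
  \sum_(a : E) w a *: extmul a x.

Definition ext0 (m : M) : ext := [ffun S : {set E} => if S == set0 then m else 0].

Definition wedge (s : seq E) (m : M) : ext := foldr extmul (ext0 m) s.

Definition homogeneous (l : nat) (x : ext) : Prop :=
  forall S : {set E}, #|S| != l -> x S = 0.

Lemma extmul_linear a : linear (extmul a).
Proof.
move=> c x y; apply/ffunP=> S; rewrite !ffunE; case: ifP => _.
  by rewrite scalerDr !scalerA mulrC.
by rewrite scaler0 addr0.
Qed.

Lemma formmul_linear w : linear (formmul w).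
Proof.
move=> c x y; rewrite /formmul scaler_sumr -big_split /=.
apply: eq_bigr => a _; rewrite extmul_linear scalerDr !scalerA.
by rewrite mulrC.
Qed.

Lemma ext0_linear : linear ext0.
Proof.
move=> c x y; apply/ffunP=> S; rewrite !ffunE; case: ifP => // _.
by rewrite scaler0 addr0.
Qed.

Lemma foldr_formmul_linear (w : E -> E -> C) s :
  linear (fun m => foldr (fun a => formmul (w a)) (ext0 m) s).
Proof.
move=> c x y; elim: s => [|a s IHs] /=; first exact: ext0_linear.
by rewrite IHs formmul_linear.
Qed.

Lemma wedge_linear s : linear (wedge s).
Proof.
move=> c x y; elim: s => [|a s IHs] /=; first exact: ext0_linear.
by rewrite IHs extmul_linear.
Qed.

Lemma sorted_enum_rank (S : {set E}) :
  sorted (fun a b => (enum_rank a < enum_rank b)%N) (enum S).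
Proof.
rewrite {1}/enum_mem -enumT.
apply: sorted_filter; first by move=> a b c; exact: ltn_trans.
case: (pickP [pred x : E | true]) => [x0 _|E0]; last first.
  by case: (enum E) => // x; have := E0 x.
apply/(sortedP x0) => i iS.
have rk j : (j < size (enum E))%N -> enum_rank (nth x0 (enum E) j) = j :> nat.
  rewrite -cardE => jE.
  by rewrite -[j]/(nat_of_ord (Ordinal jE)) -enum_val_nth enum_valK.
by rewrite !rk // ltnW.
Qed.

Lemma wedge_enum (S : {set E}) m :
  wedge (enum S) m = [ffun T : {set E} => if T == S then m else 0].
Proof.
have eS : S = [set b in enum S] by apply/setP=> b; rewrite inE mem_enum.
rewrite [in RHS]eS; have := sorted_enum_rank S.
elim: (enum S) => [|a s IHs] /=.
  by move=> _; apply/ffunP=> T; rewrite !ffunE; congr (if T == _ then _ else _);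
    apply/setP=> b; rewrite !inE.
rewrite path_sortedE; last by move=> b c d; exact: ltn_trans.
case/andP=> /allP a_s /IHs ->; apply/ffunP=> T; rewrite !ffunE.
have aNs : a \notin s by apply/negP => /a_s; rewrite ltnn.
case: (T =P [set b in a :: s]) => [->|TN].
  rewrite inE mem_head (_ : _ :\ a == _); last first.
    apply/eqP/setP=> b; rewrite !inE; case: eqP => //= ->.
    by rewrite (negPf aNs).
  rewrite (_ : [set b in _ | _] = set0) ?cards0 ?scale1r //.
  apply/setP=> b; rewrite !inE; case: eqP => [->|_ /=]; first by rewrite ltnn andbF.
  by apply/negP=> /andP[/a_s ab] /(ltn_trans ab); rewrite ltnn.
case: ifP => // aT; case: eqP => [TE|]; last by rewrite scaler0.
case: TN; apply/setP=> b; rewrite !inE; case: eqP => [->|/eqP ba] //=.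
by move/setP/(_ b): TE; rewrite !inE ba.
Qed.

End Exterior.

Section Group.
Variables (R : realType) (p q : nat).

Definition SO (n : nat) (g : 'M[R]_n) : Prop := g *m g^T = 1%:M /\ \det g = 1.

Definition inK (g : 'M[R]_(p + q)) : Prop :=
  exists (a : 'M[R]_p) (b : 'M[R]_q), [/\ SO a, SO b & g = block_mx a 0 0 b].

Definition gram : 'M[R]_(p + q) := block_mx 1%:M 0 0 (- 1%:M).

(* The matrix of the endomorphism w |-> (u, w) v - (v, w) u. *)
Definition bivector (u v : 'cV[R]_(p + q)) : 'M[R]_(p + q) :=
  v *m (u^T *m gram) - u *m (v^T *m gram).

Definition basisV (j : 'I_(p + q)) : 'cV[R]_(p + q) := delta_mx j 0.

Definition p0_basis (c : 'I_p * 'I_q) : 'M[R]_(p + q) :=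
  - bivector (basisV (lshift q c.1)) (basisV (rshift p c.2)).

(* The basis of p_0^* dual to p0_basis (see omega_p0_basis), extended to all
   matrices; only its values on p_0 matter. *)
Definition omega (c : 'I_p * 'I_q) (X : 'M[R]_(p + q)) : R :=
  - X (lshift q c.1) (rshift p c.2).

Lemma p0_basisE c : p0_basis c =
  - (delta_mx (lshift q c.1) (rshift p c.2) +
     delta_mx (rshift p c.2) (lshift q c.1)).
Proof.
rewrite /p0_basis /bivector /basisV !trmx_delta.
have gl : delta_mx 0 (lshift q c.1) *m gram =
    delta_mx 0 (lshift q c.1) :> 'rV_(p + q).
  apply/rowP=> j; rewrite -rowE [LHS]mxE [RHS]mxE /gram.
  case: (split_ordP j) => j' ->; rewrite ?block_mxEul ?block_mxEur !mxE eqxx.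
    by rewrite /= eq_lshift eq_sym.
  by rewrite /= eq_rlshift.
have gr : delta_mx 0 (rshift p c.2) *m gram =
    - delta_mx 0 (rshift p c.2) :> 'rV_(p + q).
  apply/rowP=> j; rewrite -rowE [LHS]mxE [RHS]mxE /gram.
  case: (split_ordP j) => j' ->; rewrite ?block_mxEdl ?block_mxEdr !mxE eqxx.
    by rewrite /= eq_lrshift oppr0.
  by rewrite /= eq_rshift eq_sym.
by rewrite gl gr mulmxN opprK !mul_delta_mx addrC.
Qed.

Lemma omega_p0_basis c c' : omega c (p0_basis c') = (c == c')%:R.
Proof.
rewrite /omega p0_basisE !mxE opprK eq_lshift eq_rshift eq_lrshift /= addr0.
by case: c c' => [a m] [a' m'].
Qed.

(* Coordinates of the coadjoint translate of omega c: the value of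
   X |-> omega c (Ad(g)^-1 X) on p0_basis c'. *)
Definition coadjoint (g : 'M[R]_(p + q)) (c c' : 'I_p * 'I_q) : R :=
  omega c (invmx g *m p0_basis c' *m g).

Lemma inK_inv g : inK g -> invmx g = g^T.
Proof.
move=> [a [b [[a1 _] [b1 _] ->]]].
have e : block_mx a 0 0 b *m (block_mx a 0 0 b)^T = 1%:M.
  rewrite tr_block_mx mulmx_block !trmx0 !(mulmx0, mul0mx) !(addr0, add0r) a1 b1.
  by rewrite -scalar_mx_block.
have [u _] := mulmx1_unit e.
by rewrite -[RHS]mul1mx -(mulVmx u) -mulmxA e mulmx1.
Qed.

End Group.

Section Weil.
Variables (R : realType) (p q k : nat).
Local Notation C := R[i].
Local Notation E := ('I_p * 'I_q)%type.

Definition Pol := {mpoly C[(p + q) * k]}.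

HB.instance Definition _ := GRing.ComNzRing.on Pol.
HB.instance Definition _ := GRing.Lmodule.on Pol.

(* The generic (p+q) x k matrix of coordinates. *)
Definition zmat : 'M[Pol]_(p + q, k) := \matrix_(j, i) 'X_(mxvec_index j i).

Definition zpos (a : 'I_p) (i : 'I_k) : Pol := zmat (lshift q a) i.
Definition zneg (m : 'I_q) (i : 'I_k) : Pol := zmat (rshift p m) i.

(* (g f)(v) = f(g^-1 v): substitute for the coordinates of v those of g^-1 v. *)
Definition Pact (g : 'M[R]_(p + q)) (f : Pol) : Pol :=
  comp_mpoly
    [tuple mxvec (map_mx (fun c : R => c%:C%:MP : Pol) (invmx g) *m zmat) 0 j
      | j < (p + q) * k] f.

Definition eval (f : Pol) (v : 'M[C]_(p + q, k)) : C :=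
  f.@[fun j => mxvec v 0 j].

Lemma Pact_eval g f v :
  eval (Pact g f) v = eval f (map_mx (real_complex R) (invmx g) *m v).
Proof.
rewrite /eval /Pact comp_mpoly_meval; apply: meval_eq => j.
rewrite tnth_map tnth_ord_tuple; case/mxvec_indexP: j => j i.
rewrite !mxvecE !mxE raddf_sum /=; apply: eq_bigr => l _.
by rewrite mevalM !mxE mevalC mevalXU mxvecE.
Qed.

Definition weil (a : 'I_p) (m : 'I_q) (i : 'I_k) (f : Pol) : Pol :=
  (f^`M(mxvec_index (rshift p m) i))^`M(mxvec_index (lshift q a) i)
  - zpos a i * zneg m i * f.

Definition diff (x : ext E Pol) : ext E Pol :=
  \sum_(i < k) \sum_(a < p) \sum_(m < q)
    extmul (a, m) [ffun S => weil a m i (x S)].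

(* g (w_S (x) f) = (g w_{a_1} /\ ... /\ g w_{a_l}) (x) g f for S = {a_1 < ... < a_l} *)
Definition Kact (g : 'M[R]_(p + q)) (x : ext E Pol) : ext E Pol :=
  \sum_(S : {set E})
    foldr (fun c => formmul (fun c' => (coadjoint g c c')%:C))
      (ext0 E (Pact g (x S))) (enum S).

Definition cochain (l : nat) (x : ext E Pol) : Prop :=
  homogeneous l x /\ forall g, inK g -> Kact g x = x.

Lemma Pact_linear g : linear (Pact g).
Proof. by move=> c x y; rewrite /Pact linearP. Qed.

Lemma weil_linear a m i : linear (weil a m i).
Proof.
move=> c x y; rewrite /weil !linearP /= scalerBr mulrDr scalerAr opprD.
by rewrite addrACA.
Qed.

Lemma diff_linear : linear diff.
Proof.
move=> c x y; rewrite /diff.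
do 3! [rewrite scaler_sumr -big_split /=; apply: eq_bigr => ? _].
rewrite -extmul_linear; congr extmul; apply/ffunP=> S.
by rewrite !ffunE weil_linear.
Qed.

Lemma Kact_linear g : linear (Kact g).
Proof.
move=> c x y; rewrite /Kact scaler_sumr -big_split /=.
apply: eq_bigr => S _; rewrite !ffunE Pact_linear.
exact: (foldr_formmul_linear (fun c c' => (coadjoint g c c')%:C)).
Qed.

Lemma linear_fun0 (U V : lmodType C) (f : U -> V) : linear f -> f 0 = 0.
Proof.
by move=> fl; move: (fl 1 0 0); rewrite !scale1r addr0 => /eqP;
  rewrite -subr_eq0 opprD addNKr oppr_eq0 => /eqP.
Qed.

Lemma cochain0 l : cochain l 0.
Proof.
split=> [S _|g _]; first by rewrite ffunE.
exact: linear_fun0 (Kact_linear g).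
Qed.

Lemma cochainP l c x y : cochain l x -> cochain l y -> cochain l (c *: x + y).
Proof.
move=> [hx ix] [hy iy]; split=> [S nS|g gK].
  by rewrite !ffunE hx // hy // scaler0 addr0.
by rewrite Kact_linear ix // iy.
Qed.

Definition cocycles (l : nat) : submodule (ext E Pol).
Proof.
refine (@Submodule _ _ (fun x => cochain l x /\ diff x = 0) _ _).
  by split; [exact: cochain0 | exact: linear_fun0 diff_linear].
move=> c x y [xl dx] [yl dy]; split; first exact: cochainP.
by rewrite diff_linear dx dy scaler0 addr0.
Defined.

Definition coboundaries (l : nat) : submodule (ext E Pol).
Proof.
refine (@Submodule _ _ (fun x => if l is l'.+1
  then exists2 y, cochain l' y & x = diff y else x = 0) _ _).
  case: l => [//|l]; exists 0; [exact: cochain0|].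
  by rewrite (linear_fun0 diff_linear).
case: l => [c x y -> ->|l c x y [x' x'l ->] [y' y'l ->]].
  by rewrite scaler0 addr0.
by exists (c *: x' + y'); [exact: cochainP | rewrite diff_linear].
Defined.

(* diff \o diff vanishes on K-invariant elements (not in general elsewhere); the
   definition does not rely on it, subquotient being formed inside the cocycles. *)
Definition cohomology (l : nat) := subquotient (cocycles l) (coboundaries l).

HB.instance Definition _ l := GRing.Lmodule.on (cohomology l).

Definition qpoly (c : E) : Pol := \sum_(i < k) zpos c.1 i * zneg c.2 i.

Definition qideal : submodule Pol.
Proof.
refine (@Submodule _ _
  (fun f => exists h : E -> Pol, f = \sum_(c : E) h c * qpoly c) _ _).
  by exists (fun=> 0); rewrite big1 // => c _; rewrite mul0r.
move=> a f1 f2 [h1 ->] [h2 ->]; exists (fun c => a *: h1 c + h2 c).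
rewrite scaler_sumr -big_split /=; apply: eq_bigr => c _.
by rewrite mulrDl scalerAl.
Defined.

Definition Polq := quot_module qideal.

HB.instance Definition _ := GRing.Lmodule.on Polq.

(* The action of K induced on Pol / (q_{a,m}); see Polq_act_pi. *)
Definition Polq_act (g : 'M[R]_(p + q)) (x : Polq) : Polq :=
  \pi_Polq (Pact g (repr x)).

Lemma Pact_zmat g j i :
  Pact g (zmat j i) = \sum_l (invmx g j l)%:C *: zmat l i.
Proof.
rewrite /Pact [zmat j i]mxE comp_mpolyXU -tnth_nth tnth_map tnth_ord_tuple.
by rewrite mxvecE mxE; apply: eq_bigr => l _; rewrite mxE mul_mpolyC.
Qed.

Lemma Pact_qpoly (a : 'M[R]_p) (b : 'M[R]_q) (c : E) :
  inK (block_mx a 0 0 b) ->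
  Pact (block_mx a 0 0 b) (qpoly c) =
  \sum_(c' : E) (a c'.1 c.1 * b c'.2 c.2)%:C *: qpoly c'.
Proof.
move=> gK; under [RHS]eq_bigr do rewrite /qpoly scaler_sumr.
rewrite exchange_big /= /qpoly {1}/Pact raddf_sum /=; apply: eq_bigr => i _.
rewrite rmorphM /= -!/(Pact _ _) !Pact_zmat inK_inv // tr_block_mx !trmx0.
rewrite !big_split_ord /= [X in _ + X]big1 ?addr0 => [|m _]; last first.
  by rewrite block_mxEur mxE scale0r.
rewrite [X in _ * (X + _)]big1 ?add0r => [|m _]; last first.
  by rewrite block_mxEdl mxE scale0r.
rewrite big_distrlr pair_big /=; apply: eq_bigr => -[a' m'] _ /=.
rewrite block_mxEul block_mxEdr -scalerAl -scalerAr scalerA -!/(zpos _ _).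
by rewrite [a^T _ _]mxE [b^T _ _]mxE rmorphM.
Qed.

Lemma Pact_qideal g f : inK g -> qideal f -> qideal (Pact g f).
Proof.
move=> gK [h ->]; have [a [b [_ _ gE]]] := gK; rewrite gE in gK *.
exists (fun c' => \sum_(c : E)
  (a c'.1 c.1 * b c'.2 c.2)%:C *: Pact (block_mx a 0 0 b) (h c)).
under [RHS]eq_bigr do rewrite mulr_suml.
rewrite exchange_big {1}/Pact raddf_sum /=; apply: eq_bigr => c _.
rewrite rmorphM /= -!/(Pact _ _) Pact_qpoly // mulr_sumr.
by apply: eq_bigr => c' _; rewrite -scalerAr -scalerAl.
Qed.

Lemma Polq_act_pi g f :
  inK g -> Polq_act g (\pi_Polq f) = \pi_Polq (Pact g f).
Proof.
move=> gK; apply/eqP/quot_eqP.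
have -> : Pact g (repr (\pi_Polq f)) - Pact g f
    = Pact g (repr (\pi_Polq f) - f).
  by rewrite /Pact linearB.
by apply: Pact_qideal => //; apply/quot_eqP; rewrite reprK.
Qed.

Lemma Polq_act_linear g : inK g -> linear (Polq_act g).
Proof.
move=> gK c; elim/quotW=> x; elim/quotW=> y.
rewrite -quot_piZ -quot_piD !Polq_act_pi // Pact_linear quot_piD.
by rewrite quot_piZ.
Qed.

Definition Polq_invariants : submodule Polq.
Proof.
refine (@Submodule _ _ (fun x => forall g, inK g -> Polq_act g x = x) _ _).
  by move=> g gK; exact: linear_fun0 (Polq_act_linear gK).
by move=> c x y xi yi g gK; rewrite Polq_act_linear // xi // yi.
Defined.

Definition vol (x : Polq) : ext E Polq := wedge (enum {: E}) x.

Definition Polq_invariants_vol : submodule (ext E Polq).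
Proof.
refine (@Submodule _ _ 
  (fun y => exists2 x, Polq_invariants x & y = vol x) _ _).
  by exists 0; [exact: submod0 | rewrite /vol (linear_fun0 (@wedge_linear _ _ _ _))].
move=> c x y [x' x'i ->] [y' y'i ->].
by exists (c *: x' + y'); [exact: submodP | rewrite /vol wedge_linear].
Defined.

End Weil.

(* Main.v *)
(* Write d = d1 - d0, where d0 multiplies by the q_{alpha mu} and d1 applies the
   adjoint operators for the Fischer inner product.

   d0 is the Koszul differential of the q_{alpha mu}. As pq <= k, each pair
   (alpha, mu) can be assigned its own column i; for the weight counting the
   variables z_{alpha i} and z_{mu i} of assigned columns, the leading monomials
   z_{alpha i} z_{mu i} of the q_{alpha mu} have disjoint sets of variables, so
   the Koszul complex is exact below degree pq.

   The Fischer adjoint d0s of d0 splits a K-invariant form as d0 y + h with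
   d0s h = 0; y and h inherit invariance from their uniqueness, so no averaging
   over K is needed. Since d1 lowers the polynomial degree while d0 raises it,
   induction on the degree replaces d0 by d: every invariant d-cocycle below
   degree pq is a coboundary, and in degree pq the invariant forms killed by d0s
   are a complement of the d-coboundaries. They are also a complement, among the
   forms f vol with f invariant modulo the q_{alpha mu}, of the multiples of the
   q_{alpha mu}.

   The induction needs d d = 0, which holds only on invariants: differentiating
   the invariance along rational curves of plane rotations expresses the
   curvature d1 d0 + d0 d1 through exterior algebra operators that cancel. *)
Require Import Defs.
From HB Require Import structures.
From mathcomp Require Import all_boot all_order all_algebra.
From mathcomp Require Import generic_quotient ring_quotient.
From mathcomp Require Import complex reals boolp mpoly.
From mathcomp Require Import ring.
Import GRing.Theory.
Local Open Scope ring_scope.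

Set Implicit Arguments.
Unset Strict Implicit.
Unset Printing Implicit Defensive.

(** In degree pq neither side is mapped directly to the other: the invariant top forms killed by
    [d0s] map bijectively to both, and the isomorphism is read off from these two maps. Orthogonal
    projections are available only onto finitely spanned spaces, so they are taken among forms of
    bounded polynomial degree. The bounds fit together because [d0] raises the degree by two and
    [d0s] lowers it by two. All uniqueness comes from one remark: an element that lies in the image
    of an operator and is killed by the adjoint is orthogonal to itself, hence zero. It gives the
    invariance of the Hodge components, the independence from coboundaries, and the invariance of
    the harmonic representative of a class that is invariant only modulo the ideal. The curvature
    involves the polarisation operators of gl(p) and gl(q), whereas invariance speaks only of so(p)
    and so(q). What invariance yields is that the total action of a matrix unit is symmetric in its
    two indices, and symmetric expressions vanish under two anticommuting wedge factors. *)

Section LinearFunctions.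
Variables (C : pzRingType) (U V : lmodType C) (f : U -> V).
Hypothesis fl : linear f.

Let F : {linear U -> V} := HB.pack f (GRing.isLinear.Build C U V *:%R f fl).

Lemma lin0 : f 0 = 0. Proof. exact: (linear0 F). Qed.
Lemma linD : {morph f : x y / x + y}. Proof. exact: (linearD F). Qed.
Lemma linN : {morph f : x / - x}. Proof. exact: (linearN F). Qed.
Lemma linB : {morph f : x y / x - y}. Proof. exact: (linearB F). Qed.
Lemma linZ a : {morph f : x / a *: x}. Proof. exact: (linearZ_LR F). Qed.
Lemma lin_sum I (r : seq I) (P : pred I) (g : I -> U) :
  f (\sum_(i <- r | P i) g i) = \sum_(i <- r | P i) f (g i).
Proof. exact: (linear_sum F). Qed.

End LinearFunctions.

(** * Exterior algebra operators *)

Section Anticommuting.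
Variables (E : finType) (C : comNzRingType).

(** Such a family makes [V] a module over the exterior algebra on [E]. The squares need a clause of
    their own: over a general commutative ring, anticommutation at [b = c] does not make them
    vanish. *)
Definition anticommuting (V : lmodType C) (G : E -> V -> V) : Prop :=
  [/\ forall c, linear (G c), forall b c x, G b (G c x) = - G c (G b x)
    & forall c x, G c (G c x) = 0].

Lemma anticommuting_moveP (s1 s2 : seq E) c (V : lmodType C) (G : E -> V -> V)
    (z : V) : anticommuting G ->
  foldr G z (c :: s1 ++ s2) = (-1) ^+ size s1 *: foldr G z (s1 ++ c :: s2).
Proof.
case=> Gl Gc _; elim: s1 => [|b s1 /= IHs] /=; first by rewrite scale1r.
by rewrite Gc IHs (linZ (Gl b)) /= exprS mulN1r scaleNr.
Qed.

(* The sign depends only on the two words, not on the family. *)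
Lemma anticommuting_perm (s s' : seq E) : perm_eq s s' ->
  exists e : nat, forall (V : lmodType C) (G : E -> V -> V) z,
    anticommuting G -> foldr G z s = (-1) ^+ e *: foldr G z s'.
Proof.
elim: s s' => [|c s IHs] s' ss'.
  by exists 0%N => V G z _; move: ss'; rewrite perm_sym => /perm_nilP ->; rewrite scale1r.
have cs' : c \in s' by rewrite -(perm_mem ss') mem_head.
case/splitPr: cs' ss' => s1 s2.
rewrite perm_sym -cat1s perm_catCA cat1s perm_cons perm_sym => /IHs[e eP].
exists (e + size s1)%N => V G z aG; rewrite [LHS]/= (eP _ _ _ aG).
have [Gl _ _] := aG.
rewrite (linZ (Gl c)) /= exprD -scalerA; congr (_ *: _).
exact: anticommuting_moveP.
Qed.

(** Moving the occurrence of [c] inside [s] to the front, up to sign, produces the square of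
    [G c]. *)
Lemma anticommuting_dup (V : lmodType C) (G : E -> V -> V) z c (s : seq E) :
  anticommuting G -> c \in s -> foldr G z (c :: s) = 0.
Proof.
move=> aG cs; have [Gl _ G2] := aG; case/splitPr: cs => s1 s2.
rewrite [LHS](_ : _ = G c ((-1) ^+ size s1 *: foldr G z (c :: s1 ++ s2))).
  by rewrite (linZ (Gl c)) /= G2 scaler0.
by rewrite (anticommuting_moveP s1 s2) // scalerA -expr2 sqrr_sign scale1r.
Qed.

End Anticommuting.

Section ExteriorOperators.
Variables (C : comNzRingType) (E : finType) (M : lmodType C).
Implicit Types (x y : ext E M) (b c : E) (S T : {set E}).

(** Only elements strictly before [c] are counted, so the sign is the same for [S] with or without
    [c], and it serves both [extmul] and [contract]. *)
Definition esign S c : C :=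
  (-1) ^+ #|[set b in S | (enum_rank b < enum_rank c)%N]|.

Lemma extmulE c x S :
  extmul c x S = if c \in S then esign S c *: x (S :\ c) else 0.
Proof. by rewrite ffunE. Qed.

(** Interior product with the vector dual to the generator [c]. *)
Definition contract c x : ext E M :=
  [ffun S : {set E} => if c \in S then 0 else esign S c *: x (c |: S)].

Lemma contract_linear c : linear (contract c).
Proof.
move=> a x y; apply/ffunP=> S; rewrite !ffunE; case: ifP => _.
  by rewrite scaler0 addr0.
by rewrite scalerDr !scalerA mulrC.
Qed.

Lemma esignD1 S b c : b \in S ->
  esign (S :\ b) c = (-1) ^+ (enum_rank b < enum_rank c)%N * esign S c.
Proof.
move=> bS; rewrite /esign.
set A := [set _ in S | _]; set B := [set _ in S :\ b | _].
have -> : B = A :\ b by apply/setP=> a; rewrite !inE andbA.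
have bA : b \in A = (enum_rank b < enum_rank c)%N by rewrite inE bS.
rewrite (cardsD1 b A) bA exprD mulrA -exprD addnn.
by rewrite -mul2n exprM sqrrN !expr1n mul1r.
Qed.

Lemma esignU1 S b c : b \notin S ->
  esign (b |: S) c = (-1) ^+ (enum_rank b < enum_rank c)%N * esign S c.
Proof.
move=> bS; have := @esignD1 (b |: S) b c (setU11 _ _).
rewrite setU1K // => ->; rewrite mulrA -exprD addnn.
by rewrite -mul2n exprM sqrrN !expr1n mul1r.
Qed.

Lemma esign_sqr S c : esign S c * esign S c = 1.
Proof. by rewrite /esign -expr2 sqrr_sign. Qed.

Lemma rank_sign b c : b != c ->
  (-1) ^+ (enum_rank b < enum_rank c)%N =
  - (-1) ^+ (enum_rank c < enum_rank b)%N :> C.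
Proof.
move=> bc; have : enum_rank b != enum_rank c by rewrite (inj_eq enum_rank_inj).
by rewrite -val_eqE /= => /eqP; case: ltngtP => //= _ _; rewrite ?expr0 ?expr1 ?opprK.
Qed.

Lemma extmulC b c x : extmul b (extmul c x) = - extmul c (extmul b x).
Proof.
apply/ffunP=> S; rewrite [RHS]ffunE !extmulE !in_setD1.
have [->|bc] /= := eqVneq b c.
  by case: ifP => _; rewrite ?scaler0 ?oppr0.
case: ifP => bS; case: ifP => cS; rewrite ?scaler0 ?oppr0 //.
rewrite !scalerA -scaleNr !esignD1 // (rank_sign bc).
rewrite (_ : S :\ c :\ b = S :\ b :\ c); last first.
  by apply/setP=> a; rewrite !inE andbCA.
by congr (_ *: _); ring.
Qed.

Lemma extmul_sqr c x : extmul c (extmul c x) = 0.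
Proof.
apply/ffunP=> S; rewrite !extmulE ffunE; case: ifP => // _.
by rewrite setD11 scaler0.
Qed.

Lemma extmul_anticommuting : anticommuting (@extmul C E M).
Proof. by split; [exact: extmul_linear | exact: extmulC | exact: extmul_sqr]. Qed.

Lemma contractK c x : contract c (extmul c x) + extmul c (contract c x) = x.
Proof.
apply/ffunP=> S; rewrite ffunE extmulE !ffunE setU11 setD11.
case: ifP => cS; rewrite ?add0r ?addr0 scalerA.
  by rewrite esignD1 // ltnn expr0 mul1r esign_sqr scale1r setD1K.
by rewrite [_ ^+ _]esignU1 ?cS // ltnn expr0 mul1r esign_sqr scale1r setU1K ?cS.
Qed.

Lemma contract_extmul b c x : b != c ->
  contract b (extmul c x) = - extmul c (contract b x).
Proof.
move=> bc; apply/ffunP=> S; rewrite [RHS]ffunE extmulE !ffunE !inE.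
rewrite [c == b]eq_sym (negPf bc) /=.
case: ifP => bS; case: ifP => cS; rewrite ?scaler0 ?oppr0 //.
rewrite !scalerA -scaleNr -/(esign _ _) esignD1 // esignU1 ?bS // (rank_sign bc).
rewrite (_ : (b |: S) :\ c = b |: S :\ c); last first.
  by apply/setP=> a; rewrite !inE; have [->|] := eqVneq a b; rewrite ?bc ?orbT.
by congr (_ *: _); ring.
Qed.

Lemma contract_extmulE b c x :
  contract b (extmul c x) = (b == c)%:R *: x - extmul c (contract b x).
Proof.
have [->|bc] := eqVneq; last by rewrite scale0r add0r contract_extmul.
by rewrite scale1r -[X in X - _](contractK c) addrK.
Qed.

Lemma contract_ext0 c m : contract c (ext0 E m) = 0.
Proof.
apply/ffunP=> S; rewrite !ffunE; case: ifP => // _.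
rewrite (_ : _ == set0 = false) ?scaler0 //.
by apply/negbTE/set0Pn; exists c; exact: setU11.
Qed.

Lemma ext_wedgeE x : x = \sum_(S : {set E}) wedge (enum S) (x S).
Proof.
apply/ffunP=> T; rewrite sum_ffunE (bigD1 T) //= wedge_enum ffunE eqxx.
by rewrite big1 ?addr0 // => S ST; rewrite wedge_enum ffunE eq_sym (negPf ST).
Qed.

(** Coefficients and left multiplications generate everything, so an identity between linear
    operators need only be compared on [ext0] and carried through [extmul]; the order of [enum] no
    longer appears. *)
Lemma ext_ind (P : ext E M -> Prop) :
    (forall x y, P x -> P y -> P (x + y)) -> P 0 ->
    (forall m, P (ext0 E m)) -> (forall c x, P x -> P (extmul c x)) ->
  forall x, P x.
Proof.
move=> PD P0 Pe Pm x; rewrite (ext_wedgeE x); apply: big_ind => // S _.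
by elim: (enum S) => [|c s IHs] /=; [exact: Pe | exact: Pm].
Qed.

End ExteriorOperators.

(** * Universal property of the exterior algebra *)

Section UniversalProperty.
Variables (E : finType) (C : comNzRingType) (M V : lmodType C).
Variables (G : E -> V -> V) (phi : M -> V).
Hypotheses (aG : anticommuting G) (phil : linear phi).

Definition ext_lift (x : ext E M) : V :=
  \sum_(S : {set E}) foldr G (phi (x S)) (enum S).

Lemma foldr_lift_linear s : linear (fun m => foldr G (phi m) s).
Proof.
have [Gl _ _] := aG; move=> a m m'; elim: s => [|c s IHs] /=; first exact: phil.
by rewrite IHs Gl.
Qed.

Lemma ext_lift_linear : linear ext_lift.
Proof.
move=> a x y; rewrite /ext_lift scaler_sumr -big_split /=; apply: eq_bigr => S _.
by rewrite !ffunE foldr_lift_linear.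
Qed.

Lemma ext_lift_enum (S : {set E}) m :
  ext_lift (wedge (enum S) m) = foldr G (phi m) (enum S).
Proof.
rewrite /ext_lift (bigD1 S) //= wedge_enum ffunE eqxx big1 ?addr0 // => T TS.
by rewrite ffunE (negPf TS) (lin0 (foldr_lift_linear _)).
Qed.

Lemma ext_lift0 m : ext_lift (ext0 E m) = phi m.
Proof. by have := ext_lift_enum set0 m; rewrite enum_set0. Qed.

(** Inserting [c] into [enum S] permutes a word. The resulting sign depends on the words alone, so
    it is the same for [extmul] and for [G] and cancels. *)
Lemma ext_lift_extmul c x : ext_lift (extmul c x) = G c (ext_lift x).
Proof.
have [Gl _ _] := aG; have aE := @extmul_anticommuting C E M.
rewrite {1 2}(ext_wedgeE x) (lin_sum (@extmul_linear _ _ _ c)) !(lin_sum ext_lift_linear).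
rewrite (lin_sum (Gl c)); apply: eq_bigr => S _; rewrite ext_lift_enum.
rewrite -[G c _]/(foldr G _ (c :: enum S)) -[extmul c _]/(wedge (c :: enum S) _).
have [cS|cS] := boolP (c \in S).
  rewrite [wedge _ _]anticommuting_dup ?mem_enum // (lin0 ext_lift_linear).
  by rewrite anticommuting_dup ?mem_enum.
have /(@anticommuting_perm E C)[e eP] : perm_eq (c :: enum S) (enum (c |: S)).
  have cSu : uniq (c :: enum S) by rewrite /= mem_enum cS enum_uniq.
  apply: (uniq_perm cSu (enum_uniq _)) => b.
  by rewrite inE !mem_enum !inE.
rewrite /wedge (eP _ _ _ aE) (eP _ _ _ aG) (linZ ext_lift_linear) /=.
by rewrite ext_lift_enum.
Qed.

End UniversalProperty.

Section Antisymmetry.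
Variables (C : numClosedFieldType) (V : lmodType C).

Lemma eq_opp_eq0 (x : V) : x = - x -> x = 0.
Proof.
move/eqP; rewrite -addr_eq0 -mulr2n -scaler_nat scaler_eq0.
by rewrite Num.Theory.pnatr_eq0 => /eqP.
Qed.

(** Anticommutation passes to linear combinations by bilinearity; the squares then vanish because
    [x = - x] forces [x = 0] when 2 is invertible. *)
Lemma anticommuting_comb (I E : finType) (G : E -> V -> V) (w : I -> E -> C) :
  anticommuting G -> anticommuting (fun i x => \sum_c w i c *: G c x).
Proof.
case=> Gl GC _.
have combl i : linear (fun x => \sum_c w i c *: G c x).
  move=> a x y; rewrite scaler_sumr -big_split; apply: eq_bigr => c _ /=.
  by rewrite Gl scalerDr !scalerA mulrC.
have fE b c x : \sum_a w b a *: G a (\sum_a' w c a' *: G a' x) =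
    \sum_a \sum_a' (w b a * w c a') *: G a (G a' x).
  apply: eq_bigr => a _; rewrite (lin_sum (Gl a)) scaler_sumr; apply: eq_bigr => a' _.
  by rewrite (linZ (Gl a)) scalerA.
have fC b c x : \sum_a w b a *: G a (\sum_a' w c a' *: G a' x) =
    - \sum_a w c a *: G a (\sum_a' w b a' *: G a' x).
  rewrite (fE b c) (fE c b) [LHS]exchange_big /= -sumrN; apply: eq_bigr => a _.
  by rewrite -sumrN; apply: eq_bigr => a' _; rewrite GC scalerN mulrC.
by split=> // c x; apply: eq_opp_eq0; exact: fC.
Qed.

End Antisymmetry.

(** Exchanging the two summation indices turns the sum into its opposite. *)
Lemma extmul2_sym (C : numClosedFieldType) (E I : finType) (M : lmodType C)
    (f : I -> E) (F : I -> I -> ext E M) : (forall i j, F i j = F j i) ->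
  \sum_i \sum_j extmul (f i) (extmul (f j) (F i j)) = 0.
Proof.
move=> Fs; apply: eq_opp_eq0; rewrite {1}exchange_big -sumrN /=.
apply: eq_bigr => b _; rewrite -sumrN; apply: eq_bigr => c _.
by rewrite extmulC Fs.
Qed.

(** * Determinants from anticommuting operators *)

Section Determinant.
Variables (C : comNzRingType) (n : nat).

Lemma formmulE (E : finType) (M : lmodType C) (w : E -> C) (x : ext E M) S :
  formmul w x S = \sum_(c in S) (w c * esign C S c) *: x (S :\ c).
Proof.
rewrite sum_ffunE [RHS]big_mkcond; apply: eq_bigr => c _.
by rewrite ffunE extmulE; case: ifP => _; rewrite ?scaler0 // scalerA.
Qed.

(** The coefficient of a wedge of forms at an increasing index set is a minor: multiplication by the
    outermost form is the Laplace expansion along the first row. *)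
Lemma foldr_formmul_det (M : lmodType C) (m : M) r (w : 'I_r -> 'I_n -> C)
    (e : 'I_r -> 'I_n) : {homo e : i j / (i < j)%N} ->
  foldr (fun i => formmul (w i)) (ext0 'I_n m) (enum 'I_r) (e @: 'I_r) =
  \det (\matrix_(i < r, j < r) w i (e j)) *: m.
Proof.
elim: r w e => [|r IHr] w e ew.
  rewrite enum_ord0 det_mx00 scale1r /= ffunE (_ : _ == set0) //.
  by apply/eqP/setP=> b; rewrite inE; apply/imsetP=> -[[]].
have e_lt i j : (e i < e j)%N = (i < j)%N.
  apply/idP/idP=> [|/ew //]; apply: contraLR; rewrite -!leqNgt.
  by rewrite leq_eqVlt => /orP[/eqP/val_inj -> //|/ew/ltnW].
have e_inj : injective e.
  move=> i j eij; apply/val_inj; have := e_lt i j; have := e_lt j i.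
  by rewrite eij ltnn; case: ltngtP.
rewrite enum_ordSl /= foldr_map formmulE (expand_det_row _ ord0) scaler_suml.
rewrite big_imset /=; last by move=> i j _ _; exact: e_inj.
apply: eq_bigr => j _; rewrite mxE /cofactor -!scalerA; congr (_ *: _).
(* As [e] is increasing, exactly [j] elements of its image precede [e j]; this is the cofactor sign
   of row 0 and column [j]. *)
have -> : esign C (e @: 'I_r.+1) (e j) = (-1) ^+ (0 + j).
  rewrite /esign; congr (_ ^+ _); rewrite add0n.
  rewrite (_ : finset _ = e @: [set i : 'I_r.+1 | (i < j)%N]); last first.
    apply/setP=> b; rewrite inE !enum_rank_ord /=; apply/andP/imsetP.
      by case=> /imsetP[i _ ->]; rewrite e_lt => ij; exists i; rewrite ?inE.
    by case=> i; rewrite inE => ij ->; rewrite imset_f // e_lt.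
  rewrite card_imset // -sum1dep_card -(big_ord_widen_cond _ xpredT (fun=> 1%N)).
    by rewrite sum1_card card_ord.
  exact: ltnW.
congr (_ *: _).
have -> : e @: 'I_r.+1 :\ e j = (e \o lift j) @: 'I_r.
  apply/setP=> b; rewrite !inE; apply/andP/imsetP.
    case=> bj /imsetP[i _ bi]; move: bj; rewrite bi (inj_eq e_inj).
    by rewrite eq_sym => /unlift_some[i' -> _]; exists i'.
  case=> i _ -> /=; rewrite imset_f // (inj_eq e_inj).
  by rewrite eq_sym neq_lift.
rewrite (IHr (fun i => w (lift ord0 i))); last first.
  by move=> i i' ii'; apply: ew; rewrite /= ltnNge leq_bump2 -ltnNge.
by congr (\det _ *: _); apply/matrixP=> i i'; rewrite !mxE.
Qed.

End Determinant.

Section AnticommutingDet.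
Variables (C : comNzRingType) (n : nat) (V : lmodType C).

Lemma ext_lift_formmul (E : finType) (M : lmodType C) (G : E -> V -> V)
    (phi : M -> V) (w : E -> C) x : anticommuting G -> linear phi ->
  ext_lift G phi (formmul w x) = \sum_c w c *: G c (ext_lift G phi x).
Proof.
move=> aG phil; have Ll := ext_lift_linear aG phil.
rewrite (lin_sum Ll); apply: eq_bigr => c _; rewrite (linZ Ll) /=.
by rewrite ext_lift_extmul.
Qed.

(** Lifted to the exterior algebra on [n] generators, the product of [n] forms has only a top
    coefficient, which is the determinant. *)
Lemma anticommuting_det (G : 'I_n -> V -> V) (A : 'M[C]_n) z : anticommuting G ->
  foldr (fun i x => \sum_j A i j *: G j x) z (enum 'I_n) =
  \det A *: foldr G z (enum 'I_n).
Proof.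
move=> aG; have idl : linear (@id V) by [].
pose y := foldr (fun i => formmul (A i)) (ext0 'I_n z) (enum 'I_n).
have -> : foldr (fun i x => \sum_j A i j *: G j x) z (enum 'I_n) =
    ext_lift G id y.
  rewrite /y; elim: (enum 'I_n) => [|i s IHs] /=; first by rewrite ext_lift0.
  by rewrite ext_lift_formmul // IHs.
have yT : y setT = \det A *: z.
  have := @foldr_formmul_det C n V z n (fun i => A i) id (fun _ _ => id).
  rewrite (_ : id @: _ = setT); last first.
    by apply/setP=> j; rewrite inE; apply/imsetP; exists j.
  move=> ->; congr (\det _ *: _).
  by apply/matrixP=> i j; rewrite mxE.
(* A product of [size s] forms is homogeneous of that degree. *)
have hy s (S : {set 'I_n}) : #|S| != size s ->
    foldr (fun i => formmul (A i)) (ext0 'I_n z) s S = 0.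
  elim: s S => [|i s IHs] S /=.
    by rewrite cards_eq0 ffunE => /negPf ->.
  move=> Ss; rewrite formmulE big1 // => c cS.
  rewrite IHs ?scaler0 //; move: Ss; rewrite (cardsD1 c) cS.
  by apply: contraNneq => ->.
have -> : y = wedge (enum setT) (\det A *: z).
  rewrite wedge_enum; apply/ffunP=> S; rewrite ffunE -yT.
  case: eqVneq => [-> //|ST]; rewrite /y hy ?size_enum_ord //.
  by apply: contraNneq ST => Sn; rewrite eqEcard subsetT cardsT card_ord -[X in (X <= _)%N]Sn leqnn.
by rewrite ext_lift_enum // enum_setT (linZ (foldr_lift_linear aG idl _)) -?enumT.
Qed.

End AnticommutingDet.

(** * The action of K *)

Section CoefficientMap.
Variables (C : comNzRingType) (E : finType) (M : lmodType C).
Implicit Types (x y : ext E M) (c : E) (f : M -> M).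

Definition cmap f x : ext E M := [ffun S => f (x S)].

Lemma cmapE f x S : cmap f x S = f (x S). Proof. by rewrite ffunE. Qed.

Lemma cmap_linear f : linear f -> linear (cmap f).
Proof. by move=> fl a x y; apply/ffunP=> S; rewrite !ffunE fl. Qed.

Lemma cmap_extmul f c x : linear f -> cmap f (extmul c x) = extmul c (cmap f x).
Proof.
move=> fl; apply/ffunP=> S; rewrite cmapE !extmulE cmapE.
by case: ifP => _; rewrite ?(lin0 fl) // (linZ fl).
Qed.

Lemma cmap_contract f c x : linear f ->
  cmap f (contract c x) = contract c (cmap f x).
Proof.
move=> fl; apply/ffunP=> S; rewrite cmapE !ffunE.
by case: ifP => _; rewrite ?(lin0 fl) // (linZ fl).
Qed.

Lemma cmap_ext0 f m : linear f -> cmap f (ext0 E m) = ext0 E (f m).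
Proof.
by move=> fl; apply/ffunP=> S; rewrite cmapE !ffunE; case: ifP; rewrite ?(lin0 fl).
Qed.

Lemma cmap_comp f h x : cmap f (cmap h x) = cmap (f \o h) x.
Proof. by apply/ffunP=> S; rewrite !cmapE. Qed.

Lemma eq_cmap f h x : f =1 h -> cmap f x = cmap h x.
Proof. by move=> fh; apply/ffunP=> S; rewrite !cmapE. Qed.

End CoefficientMap.

Lemma mpoly_alg_ind (C : comNzRingType) n (P : {mpoly C[n]} -> Prop) :
    (forall c, P c%:MP) -> (forall f g, P f -> P g -> P (f + g)) ->
    (forall f g, P f -> P g -> P (f * g)) -> (forall i, P 'X_i) ->
  forall f, P f.
Proof.
move=> PC PD PM PX; elim/mpolyind => [|c m f _ _ Pf]; first by rewrite -mpolyC0.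
apply: PD => //; rewrite -mul_mpolyC; apply: (PM _ _ (PC c)).
rewrite mpolyXE_id; apply: big_ind => //; first by rewrite -mpolyC1; exact: PC.
move=> i _; elim: (m i) => [|d IHd]; first by rewrite expr0 -mpolyC1.
by rewrite exprS; apply: PM.
Qed.

Section KAction.
Variables (R : realType) (p q k : nat).
Local Notation C := (R[i])%C.
Local Notation E := ('I_p * 'I_q)%type.
Local Notation Pol := (Pol R p q k).
Local Notation cochains := (ext E Pol).
Implicit Types (g : 'M[R]_(p + q)) (f : Pol) (x y : cochains) (c : E).

Definition coadC g c c' : C := (coadjoint g c c')%:C%C.

Lemma coadjoint_block (a : 'M[R]_p) (b : 'M[R]_q) c c' :
  inK (block_mx a 0 0 b) ->
  coadjoint (block_mx a 0 0 b) c c' = a c'.1 c.1 * b c'.2 c.2.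
Proof.
move=> gK; rewrite /coadjoint /omega inK_inv // p0_basisE mulmxN mulNmx mxE opprK.
rewrite mulmxDr mulmxDl mxE.
have E i j i' j' : ((block_mx a 0 0 b)^T *m delta_mx i j *m block_mx a 0 0 b) i' j' =
    block_mx a 0 0 b i i' * block_mx a 0 0 b j j'.
  rewrite -(mul_delta_mx (0 : 'I_1)) mulmxA -colE -mulmxA -rowE mxE big_ord1.
  by rewrite !mxE.
by rewrite !E block_mxEul block_mxEdr block_mxEdl mxE mul0r addr0.
Qed.

Lemma SO_trmx n (a : 'M[R]_n) : SO a -> a^T *m a = 1%:M.
Proof. by case=> aa _; apply: mulmx1C. Qed.

(** Up to transposition, [coadC g] is the Kronecker product of the two orthogonal blocks of [g]. *)
Lemma coadC_orth g c b : inK g ->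
  \sum_c' coadC g c c' * coadC g b c' = (c == b)%:R.
Proof.
move=> gK; have [u [v [uO vO gE]]] := gK; rewrite gE in gK *.
rewrite (eq_bigr (fun c' : E => ((u^T c.1 c'.1 * u c'.1 b.1) * (v^T c.2 c'.2 * v c'.2 b.2))%:C%C)).
  rewrite -rmorph_sum -(pair_big xpredT xpredT
    (fun i j => (u^T c.1 i * u i b.1) * (v^T c.2 j * v j b.2))) /=.
  rewrite -big_distrlr /=.
  have /matrixP/(_ c.1 b.1) := SO_trmx uO; rewrite mxE => ->.
  have /matrixP/(_ c.2 b.2) := SO_trmx vO; rewrite mxE => ->.
  by rewrite !mxE -natrM mulnb -xpair_eqE -!surjective_pairing rmorph_nat.
move=> c' _; rewrite /coadC !coadjoint_block // -rmorphM !mxE; congr (_%:C%C); ring.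
Qed.

Lemma coadC_orthr g c b : inK g ->
  \sum_c' coadC g c' c * coadC g c' b = (c == b)%:R.
Proof.
move=> gK; have [u [v [[uO _] [vO _] gE]]] := gK; rewrite gE in gK *.
rewrite (eq_bigr (fun c' : E => ((u c.1 c'.1 * u^T c'.1 b.1) * (v c.2 c'.2 * v^T c'.2 b.2))%:C%C)).
  rewrite -rmorph_sum -(pair_big xpredT xpredT
    (fun i j => (u c.1 i * u^T i b.1) * (v c.2 j * v^T j b.2))) /=.
  rewrite -big_distrlr /=.
  have /matrixP/(_ c.1 b.1) := uO; rewrite mxE => ->.
  have /matrixP/(_ c.2 b.2) := vO; rewrite mxE => ->.
  by rewrite !mxE -natrM mulnb -xpair_eqE -!surjective_pairing rmorph_nat.
move=> c' _; rewrite /coadC !coadjoint_block // -rmorphM !mxE; congr (_%:C%C); ring.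
Qed.

Lemma Kact_lift g x : Kact g x =
  ext_lift (fun c => formmul (coadC g c)) (fun m => ext0 E (Pact g m)) x.
Proof. by []. Qed.

Lemma ext0_Pact_linear g : linear (fun m : Pol => ext0 E (Pact g m)).
Proof. by move=> a m m'; rewrite Pact_linear ext0_linear. Qed.

Lemma coadjoint_anticommuting g :
  anticommuting (fun c => formmul (coadC g c) : cochains -> cochains).
Proof. exact: (anticommuting_comb _ (@extmul_anticommuting C E Pol)). Qed.

Lemma Kact_extmul g c x :
  Kact g (extmul c x) = \sum_c' coadC g c c' *: extmul c' (Kact g x).
Proof.
by rewrite Kact_lift ext_lift_extmul //; [exact: coadjoint_anticommuting | exact: ext0_Pact_linear].
Qed.

Lemma Kact_ext0 g f : Kact g (ext0 E f) = ext0 E (Pact g f).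
Proof.
by rewrite Kact_lift ext_lift0 //; [exact: coadjoint_anticommuting | exact: ext0_Pact_linear].
Qed.

(** Contractions transform by the contragredient of the matrix of [extmul], which is the same matrix
    because it is orthogonal. *)
Lemma Kact_contract g c x : inK g ->
  Kact g (contract c x) = \sum_c' coadC g c c' *: contract c' (Kact g x).
Proof.
move=> gK; move: x; have Kl := @Kact_linear R p q k g.
apply: ext_ind => [x y IHx IHy||f|b x IHx].
- rewrite (linD (@contract_linear _ _ _ c)) !(linD Kl) /= IHx IHy -big_split.
  by apply: eq_bigr => c' _; rewrite (linD (@contract_linear _ _ _ c')) scalerDr.
- rewrite (lin0 (@contract_linear _ _ _ c)) (lin0 Kl) big1 // => c' _.
  by rewrite (lin0 (@contract_linear _ _ _ c')) scaler0.
- rewrite contract_ext0 (lin0 Kl) big1 // => c' _.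
  by rewrite Kact_ext0 contract_ext0 scaler0.
rewrite contract_extmulE (linB Kl) (linZ Kl) /= !Kact_extmul IHx.
rewrite [RHS](_ : _ = \sum_c' \sum_b' (coadC g c c' * coadC g b b') *:
   ((c' == b')%:R *: Kact g x - extmul b' (contract c' (Kact g x)))); last first.
  apply: eq_bigr => c' _; rewrite (lin_sum (@contract_linear _ _ _ c')) scaler_sumr.
  apply: eq_bigr => b' _; rewrite (linZ (@contract_linear _ _ _ c')) scalerA /=.
  by rewrite contract_extmulE.
under [RHS]eq_bigr do under eq_bigr do rewrite scalerBr.
under [RHS]eq_bigr do rewrite big_split.
rewrite big_split /=; congr (_ + _).
  rewrite -(coadC_orth c b gK) scaler_suml; apply: eq_bigr => c' _.
  rewrite (bigD1 c') //= eqxx scale1r big1 ?addr0 // => b' bc.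
  by rewrite eq_sym (negPf bc) scale0r scaler0.
rewrite exchange_big -sumrN; apply: eq_bigr => b' _.
rewrite (lin_sum (@extmul_linear _ _ _ b')) scaler_sumr -sumrN.
apply: eq_bigr => c' _; rewrite (linZ (@extmul_linear _ _ _ b')) /= scalerA.
by rewrite mulrC.
Qed.

Lemma Kact_cmap_sum g (T : E -> Pol -> Pol) (w : E -> C) (h : Pol -> Pol) x :
    (forall c, linear (T c)) -> linear h ->
    (forall f, Pact g (h f) = \sum_c w c *: T c (Pact g f)) ->
  Kact g (cmap h x) = \sum_c w c *: cmap (T c) (Kact g x).
Proof.
move=> Tl hl hT; move: x; have Kl := @Kact_linear R p q k g.
apply: ext_ind => [x y IHx IHy||f|b x IHx].
- rewrite (linD (cmap_linear hl)) !(linD Kl) /= IHx IHy -big_split.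
  by apply: eq_bigr => c' _; rewrite (linD (cmap_linear (Tl c'))) scalerDr.
- rewrite (lin0 (cmap_linear hl)) (lin0 Kl) big1 // => c' _.
  by rewrite (lin0 (cmap_linear (Tl c'))) scaler0.
- rewrite cmap_ext0 // !Kact_ext0 hT (lin_sum (@ext0_linear _ _ _)).
  apply: eq_bigr => c _; rewrite (linZ (@ext0_linear _ _ _)) /=.
  by rewrite cmap_ext0.
rewrite (cmap_extmul b x hl) (Kact_extmul g b x) (Kact_extmul g b (cmap h x)) IHx.
transitivity (\sum_c \sum_c' (w c * coadC g b c') *: extmul c' (cmap (T c) (Kact g x))).
  rewrite [RHS]exchange_big /=; apply: eq_bigr => c' _.
  rewrite (lin_sum (@extmul_linear _ _ _ c')) scaler_sumr; apply: eq_bigr => c _.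
  by rewrite (linZ (@extmul_linear _ _ _ c')) scalerA mulrC.
apply: eq_bigr => c _; rewrite [in RHS](lin_sum (cmap_linear (Tl c))) scaler_sumr.
apply: eq_bigr => c' _; rewrite (linZ (cmap_linear (Tl c))) scalerA /=.
by rewrite (cmap_extmul c' (Kact g x) (Tl c)).
Qed.

(* Both factors transform by the same orthogonal matrix, so the sum is fixed. *)
Lemma Kact_sum g (Op : E -> cochains -> cochains) (T : E -> Pol -> Pol) x : inK g ->
    (forall c, linear (Op c)) -> (forall c, linear (T c)) ->
    (forall c y, Kact g (Op c y) = \sum_c' coadC g c c' *: Op c' (Kact g y)) ->
    (forall c f, Pact g (T c f) = \sum_c' coadC g c c' *: T c' (Pact g f)) ->
  Kact g (\sum_c Op c (cmap (T c) x)) = \sum_c Op c (cmap (T c) (Kact g x)).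
Proof.
move=> gK Opl Tl KOp PT; rewrite (lin_sum (@Kact_linear R p q k g)).
transitivity (\sum_c \sum_c' \sum_b (coadC g c c' * coadC g c b) *:
    Op c' (cmap (T b) (Kact g x))).
  apply: eq_bigr => c _; rewrite KOp; apply: eq_bigr => c' _.
  rewrite (Kact_cmap_sum x Tl (Tl c) (PT c)) (lin_sum (Opl c')) scaler_sumr.
  by apply: eq_bigr => b _; rewrite (linZ (Opl c')) scalerA.
rewrite [LHS]exchange_big /=; apply: eq_bigr => c' _; rewrite [LHS]exchange_big /=.
rewrite (bigD1 c') //= -scaler_suml coadC_orthr // eqxx scale1r big1 ?addr0 //.
by move=> b bc; rewrite -scaler_suml coadC_orthr // eq_sym (negPf bc) scale0r.
Qed.

End KAction.

Section ChainRule.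
Variables (C : comNzRingType) (n : nat).

Lemma mderivXU (i j : 'I_n) : ('X_i : {mpoly C[n]})^`M(j) = (i == j)%:R%:MP.
Proof.
rewrite mderivX mnm1E; have [->|ij] := eqVneq; last by rewrite scale0r mpolyC0.
have -> : (U_(j) - U_(j) = 0 :> 'X_{1..n})%MM.
  by apply/mnmP=> a; rewrite mnmBE mnm0E subnn.
by rewrite mpolyX0 scale1r mpolyC1.
Qed.

Lemma mderiv_comp (t : n.-tuple {mpoly C[n]}) j (f : {mpoly C[n]}) :
  (f \mPo t)^`M(j) = \sum_i (tnth t i)^`M(j) * (f^`M(i) \mPo t).
Proof.
elim/mpoly_alg_ind: f => [a|f h IHf IHh|f h IHf IHh|a].
- rewrite comp_mpolyC mderivC big1 // => l _.
  by rewrite mderivC raddf0 mulr0.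
- rewrite raddfD mderivD IHf IHh -big_split; apply: eq_bigr => l _ /=.
  by rewrite mderivD raddfD mulrDr.
- rewrite rmorphM mderivM IHf IHh mulr_suml mulr_sumr -big_split /=.
  apply: eq_bigr => l _; rewrite mderivM raddfD /= !rmorphM /=; ring.
rewrite comp_mpolyXU -tnth_nth (bigD1 a) //= mderivXU eqxx mpolyC1 rmorph1 mulr1.
by rewrite big1 ?addr0 // => i ia; rewrite mderivXU eq_sym (negPf ia) raddf0 mulr0.
Qed.

End ChainRule.

Section PolynomialAction.
Variables (R : realType) (p q k : nat).
Local Notation C := (R[i])%C.
Local Notation E := ('I_p * 'I_q)%type.
Local Notation Pol := (Pol R p q k).
Local Notation cochains := (ext E Pol).
Local Notation idx j i := (mxvec_index (j : 'I_(p + q)) (i : 'I_k)).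
Implicit Types (g : 'M[R]_(p + q)) (f h : Pol) (x y : cochains) (c : E).

Lemma PactM g f h : Pact g (f * h) = Pact g f * Pact g h.
Proof. by rewrite /Pact rmorphM. Qed.

Lemma mxvec_index_eq (l j : 'I_(p + q)) (i' i : 'I_k) :
  (mxvec_index l i' == mxvec_index j i) = (l == j) && (i' == i).
Proof.
apply/eqP/andP=> [e|[/eqP -> /eqP -> //]].
(* The indicator matrix of the position [(j, i)] recovers both indices from the flattened one. *)
have := congr1 (mxvec (\matrix_(a, b) ((a == j) && (b == i))) 0) e.
by rewrite !mxvecE !mxE !eqxx => /andP.
Qed.

Lemma mderiv_zmat l i' j i : (zmat R p q k l i')^`M(idx j i) =
  ((l == j) && (i' == i))%:R%:MP.
Proof. by rewrite mxE mderivXU mxvec_index_eq. Qed.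

Lemma mderiv_Pact g j i f : (Pact g f)^`M(idx j i) =
  \sum_l (invmx g l j)%:C%C *: Pact g (f^`M(idx l i)).
Proof.
rewrite /Pact; set t := [tuple _ | _ < _].
have tE l i' : tnth t (idx l i') = \sum_m (invmx g l m)%:C%C *: (zmat R p q k m i').
  by rewrite tnth_mktuple mxvecE mxE; apply: eq_bigr => m _; rewrite mxE mul_mpolyC.
rewrite mderiv_comp (reindex _ (curry_mxvec_bij _ _)) /=.
transitivity (\sum_l \sum_i' (tnth t (idx l i'))^`M(idx j i) * (f^`M(idx l i') \mPo t)).
  by rewrite pair_bigA; apply: eq_bigr => -[].
apply: eq_bigr => l _; rewrite (bigD1 i) //= big1 ?addr0 => [|i' ii']; rewrite tE.
  rewrite linear_sum (bigD1 j) //= mderivZ mderiv_zmat !eqxx mpolyC1 big1 ?addr0.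
    by rewrite -scalerAl mul1r.
  by move=> m mj; rewrite mderivZ mderiv_zmat (negPf mj) mpolyC0 scaler0.
rewrite linear_sum big1 ?mul0r //= => m _.
by rewrite mderivZ mderiv_zmat (negPf ii') andbF mpolyC0 scaler0.
Qed.

(** This is the chain rule [mderiv_Pact] solved for the derivatives of [f], by orthogonality of
    [g]. *)
Lemma Pact_mderiv g m i f : inK g -> Pact g (f^`M(idx m i)) =
  \sum_j (g j m)%:C%C *: (Pact g f)^`M(idx j i).
Proof.
move=> gK; have gg : g^T *m g = 1%:M.
  have [u [v [uO vO ->]]] := gK.
  rewrite tr_block_mx mulmx_block !trmx0 !(mulmx0, mul0mx) !(addr0, add0r).
  by rewrite !SO_trmx // -scalar_mx_block.
have gF (V : lmodType C) (F : 'I_(p + q) -> V) :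
    \sum_j \sum_l (g^T m j * g j l)%:C%C *: F l = F m.
  rewrite exchange_big (bigD1 m) //= -scaler_suml -rmorph_sum /=.
  have /matrixP/(_ m m) := gg; rewrite [LHS]mxE => ->; rewrite mxE eqxx scale1r.
  rewrite big1 ?addr0 // => l lm; rewrite -scaler_suml -rmorph_sum /=.
  have /matrixP/(_ m l) := gg; rewrite [LHS]mxE => ->; rewrite mxE eq_sym.
  by rewrite (negPf lm) scale0r.
rewrite -[LHS](gF _ (fun l => Pact g (f^`M(idx l i)))); apply: eq_bigr => j _.
rewrite mderiv_Pact scaler_sumr; apply: eq_bigr => l _.
by rewrite inK_inv // !mxE scalerA rmorphM.
Qed.

(* The adjoint of multiplication by qpoly c for the Fischer product. *)
Definition lap c (f : Pol) : Pol :=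
  \sum_i (f^`M(idx (rshift p c.2) i))^`M(idx (lshift q c.1) i).

Lemma lap_linear c : linear (lap c).
Proof.
move=> a f h; rewrite /lap scaler_sumr -big_split; apply: eq_bigr => i _ /=.
by rewrite !linearP.
Qed.

Definition qmul c (f : Pol) : Pol := @Defs.qpoly R p q k c * f.

Lemma qmul_linear c : linear (qmul c).
Proof. by move=> a f h; rewrite /qmul mulrDr scalerAr. Qed.

Lemma Pact_lap g c f : inK g ->
  Pact g (lap c f) = \sum_c' coadC g c c' *: lap c' (Pact g f).
Proof.
move=> gK; have [u [v [_ _ gE]]] := gK; rewrite gE in gK *.
have Pl := @Pact_linear R p q k (block_mx u 0 0 v).
under [RHS]eq_bigr do rewrite /lap scaler_sumr.
rewrite [RHS]exchange_big /lap (lin_sum Pl) /=; apply: eq_bigr => i _.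
rewrite Pact_mderiv // big_split_ord /= [X in _ + X]big1 ?addr0 => [|m _]; last first.
  by rewrite block_mxEdl mxE scale0r.
rewrite -(pair_bigA _ (fun a m => coadC _ c (a, m) *: mderiv (idx (lshift q a) i)
  (mderiv (idx (rshift p m) i) (Pact (block_mx u 0 0 v) f)))) /=.
apply: eq_bigr => a _; rewrite Pact_mderiv // big_split_ord /= big1 ?add0r => [|m _].
  rewrite (lin_sum (@mderiv_is_linear _ _ (idx (lshift q a) i))) scaler_sumr.
  apply: eq_bigr => m _ /=.
  rewrite mderivZ scalerA -rmorphM block_mxEul block_mxEdr.
  by rewrite /coadC coadjoint_block.
by rewrite block_mxEur mxE scale0r.
Qed.

Lemma Pact_qmul g c f : inK g ->
  Pact g (qmul c f) = \sum_c' coadC g c c' *: qmul c' (Pact g f).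
Proof.
move=> gK; rewrite /qmul PactM; have [u [v [_ _ gE]]] := gK; rewrite gE in gK *.
rewrite Pact_qpoly // mulr_suml; apply: eq_bigr => c' _.
by rewrite -scalerAl /coadC coadjoint_block.
Qed.

Definition d0 x : cochains := \sum_c extmul c (cmap (qmul c) x).
Definition d1 x : cochains := \sum_c extmul c (cmap (lap c) x).
Definition d0s x : cochains := \sum_c contract c (cmap (lap c) x).

Lemma d0_linear : linear d0.
Proof.
move=> a x y; rewrite /d0 scaler_sumr -big_split; apply: eq_bigr => c _ /=.
by rewrite (cmap_linear (@qmul_linear c)) extmul_linear.
Qed.

Lemma d1_linear : linear d1.
Proof.
move=> a x y; rewrite /d1 scaler_sumr -big_split; apply: eq_bigr => c _ /=.
by rewrite (cmap_linear (@lap_linear c)) extmul_linear.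
Qed.

Lemma d0s_linear : linear d0s.
Proof.
move=> a x y; rewrite /d0s scaler_sumr -big_split; apply: eq_bigr => c _ /=.
by rewrite (cmap_linear (@lap_linear c)) contract_linear.
Qed.

Lemma diffE x : diff x = d1 x - d0 x.
Proof.
have cE c : extmul c (cmap (lap c) x) - extmul c (cmap (qmul c) x) =
    \sum_(i < k) extmul c [ffun S => weil c.1 c.2 i (x S)].
  rewrite -(linB (@extmul_linear _ _ _ c)) -(lin_sum (@extmul_linear _ _ _ c)).
  congr (extmul _ _); apply/ffunP=> S; rewrite sum_ffunE [LHS]ffunE [X in _ + X]ffunE !cmapE.
  under [RHS]eq_bigr do rewrite ffunE /weil.
  by rewrite sumrB /lap /qmul /Defs.qpoly mulr_suml.
rewrite /d1 /d0 -sumrB (eq_bigr _ (fun c _ => cE c)) exchange_big /diff /=.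
apply: eq_bigr => i _; rewrite pair_bigA /=; apply: eq_bigr => -[a m] _ //.
Qed.

Lemma Kact_d0 g x : inK g -> Kact g (d0 x) = d0 (Kact g x).
Proof.
move=> gK; apply: Kact_sum => // [c|c|c y|c f].
- exact: extmul_linear.
- exact: qmul_linear.
- exact: Kact_extmul.
- exact: Pact_qmul.
Qed.

Lemma Kact_d1 g x : inK g -> Kact g (d1 x) = d1 (Kact g x).
Proof.
move=> gK; apply: Kact_sum => // [c|c|c y|c f].
- exact: extmul_linear.
- exact: lap_linear.
- exact: Kact_extmul.
- exact: Pact_lap.
Qed.

Lemma Kact_d0s g x : inK g -> Kact g (d0s x) = d0s (Kact g x).
Proof.
move=> gK; apply: Kact_sum => // [c|c|c y|c f].
- exact: contract_linear.
- exact: lap_linear.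
- exact: Kact_contract.
- exact: Pact_lap.
Qed.

End PolynomialAction.

(** * Harmonic projection *)

Section HermitianForms.
Import Order.TTheory Num.Theory.
Variables (C : numClosedFieldType) (V : lmodType C) (B : V -> V -> C).
Hypotheses (Bl : forall y a x x', B (a *: x + x') y = a * B x y + B x' y).
Hypotheses (Bherm : forall x y, B y x = (B x y)^*).
Hypotheses (Bdef : forall x, B x x = 0 -> x = 0).

(** The span is described by the submodules containing it, so that no coefficients are carried
    along: orthogonality or membership in an image follows by instantiating [W]. *)
Definition in_span (s : seq V) (x : V) : Prop :=
  forall W : submodule V, (forall e, e \in s -> W e) -> W x.

Lemma form0l y : B 0 y = 0.
Proof. by have := Bl y (-1) 0 0; rewrite scaler0 addr0 mulN1r addNr. Qed.

Lemma formr a x y y' : B x (a *: y + y') = a^* * B x y + B x y'.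
Proof. by rewrite Bherm Bl rmorphD rmorphM /= -!Bherm. Qed.

Lemma form0r x : B x 0 = 0.
Proof. by rewrite Bherm form0l conjC0. Qed.

Definition orthogonal_submodule (x : V) : submodule V.
Proof.
refine (@Submodule _ _ (fun y => B x y = 0) (form0r x) _).
by move=> a u v xu xv; rewrite formr xu xv mulr0 addr0.
Defined.

(** Gram-Schmidt: [a] is replaced by its component [b] orthogonal to the earlier vectors. Either [b]
    vanishes and nothing changes, or definiteness allows division by [B b b]. *)
Lemma orthogonal_projection (s : seq V) x :
  exists w, in_span s w /\ forall e, e \in s -> B (x - w) e = 0.
Proof.
elim: s x => [|a s IHs] x.
  by exists 0; split=> // W _; exact: submod0.
have [a0 [sa0 a0s]] := IHs a; have [w [sw ws]] := IHs x.
pose b := a - a0; pose y := x - w.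
have Us : forall t, in_span s t -> in_span (a :: s) t.
  by move=> t st W We; apply: st => e es; apply: We; rewrite inE es orbT.
have orth z t : (forall e, e \in s -> B z e = 0) -> in_span s t -> B z t = 0.
  by move=> zs st; apply: (st (orthogonal_submodule z)).
have aE : a = 1 *: b + a0 by rewrite scale1r subrK.
have [b0|b_neq0] := eqVneq b 0.
  exists w; split=> [|e]; first exact: Us.
  rewrite inE => /orP[/eqP ->|]; last exact: ws.
  by rewrite aE formr b0 form0r mulr0 add0r; exact: orth.
have Bb : B b b != 0 by apply: contra_neq b_neq0; exact: Bdef.
pose c := B y b / B b b; exists (c *: b + w); split.
  move=> W We; apply: submodP; last exact: Us.
  rewrite /b -[a]scale1r -[_ - _]addrC -scaleN1r; apply: submodP; first exact: Us.
  by rewrite scale1r; apply: We; rewrite mem_head.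
have yE : x - (c *: b + w) = (- c) *: b + y by rewrite scaleNr opprD addrCA addrA addrAC.
have Ho e : e \in s -> B (x - (c *: b + w)) e = 0.
  by move=> es; rewrite yE Bl a0s // ws // mulr0 addr0.
move=> e; rewrite inE => /orP[/eqP ->|]; last exact: Ho.
rewrite aE formr [B _ a0]orth // addr0 yE Bl mulNr divfK // addNr mulr0 //.
Qed.

Variables (T Ts : V -> V).
Hypotheses (Tl : linear T) (Tsl : linear Ts).
Hypothesis adj : forall x y, B (T x) y = B x (Ts y).

Definition image_submodule (W : submodule V) : submodule V.
Proof.
refine (@Submodule _ _ (fun y => exists2 x, W x & y = T x) _ _).
  by exists 0; [exact: submod0 | rewrite (lin0 Tl)].
move=> a u v [x Wx ->] [y Wy ->]; exists (a *: x + y); first exact: submodP.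
by rewrite Tl.
Defined.

(** The residue of [x] after projection to [T W] is orthogonal to [T W], so its image under [Ts] is
    orthogonal to [W]. That image also lies in [W], hence is orthogonal to itself and vanishes. *)
Lemma hodge_projection (W : submodule V) (s : seq V) x :
    (forall e, e \in s -> W e) -> (forall u, W u -> in_span s u) ->
    (forall u, W u -> W (Ts (T u))) -> W (Ts x) ->
  exists2 u, W u & Ts (x - T u) = 0.
Proof.
move=> sW Ws WT Wx; have [w [sw ws]] := orthogonal_projection (map T s) x.
have [|u Wu wE] := sw (image_submodule W).
  by move=> e /mapP[e' /sW e'W ->]; exists e'.
exists u => //; apply: Bdef; rewrite -wE.
have Wh : W (Ts (x - w)).
  rewrite (linB Tsl) addrC -scaleN1r; apply: submodP; last by [].
  by rewrite wE; exact: WT.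
apply: (Ws _ Wh (orthogonal_submodule (Ts (x - w)))) => e es /=.
by rewrite Bherm -adj -Bherm ws // map_f.
Qed.

Lemma harmonic_image0 x u : x = T u -> Ts x = 0 -> x = 0.
Proof. by move=> xE x0; apply: Bdef; rewrite {1}xE adj x0 form0r. Qed.

End HermitianForms.

(** * The Fischer inner product *)

Section Fischer.
Import Order.TTheory Num.Theory.
Variables (C : numClosedFieldType) (n : nat).
Implicit Types (f h : {mpoly C[n]}) (m : 'X_{1..n}).

Definition mfact m : C := (\prod_i (m i)`!)%:R.

(** This is [f], with its variables replaced by derivatives, applied to the conjugate of [h] and
    evaluated at 0. The factorials make multiplication by a variable adjoint to the derivative. *)
Definition fischer f h : C := \sum_(m <- msupp f) mfact m * (f@_m * (h@_m)^*).

Lemma mfactU m j : mfact (U_(j) + m) = (m j).+1%:R * mfact m.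
Proof.
rewrite /mfact -natrM (bigD1 j) //= [in RHS](bigD1 j) //= mulnA.
rewrite mnmDE mnm1E eqxx add1n factS; congr ((_ * _)%:R).
by apply: eq_bigr => i ij; rewrite mnmDE mnm1E eq_sym (negPf ij).
Qed.

Lemma mfact_gt0 m : 0 < mfact m.
Proof. by rewrite /mfact ltr0n prodn_gt0 // => i; exact: fact_gt0. Qed.

Lemma fischerE (r : seq 'X_{1..n}) f h : uniq r -> {subset msupp f <= r} ->
  fischer f h = \sum_(m <- r) mfact m * (f@_m * (h@_m)^*).
Proof.
move=> ur fr; rewrite (bigID (mem (msupp f))) /= [X in _ + X]big1 ?addr0 => [|m mf].
  rewrite -big_filter; apply: perm_big; apply: uniq_perm.
  - exact: msupp_uniq.
  - exact: filter_uniq.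
  by move=> m; rewrite mem_filter; case: (boolP (m \in msupp f)) => // /fr ->.
by rewrite (memN_msupp_eq0 mf) mul0r mulr0.
Qed.

Lemma fischer_linearl h a f f' :
  fischer (a *: f + f') h = a * fischer f h + fischer f' h.
Proof.
pose r := undup (msupp f ++ msupp f' ++ msupp (a *: f + f')).
have rE g : {subset msupp g <= msupp f ++ msupp f' ++ msupp (a *: f + f')} ->
    fischer g h = \sum_(m <- r) mfact m * (g@_m * (h@_m)^*).
  by move=> gr; apply: fischerE; rewrite ?undup_uniq // => m /gr; rewrite mem_undup.
rewrite !rE => [|m mm|m mm|m mm]; rewrite ?mem_cat ?mm ?orbT //.
rewrite mulr_sumr -big_split /=; apply: eq_bigr => m _.
rewrite mcoeffD mcoeffZ; ring.
Qed.

Lemma fischer_herm f h : fischer h f = (fischer f h)^*.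
Proof.
pose r := undup (msupp f ++ msupp h).
rewrite !(@fischerE r) ?undup_uniq // => [|m mm|m mm]; rewrite ?mem_undup ?mem_cat ?mm ?orbT //.
rewrite rmorph_sum; apply: eq_bigr => m _ /=.
by rewrite /mfact !rmorphM /= conjCK rmorph_nat [X in _ = _ * X]mulrC.
Qed.

Lemma fischer_ge0 f : 0 <= fischer f f.
Proof.
by apply: sumr_ge0 => m _; rewrite mulr_ge0 ?mul_conjC_ge0 // ltW ?mfact_gt0.
Qed.

Lemma fischer_def f : fischer f f = 0 -> f = 0.
Proof.
move=> f0; apply/mpolyP=> m; rewrite mcoeff0; apply/eqP; rewrite mcoeff_eq0.
apply/negP=> mf; have := f0; rewrite /fischer (bigD1_seq m) ?msupp_uniq //=.
have ge0 m' : 0 <= mfact m' * (f@_m' * (f@_m')^*).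
  by rewrite mulr_ge0 ?mul_conjC_ge0 // ltW ?mfact_gt0.
move/eqP; rewrite paddr_eq0 ?sumr_ge0 // => /andP[].
by rewrite mulf_eq0 (gt_eqF (mfact_gt0 m)) mul_conjC_eq0 /= mcoeff_eq0 mf.
Qed.

Lemma fischerX m h : fischer 'X_[m] h = mfact m * (h@_m)^*.
Proof. by rewrite /fischer msuppX big_seq1 mcoeffX eqxx mul1r. Qed.

Lemma fischer_adj j f h : fischer ('X_j * f) h = fischer f h^`M(j).
Proof.
elim/mpolyind: f => [|c m f _ _ IHf]; first by rewrite mulr0 /fischer msupp0 !big_nil.
rewrite mulrDr -scalerAr !fischer_linearl IHf -mpolyXD !fischerX; congr (_ * _ + _).
rewrite mfactU mcoeff_deriv rmorphMn /= addmC -mulr_natl; ring.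
Qed.

End Fischer.

Section ExteriorFischer.
Import Order.TTheory Num.Theory.
Variables (C : numClosedFieldType) (E : finType) (n : nat).
Local Notation V := (ext E {mpoly C[n]}).
Implicit Types (x y : V).

Definition efischer x y : C := \sum_(S : {set E}) fischer (x S) (y S).

Lemma efischer_linearl y a x x' :
  efischer (a *: x + x') y = a * efischer x y + efischer x' y.
Proof.
rewrite /efischer mulr_sumr -big_split; apply: eq_bigr => S _ /=.
by rewrite !ffunE fischer_linearl.
Qed.

Lemma efischer_herm x y : efischer y x = (efischer x y)^*.
Proof. by rewrite /efischer rmorph_sum; apply: eq_bigr => S _; exact: fischer_herm. Qed.

Lemma efischer_def x : efischer x x = 0 -> x = 0.
Proof.
move/eqP; rewrite psumr_eq0 => [/allP x0|S _]; last exact: fischer_ge0.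
apply/ffunP=> S; rewrite [RHS]ffunE; apply: fischer_def; apply/eqP.
by apply: (x0 S); rewrite mem_index_enum.
Qed.

Lemma efischer_sumr I (r : seq I) x (F : I -> V) :
  efischer x (\sum_(i <- r) F i) = \sum_(i <- r) efischer x (F i).
Proof.
elim: r => [|i r IHr].
  by rewrite !big_nil (form0r efischer_linearl efischer_herm).
rewrite !big_cons -IHr -[F i]scale1r (formr efischer_linearl efischer_herm).
by rewrite conjC1 mul1r scale1r.
Qed.

Lemma efischer_extmul c x y : efischer (extmul c x) y = efischer x (contract c y).
Proof.
rewrite /efischer (bigID (fun S : {set E} => c \in S)) /= addrC big1 ?add0r => [|S cS]; last first.
  by rewrite extmulE (negPf cS) /fischer msupp0 big_nil.
rewrite [RHS](bigID (fun S : {set E} => c \in S)) /= [X in _ = X + _]big1 ?add0r => [|S cS];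
  last first.
  rewrite ffunE cS fischer_herm /fischer msupp0 big_nil; exact: conjC0.
(* The nonzero terms on the left sit at sets containing [c], those on the right at sets avoiding it;
   adding [c] matches them, and the two signs agree. *)
rewrite (reindex_onto (fun S => c |: S) (fun S => S :\ c)) /=; last first.
  by move=> S cS; rewrite setD1K.
rewrite (eq_bigl _ _ (_ : _ =1 (fun S : {set E} => c \notin S))) => [|S].
  apply: eq_bigr => S cS; rewrite extmulE setU11 ffunE (negPf cS) setU1K //.
  have := fischer_linearl (y (c |: S)) (esign C (c |: S) c) (x S) 0.
  rewrite addr0 => ->; rewrite [X in _ + X]/fischer msupp0 big_nil addr0.
  rewrite [RHS]fischer_herm; have := fischer_linearl (x S) (esign C S c) (y (c |: S)) 0.
  rewrite addr0 => ->; rewrite [X in _ + X]/fischer msupp0 big_nil addr0.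
  rewrite rmorphM /= -fischer_herm esignU1 // ltnn expr0 mul1r; congr (_ * _).
  by rewrite rmorphXn rmorphN1.
by rewrite setU11 /=; apply/eqP/idP => [<-|/setU1K //]; rewrite setD11.
Qed.

Lemma efischer_cmap (f f' : {mpoly C[n]} -> {mpoly C[n]}) x y :
  (forall a b, fischer (f a) b = fischer a (f' b)) ->
  efischer (cmap f x) y = efischer x (cmap f' y).
Proof. by move=> ff'; apply: eq_bigr => S _; rewrite !cmapE. Qed.

End ExteriorFischer.

(** * Weights, truncation and division by monomials *)

Section Monomials.
Variables (C : comNzRingType) (n : nat).
Implicit Types (f h : {mpoly C[n]}) (m u : 'X_{1..n}).

Lemma mcoeff_mulX u f m :
  ('X_[u] * f)@_m = if (u <= m)%MM then f@_(m - u) else 0.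
Proof.
rewrite mulrC; case: ifP => um; first by rewrite -{1}(submK um) addmC mcoeffMX.
apply/eqP; rewrite mcoeff_eq0 (perm_mem (msuppMX _ _)); apply/negP.
by case/mapP=> m' _ mE; move/negP: um; apply; rewrite mE lem_addr.
Qed.

Definition mfilter (P : pred 'X_{1..n}) f : {mpoly C[n]} :=
  \sum_(m <- msupp f | P m) f@_m *: 'X_[m].

Lemma mcoeff_mfilter P f m : (mfilter P f)@_m = if P m then f@_m else 0.
Proof.
rewrite /mfilter linear_sum /=; case: (boolP (m \in msupp f)) => mf; last first.
  rewrite (memN_msupp_eq0 mf) if_same big1_seq // => m' /andP[_ m'f].
  rewrite mcoeffZ mcoeffX; case: eqP => [m'm|_]; last by rewrite mulr0.
  by rewrite m'm (negPf mf) in m'f.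
rewrite -big_filter; case: ifP => Pm.
  rewrite (bigD1_seq m) ?filter_uniq ?msupp_uniq ?mem_filter ?Pm //=.
  rewrite mcoeffZ mcoeffX eqxx mulr1 big1 ?addr0 // => m' m'm.
  by rewrite mcoeffZ mcoeffX (negPf m'm) mulr0.
rewrite big1_seq // => m' /andP[_]; rewrite mem_filter => /andP[Pm' _].
rewrite mcoeffZ mcoeffX; case: eqP => [m'm|_]; last by rewrite mulr0.
by rewrite m'm Pm in Pm'.
Qed.

Lemma mfilter_linear P : linear (mfilter P).
Proof.
move=> a f h; apply/mpolyP=> m; rewrite mcoeffD mcoeffZ !mcoeff_mfilter.
by case: ifP => _; rewrite ?mulr0 ?addr0 // mcoeffD mcoeffZ.
Qed.

(** Terms not divisible by ['X_[u]] are dropped, so this is a left inverse of multiplication by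
    ['X_[u]], and ['X_[u] * mdivX u f] is the divisible part of [f]. *)
Definition mdivX u f : {mpoly C[n]} :=
  \sum_(m <- msupp f | (u <= m)%MM) f@_m *: 'X_[m - u].

Lemma mcoeff_mdivX u f m : (mdivX u f)@_m = f@_(m + u).
Proof.
rewrite -[RHS](mcoeffMX _ u) addmC addmC.
have -> : (mdivX u f)@_m = ('X_[u] * mdivX u f)@_(m + u).
  by rewrite mcoeff_mulX lem_addl addmK.
rewrite /mdivX mulr_sumr.
transitivity ((mfilter (fun m' => (u <= m')%MM) f)@_(m + u)); last first.
  by rewrite mcoeff_mfilter lem_addl addmC mcoeffMX.
congr (_@_ _); apply: eq_bigr => m' um'.
by rewrite -scalerAr -mpolyXD addmC submK.
Qed.

Lemma mdivX_linear u : linear (mdivX u).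
Proof.
move=> a f h; apply/mpolyP=> m; rewrite mcoeffD mcoeffZ !mcoeff_mdivX.
by rewrite mcoeffD mcoeffZ.
Qed.

Lemma mdivXK u f : mdivX u ('X_[u] * f) = f.
Proof. by apply/mpolyP=> m; rewrite mcoeff_mdivX mcoeff_mulX lem_addl addmK. Qed.

Lemma mdivXC u (v : 'X_{1..n}) f : (forall i, u i = 0%N \/ v i = 0%N) ->
  mdivX u ('X_[v] * f) = 'X_[v] * mdivX u f.
Proof.
move=> uv; apply/mpolyP=> m; rewrite mcoeff_mdivX !mcoeff_mulX mcoeff_mdivX.
have -> : (v <= m + u)%MM = (v <= m)%MM.
  apply/mnm_lepP/mnm_lepP => vm i; have := vm i; rewrite mnmDE.
    by case: (uv i) => ->; rewrite ?addn0.
  by move/leq_trans; apply; exact: leq_addr.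
case: ifP => [/mnm_lepP vm|//]; congr (_@_ _); apply/mnmP=> i.
by rewrite !(mnmDE, mnmBE) addnBAC.
Qed.

Section Weight.
Variable wt : 'X_{1..n} -> nat.
Hypothesis wtD : forall m m', wt (m + m') = (wt m + wt m')%N.

(** The bound is strict: bound 0 means that [f] is zero, which starts all inductions on weight or
    degree and spares a convention for the zero polynomial. *)
Definition wtlt w f := forall m, (w <= wt m)%N -> f@_m = 0.

Lemma wtlt0 w : wtlt w 0.
Proof. by move=> m _; rewrite mcoeff0. Qed.

Lemma wtltP w a f h : wtlt w f -> wtlt w h -> wtlt w (a *: f + h).
Proof. by move=> wf wh m wm; rewrite mcoeffD mcoeffZ wf // wh // mulr0 addr0. Qed.

Lemma wtltD w f h : wtlt w f -> wtlt w h -> wtlt w (f + h).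
Proof. by move=> wf wh; rewrite -[f]scale1r; exact: wtltP. Qed.

Lemma wtlt_sum w I (r : seq I) (F : I -> {mpoly C[n]}) :
  (forall i, wtlt w (F i)) -> wtlt w (\sum_(i <- r) F i).
Proof.
by move=> wF; elim/big_ind: _ => [|f h|i _]; [exact: wtlt0 | exact: wtltD | exact: wF].
Qed.

Lemma wtlt_le w w' f : (w <= w')%N -> wtlt w f -> wtlt w' f.
Proof. by move=> ww' wf m wm; apply: wf; exact: leq_trans wm. Qed.

Lemma wtlt_mulX w u f : wtlt w f -> wtlt (w + wt u) ('X_[u] * f).
Proof.
move=> wf m wm; rewrite mcoeff_mulX; case: ifP => // um; apply: wf.
by move: wm; rewrite -{1}(submK um) wtD leq_add2r.
Qed.

Lemma wtlt_mdivX w u f : wtlt (w + wt u) f -> wtlt w (mdivX u f).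
Proof. by move=> wf m wm; rewrite mcoeff_mdivX wf // wtD leq_add2r. Qed.

Lemma wtlt_mderiv w j f : wtlt (w + wt U_(j)) f -> wtlt w f^`M(j).
Proof. by move=> wf m wm; rewrite mcoeff_deriv wf ?mul0rn // wtD leq_add2r. Qed.

End Weight.

Lemma wtlt_mdeg d f : wtlt (@mdeg n) d f <-> (msize f <= d)%N.
Proof.
rewrite msizeE; split=> [df|/bigmax_leqP_seq df m dm].
  apply/bigmax_leqP_seq => m mf _; rewrite ltnNge; apply/negP=> /df /eqP.
  by rewrite mcoeff_eq0 mf.
apply/eqP; rewrite mcoeff_eq0; apply/negP=> mf.
by have := df m mf isT; rewrite ltnNge dm.
Qed.

Definition mtail d f := mfilter (fun m => (d <= mdeg m)%N) f.

Lemma mtail_mulX j d f : mtail d.+1 ('X_j * f) = 'X_j * mtail d f.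
Proof.
apply/mpolyP=> m; rewrite mcoeff_mfilter !mcoeff_mulX mcoeff_mfilter.
case: (boolP (U_(j) <= m)%MM) => [jm|]; last by rewrite if_same.
by rewrite -{1}(submK jm) mdegD mdeg1 addn1 ltnS.
Qed.

Lemma mtail_mderiv j d f : mtail d f^`M(j) = (mtail d.+1 f)^`M(j).
Proof.
apply/mpolyP=> m; rewrite mcoeff_mfilter !mcoeff_deriv mcoeff_mfilter.
by rewrite mdegD mdeg1 addn1 ltnS; case: ifP; rewrite ?mul0rn.
Qed.

Lemma mtail_eq0 d f : mtail d f = 0 <-> wtlt (@mdeg n) d f.
Proof.
split=> [f0 m dm|f0]; last first.
  by apply/mpolyP=> m; rewrite mcoeff_mfilter mcoeff0; case: ifP => // /f0.
by have := congr1 (mcoeff m) f0; rewrite mcoeff_mfilter mcoeff0 dm.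
Qed.

End Monomials.

Section Filtration.
Variables (C : comNzRingType) (n : nat) (E : finType).
Local Notation V := (ext E {mpoly C[n]}).
Implicit Types (x y : V) (P : pred {set E}) (d : nat).

Definition filt P d : submodule V.
Proof.
refine (@Submodule _ _
  (fun x => forall S : {set E}, wtlt (@mdeg n) d (x S) /\ (~~ P S -> x S = 0)) _ _).
  by move=> S; rewrite ffunE; split=> // m _; rewrite mcoeff0.
move=> a x y xP yP S; rewrite !ffunE; split; first by apply: wtltP; [case: (xP S) | case: (yP S)].
move=> nP; have [_ ->//] := xP S; have [_ ->//] := yP S; by rewrite scaler0 addr0.
Defined.

Lemma filt_bound (x : V) P : (forall S : {set E}, ~~ P S -> x S = 0) ->
  exists d, filt P d x.
Proof.
move=> xP; exists (\max_(S : {set E}) msize (x S)) => S; split; last exact: xP.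
by apply/wtlt_mdeg; exact: leq_bigmax.
Qed.

Lemma filt_le P d d' x : (d <= d')%N -> filt P d x -> filt P d' x.
Proof. by move=> dd' xP S; have [xd xS] := xP S; split=> //; exact: wtlt_le xd. Qed.

(** Wedges with monomial coefficients of degree below [d] span; this finiteness is what permits
    orthogonal projection. *)
Lemma filt_finite P d : exists s : seq V,
  (forall e, e \in s -> filt P d e) /\
  (forall x, filt P d x -> forall W : submodule V,
    (forall e, e \in s -> W e) -> W x).
Proof.
pose e (i : {set E} * 'X_{1..n < d}) : V := wedge (enum i.1) 'X_[i.2].
exists [seq e i | i <- enum [pred i | P i.1]]; split.
  move=> e0 /mapP[i iP ->] S; move: iP; rewrite mem_enum => Pi; rewrite /e wedge_enum ffunE.
  have [Si|_] := boolP (S == i.1); last by split=> // m' _; rewrite mcoeff0.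
  split; last by move/eqP: Si Pi => -> Pi; rewrite [P _]Pi.
  move=> m' dm'; rewrite mcoeffX; case: eqP => // mm'.
  by move: dm'; rewrite -mm' leqNgt bmdeg.
move=> x xP W We.
have WD a u v : W u -> W v -> W (a *: u + v) by exact: submodP.
have Wsum I (r : seq I) (Q : pred I) F : (forall i, Q i -> W (F i)) -> W (\sum_(i <- r | Q i) F i).
  move=> WF; elim/big_ind: _ => [|u v Wu Wv|i]; [exact: submod0 | | exact: WF].
  by rewrite -[u]scale1r; exact: WD.
rewrite (ext_wedgeE x); apply: (Wsum) => S _; have [xd xS] := xP S.
have [PS|nPS] := boolP (P S); last first.
  by rewrite xS // (lin0 (@wedge_linear _ _ _ _)); exact: submod0.
rewrite [x S](@mpolywE _ _ d); last exact/wtlt_mdeg.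
rewrite (lin_sum (@wedge_linear _ _ _ _)); apply: (Wsum) => m _.
rewrite (linZ (@wedge_linear _ _ _ _)) /= -[_ *: _]addr0; apply: (WD); last exact: submod0.
by apply: We; apply/mapP; exists (S, m) => //; rewrite mem_enum.
Qed.

Lemma filt_cmap P d d' (f : {mpoly C[n]} -> {mpoly C[n]}) x : linear f ->
    (forall h, wtlt (@mdeg n) d h -> wtlt (@mdeg n) d' (f h)) ->
  filt P d x -> filt P d' (cmap f x).
Proof.
move=> fl fd xP S; have [xd xS] := xP S; rewrite cmapE; split; first exact: fd.
by move=> /xS ->; rewrite (lin0 fl).
Qed.

Lemma filt_extmul l d c x : filt (fun S => #|S|.+1 == l) d x ->
  filt (fun S => #|S| == l) d (extmul c x).
Proof.
move=> xP S; rewrite extmulE; have [xd xS] := xP (S :\ c).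
case: ifP => cS; last by split=> // m _; rewrite mcoeff0.
split=> [|nl]; first by move=> m dm; rewrite mcoeffZ xd // mulr0.
by rewrite xS ?scaler0 //; move: nl; rewrite (cardsD1 c) cS.
Qed.

Lemma filt_contract l d c x : filt (fun S => #|S| == l) d x ->
  filt (fun S => #|S|.+1 == l) d (contract c x).
Proof.
move=> xP S; rewrite ffunE; have [xd xS] := xP (c |: S).
case: ifP => cS; first by split=> // m _; rewrite mcoeff0.
split=> [|nl]; first by move=> m dm; rewrite mcoeffZ xd // mulr0.
by rewrite xS ?scaler0 //; move: nl; rewrite cardsU1 cS.
Qed.

End Filtration.

(** * Hodge decomposition for [d0] and its Fischer adjoint *)

Section Hodge.
Variables (R : realType) (p q k : nat).
Local Notation C := (R[i])%C.
Local Notation E := ('I_p * 'I_q)%type.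
Local Notation Pol := (Pol R p q k).
Local Notation cochains := (ext E Pol).
Local Notation N := ((p + q) * k)%N.
Local Notation deg := (@mdeg N).
Local Notation idx j i := (mxvec_index (j : 'I_(p + q)) (i : 'I_k)).
Implicit Types (g : 'M[R]_(p + q)) (f h : Pol) (x y : cochains) (c : E).

Definition homdeg l d : submodule (ext E {mpoly C[N]}) :=
  filt C N (fun S : {set E} => #|S| == l) d.
(* Shifting the degree from this side avoids subtraction when l = 0. *)
Definition homdeg_pred l d : submodule (ext E {mpoly C[N]}) :=
  filt C N (fun S : {set E} => #|S|.+1 == l) d.

Lemma qmulE c f : qmul c f =
  \sum_i 'X_(idx (lshift q c.1) i) * ('X_(idx (rshift p c.2) i) * f).
Proof.
rewrite /qmul /Defs.qpoly mulr_suml; apply: eq_bigr => i _.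
by rewrite /zpos /zneg /zmat !mxE mulrA.
Qed.

Lemma fischer_qmul c f h : fischer (qmul c f) h = fischer f (lap c h).
Proof.
rewrite qmulE /lap.
have Fl I (r : seq I) (G : I -> {mpoly C[N]}) b :
    fischer (\sum_(i <- r) G i) b = \sum_(i <- r) fischer (G i) b.
  elim: r => [|i r IHr]; first by rewrite !big_nil /fischer msupp0 big_nil.
  by rewrite !big_cons -IHr -[G i]scale1r fischer_linearl mul1r scale1r.
rewrite Fl; transitivity (\sum_i fischer f
    (mderiv (idx (rshift p c.2) i) (mderiv (idx (lshift q c.1) i) h))).
  by apply: eq_bigr => i _; rewrite !fischer_adj.
rewrite [RHS]fischer_herm Fl rmorph_sum; apply: eq_bigr => i _ /=.
by rewrite -fischer_herm mderiv_comm.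
Qed.

Lemma efischer_d0 x y : efischer (d0 x) y = efischer x (d0s y).
Proof.
rewrite /d0s efischer_sumr efischer_herm efischer_sumr rmorph_sum.
apply: eq_bigr => c _ /=; rewrite -efischer_herm efischer_extmul.
rewrite -cmap_contract; last exact: lap_linear.
by rewrite (efischer_cmap _ _ (@fischer_qmul c)).
Qed.

Lemma wtlt_qmul d c f : wtlt deg d f -> wtlt deg d.+2 (qmul c f).
Proof.
move=> fd; rewrite qmulE; apply: wtlt_sum => i.
have X1 e j h : wtlt deg e h -> wtlt deg e.+1 ('X_j * h).
  by move=> he; rewrite -addn1 -(mdeg1 j); apply: wtlt_mulX => //; exact: mdegD.
by apply: (X1); apply: (X1).
Qed.

Lemma wtlt_lap d c f : wtlt deg d.+2 f -> wtlt deg d (lap c f).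
Proof.
move=> fd; apply: wtlt_sum => i.
have D1 e j h : wtlt deg e.+1 h -> wtlt deg e h^`M(j).
  by move=> he; apply: (wtlt_mderiv (@mdegD N)); rewrite mdeg1 addn1.
by apply: (D1); apply: (D1).
Qed.

Lemma hom_sum (I : Type) (r : seq I) (W : submodule cochains) (F : I -> cochains) :
  (forall i, W (F i)) -> W (\sum_(i <- r) F i).
Proof.
move=> WF; elim/big_ind: _ => // [|u v Wu Wv]; first exact: submod0.
by rewrite -[u]scale1r; exact: submodP.
Qed.

Lemma d0_hom l d x : homdeg_pred l d x -> homdeg l d.+2 (d0 x).
Proof.
move=> xl; apply: hom_sum => c; apply: filt_extmul; apply: filt_cmap xl.
  exact: qmul_linear.
exact: wtlt_qmul.
Qed.

Lemma d1_hom l d x : homdeg_pred l d.+2 x -> homdeg l d (d1 x).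
Proof.
move=> xl; apply: hom_sum => c; apply: filt_extmul; apply: filt_cmap xl.
  exact: lap_linear.
exact: wtlt_lap.
Qed.

Lemma d0s_hom l d x : homdeg l d.+2 x -> homdeg_pred l d (d0s x).
Proof.
move=> xl; apply: hom_sum => c; apply: filt_contract; apply: filt_cmap xl.
  exact: lap_linear.
exact: wtlt_lap.
Qed.

Local Notation BL := (@efischer_linearl C E N).
Local Notation BH := (@efischer_herm C E N).
Local Notation BD := (@efischer_def C E N).

Lemma harmonic_d0_eq0 (h u : cochains) : d0s h = 0 -> h = d0 u -> h = 0.
Proof. by move=> h0 hE; exact: (harmonic_image0 BL BH BD efischer_d0 hE h0). Qed.

Lemma efischer_d0s x y : efischer (d0s x) y = efischer x (d0 y).
Proof. by rewrite efischer_herm -efischer_d0 -efischer_herm. Qed.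

(** The shift by two makes [homdeg_pred l d] stable under [d0s] after [d0], as the projection
    requires. *)
Lemma hodge l d x : homdeg l d.+2 x ->
  exists2 u, homdeg_pred l d u & d0s (x - d0 u) = 0.
Proof.
move=> xl; have [s [sW Ws]] := filt_finite C N (fun S : {set E} => #|S|.+1 == l) d.
apply: (hodge_projection BL BH BD (@d0_linear R p q k) (@d0s_linear R p q k) efischer_d0 sW Ws).
- by move=> u /d0_hom/d0s_hom.
- exact: d0s_hom.
Qed.

(** With the roles of the adjoints exchanged, [u] may be replaced by an element of the image of
    [d0s] without changing [d0 u]; such a primitive is unique. *)
Lemma hodge_dual l d u : homdeg_pred l d u ->
  exists2 v, homdeg l d.+2 v & d0 (u - d0s v) = 0.
Proof.
move=> ul; have [s [sW Ws]] := filt_finite C N (fun S : {set E} => #|S| == l) d.+2.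
apply: (hodge_projection BL BH BD (@d0s_linear R p q k) (@d0_linear R p q k) efischer_d0s sW Ws).
- by move=> v /d0s_hom/d0_hom.
- exact: d0_hom.
Qed.

Definition Kinvariant x := forall g, inK g -> Kact g x = x.

(* Both components are unique once y is taken in the image of d0s, hence they
   inherit the invariance of x; this replaces averaging over K. *)
Lemma hodge_invariant l d x : homdeg l d.+2 x -> Kinvariant x ->
  exists y (h : cochains), [/\ homdeg_pred l d y, Kinvariant y, homdeg l d.+2 h, Kinvariant h &
    d0s h = 0 /\ x = d0 y + h].
Proof.
move=> xl xi; have [u ul u0] := hodge xl; have [v vl v0] := hodge_dual ul.
pose y := d0s v; pose h := x - d0 y.
have d0u : d0 u = d0 y by apply/eqP; rewrite -subr_eq0 -(linB (@d0_linear R p q k)) v0.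
have h0 : d0s h = 0 by rewrite /h -d0u.
have yl : homdeg_pred l d y by exact: d0s_hom.
have xE : x = d0 y + h := esym (subrKC (d0 y) x).
have d0yE : d0 y = x - h := esym (subKr x (d0 y)).
have yi : Kinvariant y.
  move=> g gK; apply/eqP; rewrite -subr_eq0; apply/eqP.
  have yE : Kact g y - y = d0s (Kact g v - v).
    by rewrite (linB (@d0s_linear R p q k)) -Kact_d0s.
  (* The difference lies in the image of [d0s], so it vanishes once [d0] kills it. Its image under
     [d0] is [h - Kact g h], which [d0s] kills, so the same principle applies again. *)
  apply: (harmonic_image0 BL BH BD efischer_d0s yE).
  apply: (harmonic_image0 BL BH BD efischer_d0 erefl).
  have -> : d0 (Kact g y - y) = h - Kact g h.
    rewrite (linB (@d0_linear R p q k)) -(Kact_d0 y gK) d0yE.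
    by rewrite (linB (@Kact_linear R p q k g)) (xi g gK) opprB addrC addrA subrK.
  rewrite (linB (@d0s_linear R p q k)) -(Kact_d0s h gK) h0.
  by rewrite (lin0 (@Kact_linear R p q k g)) subr0.
have hl : homdeg l d.+2 h.
  have -> : h = -1 *: d0 y + x by rewrite scaleN1r addrC.
  by apply: submodP; [exact: d0_hom | exact: xl].
have hi : Kinvariant h.
  move=> g gK; rewrite [in LHS]/h (linB (@Kact_linear R p q k g)) (xi g gK).
  by rewrite (Kact_d0 y gK) (yi g gK).
by exists y, h; split; [exact: yl | exact: yi | exact: hl | exact: hi | split].
Qed.

End Hodge.

(** * Exactness of the Koszul complex *)

Section Koszul.
Variables (C : numClosedFieldType) (E : finType) (n : nat).
Local Notation V := (ext E {mpoly C[n]}).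
Variables (u : E -> 'X_{1..n}) (r : E -> {mpoly C[n]}) (wt : 'X_{1..n} -> nat).
Hypothesis wtD : forall m m', wt (m + m') = (wt m + wt m')%N.
Hypothesis wt_u : forall c, wt (u c) = 2%N.
Hypothesis u_disjoint : forall b c, b != c -> forall i, u b i = 0%N \/ u c i = 0%N.
Hypothesis wt_r : forall c w f, wtlt wt w f -> wtlt wt w.+1 (r c * f).
Implicit Types (x y : V) (b c : E) (f : {mpoly C[n]}).

Definition kmul c f := ('X_[u c] + r c) * f.
Definition koszul x : V := \sum_c extmul c (cmap (kmul c) x).

Lemma kmul_linear c : linear (kmul c).
Proof. by move=> a f h; rewrite /kmul mulrDr scalerAr. Qed.

Lemma koszul_linear : linear koszul.
Proof.
move=> a x y; rewrite /koszul scaler_sumr -big_split; apply: eq_bigr => c _ /=.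
by rewrite (cmap_linear (@kmul_linear c)) extmul_linear.
Qed.

Lemma koszul_sqr x : koszul (koszul x) = 0.
Proof.
rewrite -[RHS](@extmul2_sym C E E _ id (fun b c => cmap (kmul b) (cmap (kmul c) x))).
  rewrite {1}/koszul; apply: eq_bigr => b _; rewrite -(lin_sum (@extmul_linear _ _ _ b)).
  rewrite (lin_sum (cmap_linear (@kmul_linear b))); congr (extmul b _).
  by apply: eq_bigr => c _; rewrite cmap_extmul //; exact: kmul_linear.
by move=> b c; rewrite !cmap_comp; apply: eq_cmap => f; rewrite /= /kmul; ring.
Qed.

Definition udiv c f := mdivX (u c) f.

Lemma udiv_linear c : linear (udiv c). Proof. exact: mdivX_linear. Qed.

(** Contraction by [c] anticommutes with every wedge factor except that of [c], where it leaves
    multiplication by the [c]-th entry of the sequence. *)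
Lemma koszul_contract c x : koszul (contract c x) = cmap (kmul c) x - contract c (koszul x).
Proof.
rewrite /koszul (lin_sum (@contract_linear _ _ _ c)).
have E1 b : contract c (extmul b (cmap (kmul b) x)) =
    (c == b)%:R *: cmap (kmul b) x - extmul b (cmap (kmul b) (contract c x)).
  by rewrite contract_extmulE cmap_contract //; exact: kmul_linear.
have E2 : \sum_b (c == b)%:R *: cmap (kmul b) x = cmap (kmul c) x.
  rewrite (bigD1 c) //= eqxx scale1r big1 ?addr0 // => b bc.
  by rewrite eq_sym (negPf bc) scale0r.
by rewrite (eq_bigr _ (fun b _ => E1 b)) sumrB E2 subKr.
Qed.

Lemma kmul_udiv c f : kmul c (udiv c f) - udiv c (kmul c f) =
  - (f - 'X_[u c] * udiv c f) + (r c * udiv c f - udiv c (r c * f)).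
Proof.
rewrite /kmul [in X in _ - X]mulrDl (linD (@udiv_linear c)) /=.
by rewrite [udiv c ('X_[u c] * f)]mdivXK; ring.
Qed.

Lemma kmul_udivC b c f : b != c -> kmul b (udiv c f) - udiv c (kmul b f) =
  r b * udiv c f - udiv c (r b * f).
Proof.
move=> bc; rewrite /kmul [in X in _ - X]mulrDl (linD (@udiv_linear c)) /=.
rewrite [udiv c ('X_[u b] * f)]mdivXC; first by rewrite -/(udiv c f); ring.
by apply: u_disjoint; rewrite eq_sym.
Qed.

(** It collects the terms in which a remainder [r b] occurs. *)
Definition kerr c x : V := contract c (\sum_b extmul b
  (cmap (fun f => r b * udiv c f - udiv c (r b * f)) x)) -
  cmap (fun f => r c * udiv c f) x.

(** Division by ['X_[u c]] followed by contraction is a homotopy in direction [c]. Division commutes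
    with the other leading monomials, which use other variables, so up to [kerr] only terms
    containing [c] with coefficients free of multiples of ['X_[u c]] remain. *)
Lemma koszul_step c x : koszul x = 0 ->
  x - koszul (contract c (cmap (udiv c) x)) =
  extmul c (contract c (cmap (fun f => f - 'X_[u c] * udiv c f) x)) + kerr c x.
Proof.
move=> Kx; rewrite koszul_contract.
pose z := cmap (fun f => f - 'X_[u c] * udiv c f) x.
have Kd : koszul (cmap (udiv c) x) = - extmul c z + \sum_b extmul b
    (cmap (fun f => r b * udiv c f - udiv c (r b * f)) x).
  have <- : koszul (cmap (udiv c) x) - cmap (udiv c) (koszul x) =
      - extmul c z + \sum_b extmul b (cmap (fun f => r b * udiv c f - udiv c (r b * f)) x).
    rewrite {2}/koszul (lin_sum (cmap_linear (@udiv_linear c))) -sumrB.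
    rewrite [LHS](bigD1 c) // [X in _ = _ + X](bigD1 c) //= addrA; congr (_ + _).
      rewrite cmap_extmul; last exact: udiv_linear.
      rewrite -(linB (@extmul_linear _ _ _ c)) -(linN (@extmul_linear _ _ _ c)).
      rewrite -(linD (@extmul_linear _ _ _ c)); congr extmul.
      by apply/ffunP=> S; rewrite !(cmapE, ffunE); exact: kmul_udiv.
    apply: eq_bigr => b bc; rewrite cmap_extmul; last exact: udiv_linear.
    rewrite -(linB (@extmul_linear _ _ _ b)); congr extmul.
    by apply/ffunP=> S; rewrite !(cmapE, ffunE); exact: kmul_udivC.
  by rewrite Kx (lin0 (cmap_linear (@udiv_linear c))) subr0.
rewrite Kd (linD (@contract_linear _ _ _ c)) (linN (@contract_linear _ _ _ c)).
have -> : cmap (kmul c) (cmap (udiv c) x) = x - z + cmap (fun f => r c * udiv c f) x.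
  by apply/ffunP=> S; rewrite !(cmapE, ffunE) /kmul; ring.
rewrite /kerr; move: (contract c (\sum_b _)) (cmap (fun f => r c * _) x) => t1 t2.
rewrite -/z; move: (contractK c z).
move: (contract c (extmul c z)) (extmul c (contract c z)) => i e <-.
by apply/ffunP=> S; rewrite !ffunE; ring.
Qed.

Definition low w x := forall S, wtlt wt w (x S).

Lemma lowD w x y : low w x -> low w y -> low w (x + y).
Proof. by move=> xw yw S; rewrite ffunE; apply: wtltD. Qed.

Lemma lowN w x : low w x -> low w (- x).
Proof. by move=> xw S m wm; rewrite ffunE mcoeffN xw // oppr0. Qed.

Lemma low_extmul w c x : low w x -> low w (extmul c x).
Proof.
move=> xw S m wm; rewrite extmulE; case: ifP => _; last by rewrite mcoeff0.
by rewrite mcoeffZ xw ?mulr0.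
Qed.

Lemma low_contract w c x : low w x -> low w (contract c x).
Proof.
move=> xw S m wm; rewrite ffunE; case: ifP => _; first by rewrite mcoeff0.
by rewrite mcoeffZ xw ?mulr0.
Qed.

Lemma wtlt0_eq0 f : wtlt wt 0 f -> f = 0.
Proof. by move=> f0; apply/mpolyP=> m; rewrite f0 // mcoeff0. Qed.

Lemma wtlt_r_udiv w b c f : wtlt wt w.+1 f -> wtlt wt w (r b * udiv c f).
Proof.
case: w => [|w] fw.
  (* Below weight 1 no monomial is divisible by ['X_[u c]], which has weight 2. *)
  rewrite /udiv (_ : mdivX _ _ = 0) ?mulr0; first exact: wtlt0.
  apply: wtlt0_eq0; apply: (wtlt_mdivX wtD); rewrite wt_u.
  exact: wtlt_le fw.
by apply: wt_r; apply: (wtlt_mdivX wtD); rewrite wt_u addn2.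
Qed.

Lemma wtlt_udiv_r w b c f : wtlt wt w.+1 f -> wtlt wt w (udiv c (r b * f)).
Proof.
by move=> fw; apply: (wtlt_mdivX wtD); rewrite wt_u addn2; exact: wt_r.
Qed.

(** Multiplication by a remainder raises the weight by at most one while division lowers it by
    two. *)
Lemma low_kerr w c x : low w.+1 x -> low w (kerr c x).
Proof.
move=> xw; apply: lowD.
  apply: low_contract => S; rewrite sum_ffunE; apply: wtlt_sum => b.
  apply: (@low_extmul w b _ _ S) => {}S; rewrite cmapE -scaleN1r addrC.
  by apply: wtltP; [exact: wtlt_udiv_r | exact: wtlt_r_udiv].
by apply: lowN => S; rewrite cmapE; exact: wtlt_r_udiv.
Qed.

Lemma extmul_contractE c x S :
  extmul c (contract c x) S = if c \in S then x S else 0.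
Proof.
rewrite extmulE; case: ifP => // cS; rewrite ffunE setD11 scalerA.
have := esignD1 C c cS; rewrite ltnn expr0 mul1r /esign => ->.
by rewrite -/(esign C S c) esign_sqr scale1r setD1K.
Qed.

Lemma wtlt_udivK w c f : wtlt wt w f -> wtlt wt w (f - 'X_[u c] * udiv c f).
Proof.
move=> fw m wm; rewrite mcoeffB mcoeff_mulX fw // sub0r.
case: ifP => um; last by rewrite oppr0.
by rewrite mcoeff_mdivX submK // fw // oppr0.
Qed.

Lemma koszul_contract_deg l c x : homogeneous l x -> homogeneous l (koszul (contract c x)).
Proof.
move=> xl; rewrite koszul_contract => S Sl.
rewrite !ffunE xl // (lin0 (@kmul_linear c)) sub0r.
case: ifP => cS; rewrite ?oppr0 // sum_ffunE big1 ?scaler0 ?oppr0 // => b _.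
rewrite extmulE; case: ifP => // bS; rewrite cmapE xl ?(lin0 (@kmul_linear b)) ?scaler0 //.
have := cardsD1 b (c |: S); rewrite cardsU1 cS bS !add1n => -[e].
by rewrite -e.
Qed.

(** One [koszul_step] confines the part of weight [w] to sets containing [c]. Later steps keep this,
    since up to lower weight they act on each component separately and only delete terms. *)
Lemma koszul_reduce l w x (t : seq E) :
    homogeneous l x -> koszul x = 0 -> low w.+1 x ->
  exists x' y, [/\ x = koszul y + x', homogeneous l x', koszul x' = 0, low w.+1 x' &
    forall c (S : {set E}), c \in t -> c \notin S -> wtlt wt w (x' S)].
Proof.
move=> xl Kx xw; elim: t => [|c t [x' [y [xE x'l Kx' x'w x't]]]].
  by exists x, 0; rewrite (lin0 koszul_linear) add0r; split.
pose y' := contract c (cmap (udiv c) x').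
pose x1 := x' - koszul y'.
have x1E S : x1 S =
    (if c \in S then x' S - 'X_[u c] * udiv c (x' S) else 0) + kerr c x' S.
  by rewrite /x1 (koszul_step c Kx') ffunE extmul_contractE cmapE.
exists x1, (y + y'); split.
- by rewrite (linD koszul_linear) -addrA [koszul y' + _]addrC subrK.
- move=> S Sl; rewrite /x1 !ffunE x'l // sub0r.
  rewrite (@koszul_contract_deg l) ?oppr0 //.
  by move=> T Tl; rewrite cmapE x'l // (lin0 (@udiv_linear c)).
- by rewrite /x1 (linB koszul_linear) Kx' koszul_sqr subr0.
- move=> S; rewrite x1E; apply: wtltD.
    by case: ifP => _; [exact: wtlt_udivK | exact: wtlt0].
  exact: wtlt_le (low_kerr c x'w S).
move=> b S; rewrite inE x1E => bct bS; apply: wtltD; last exact: low_kerr.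
case: ifP => cS; last exact: wtlt0.
apply: wtlt_udivK; case/orP: bct => [/eqP bc|bt]; last exact: x't bt bS.
by rewrite -bc (negPf bS) in cS.
Qed.

(* Modulo lower weight the differential is that of the monomials 'X_[u c], which
   involve disjoint sets of variables; division by 'X_[u c] contracts it in the
   direction c. *)
Lemma koszul_exact l x : (l < #|E|)%N -> homogeneous l x -> koszul x = 0 ->
  exists y, x = koszul y.
Proof.
move=> lE; pose b := \max_(S : {set E}) \max_(m <- msupp (x S)) (wt m).+1.
have : low b x.
  move=> S m bm; apply/eqP; rewrite mcoeff_eq0; apply/negP=> mx.
  have : ((wt m).+1 <= b)%N.
    apply: leq_trans (leq_bigmax S).
    exact: (leq_bigmax_seq m).
  by rewrite ltnNge bm.
move: b => b; elim: b x => [|w IHw] x xw xl Kx.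
  exists 0; rewrite (lin0 koszul_linear); apply/ffunP=> S; rewrite ffunE.
  exact: wtlt0_eq0.
have [x' [y [-> x'l Kx' x'w x't]]] := koszul_reduce (enum E) xl Kx xw.
have x'w0 : low w x'.
  (* In weight [w] only the full set survives, and its cardinality is not [l]. *)
  move=> S; have [/setP SE|] := eqVneq S setT.
    rewrite x'l; first exact: wtlt0.
    by rewrite (eq_card SE) cardsT neq_ltn lE orbT.
  rewrite -subTset => /subsetPn[c _ cS]; apply: x't cS; exact: mem_enum.
have [y' ->] := IHw _ x'w0 x'l Kx'.
by exists (y + y'); rewrite (linD koszul_linear).
Qed.

End Koszul.

(** * Leading monomials of the quadratic generators *)

Section LeadingMonomials.
Variables (R : realType) (p q k : nat).
Hypothesis hpq : (p * q <= k)%N.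
Local Notation C := (R[i])%C.
Local Notation E := ('I_p * 'I_q)%type.
Local Notation Pol := (Pol R p q k).
Local Notation cochains := (ext E Pol).
Local Notation N := ((p + q) * k)%N.
Local Notation idx j i := (mxvec_index (j : 'I_(p + q)) (i : 'I_k)).
Implicit Types (b c : E) (i : 'I_k) (m : 'X_{1..N}).

Lemma card_pairs : (#|{: E}| <= k)%N.
Proof. by rewrite card_prod !card_ord. Qed.

Definition slot c : 'I_k := widen_ord card_pairs (enum_rank c).

Lemma slot_inj : injective slot.
Proof. by move=> b c /(congr1 val) /= /val_inj /enum_rank_inj. Qed.

Definition leadm c : 'X_{1..N} :=
  (U_(idx (lshift q c.1) (slot c)) + U_(idx (rshift p c.2) (slot c)))%MM.

Definition slot_wt m : nat :=
  (\sum_b (m (idx (lshift q b.1) (slot b)) + m (idx (rshift p b.2) (slot b))))%N.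

Definition tailq c : {mpoly C[N]} :=
  \sum_(i | i != slot c) 'X_[U_(idx (lshift q c.1) i) + U_(idx (rshift p c.2) i)].

Lemma qpoly_lead c : @Defs.qpoly R p q k c = 'X_[leadm c] + tailq c.
Proof.
rewrite /Defs.qpoly (bigD1 (slot c)) //= /zpos /zneg /zmat; congr (_ + _).
  by rewrite !mxE mpolyXD.
by apply: eq_bigr => i _; rewrite !mxE mpolyXD.
Qed.

Lemma slot_wtD m m' : slot_wt (m + m') = (slot_wt m + slot_wt m')%N.
Proof.
by rewrite /slot_wt -big_split; apply: eq_bigr => b _ /=; rewrite !mnmDE addnACA.
Qed.

Lemma slot_wt_pos (a : 'I_p) i :
  slot_wt U_(idx (lshift q a) i) = (\sum_b ((a == b.1) && (i == slot b)))%N.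
Proof.
apply: eq_bigr => b _; rewrite !mnm1E !mxvec_index_eq eq_lshift eq_lrshift.
by rewrite addn0.
Qed.

Lemma slot_wt_neg (a : 'I_q) i :
  slot_wt U_(idx (rshift p a) i) = (\sum_b ((a == b.2) && (i == slot b)))%N.
Proof.
apply: eq_bigr => b _; rewrite !mnm1E !mxvec_index_eq eq_rshift eq_rlshift.
by [].
Qed.

Lemma slot_wt_pair c i : slot_wt (U_(idx (lshift q c.1) i) + U_(idx (rshift p c.2) i)) =
  (\sum_b (((c.1 == b.1) + (c.2 == b.2)) * (i == slot b)))%N.
Proof.
rewrite slot_wtD slot_wt_pos slot_wt_neg -big_split; apply: eq_bigr => b _ /=.
by rewrite mulnDl !mulnb.
Qed.

Lemma slot_wt_lead c : slot_wt (leadm c) = 2%N.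
Proof.
rewrite slot_wt_pair (bigD1 c) //= !eqxx big1 // => b bc.
by rewrite (inj_eq slot_inj) [c == b]eq_sym (negPf bc) muln0.
Qed.

(** Column [i] is the slot of at most one pair, different from [c]; such a pair shares at most one
    of its two indices with [c]. *)
Lemma slot_wt_tail c i : i != slot c ->
  (slot_wt (U_(idx (lshift q c.1) i) + U_(idx (rshift p c.2) i)) <= 1)%N.
Proof.
move=> ic; rewrite slot_wt_pair; have [b /= /eqP ib|nb] := pickP (fun b => i == slot b).
  rewrite (bigD1 b) //= big1 ?addn0 => [|b' b'b].
    rewrite ib eqxx muln1; have : ~~ ((c.1 == b.1) && (c.2 == b.2)).
      apply: contraNN ic => /andP[/eqP c1 /eqP c2].
      by rewrite ib [c]surjective_pairing c1 c2 -surjective_pairing.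
    by case: eqP => _; case: eqP.
  by rewrite ib (inj_eq slot_inj) [b == b']eq_sym (negPf b'b) muln0.
by rewrite big1 // => b _; rewrite nb muln0.
Qed.

Lemma wtlt_tailq c w f : wtlt slot_wt w f -> wtlt slot_wt w.+1 (tailq c * f).
Proof.
move=> fw; rewrite /tailq mulr_suml big_mkcond; apply: wtlt_sum => i.
case: ifP => ic; last exact: wtlt0.
pose m := (U_(idx (lshift q c.1) i) + U_(idx (rshift p c.2) i))%MM.
have := wtlt_mulX slot_wtD (u := m) fw; apply: wtlt_le.
by rewrite -addn1 leq_add2l; exact: slot_wt_tail.
Qed.

Lemma leadm_disjoint b c : b != c -> forall j, leadm b j = 0%N \/ leadm c j = 0%N.
Proof.
move=> bc j; have lead0 a l i : i != slot a -> leadm a (idx l i) = 0%N.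
  move=> ia; rewrite mnmDE !mnm1E !mxvec_index_eq.
  by rewrite ![slot a == i]eq_sym (negPf ia) !andbF.
case/mxvec_indexP: j => l i; have [ib|ib] := eqVneq i (slot b).
  by right; apply: lead0; rewrite ib (inj_eq slot_inj).
by left; exact: lead0.
Qed.

Lemma d0E (x : cochains) : d0 x = koszul leadm tailq x.
Proof.
rewrite /d0 /koszul; apply: eq_bigr => c _; congr (extmul c _).
by apply: eq_cmap => f; rewrite /qmul qpoly_lead.
Qed.

Lemma d0_exact l (x : cochains) : (l < p * q)%N ->
  (forall S : {set E}, #|S| != l -> x S = 0) -> d0 x = 0 -> exists y, x = d0 y.
Proof.
move=> lpq xl; rewrite d0E => Kx.
have lE : (l < #|{: E}|)%N by rewrite card_prod !card_ord.
have [y xE] := koszul_exact slot_wtD slot_wt_lead leadm_disjoint wtlt_tailq lE xl Kx.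
by exists y; rewrite d0E.
Qed.

Lemma harmonic_eq0 l (x : cochains) : (l < p * q)%N ->
  (forall S : {set E}, #|S| != l -> x S = 0) -> d0 x = 0 -> d0s x = 0 -> x = 0.
Proof.
move=> lpq xl x0; have [y xE] := d0_exact lpq xl x0.
by move/harmonic_d0_eq0; apply; exact: xE.
Qed.

End LeadingMonomials.

(** * Infinitesimal invariance *)

Section Jets.
Import Num.Theory.
Variables (R : realType) (n : nat).
Local Notation C := (R[i])%C.
Local Notation A := {mpoly C[n]}.
Implicit Types (F G : R -> A) (a b : A).

Definition real_pt (t : R) : A := (t%:C%C)%:MP.

(* F has value a and derivative b at 0; clearing a power of 1 + t^2 is enough
   for the rational parametrisation of the rotations used below. *)
Definition jet F a b : Prop := exists d (P : {poly A}),
  [/\ forall t, (1 + real_pt t ^+ 2) ^+ d * F t = P.[real_pt t], P.[0] = a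
    & P^`().[0] = b].

Lemma jet_eq F G a b : F =1 G -> jet F a b -> jet G a b.
Proof. by move=> FG [d [P [FP P0 P1]]]; exists d, P; split=> // t; rewrite -FG. Qed.

Lemma jet_congr F G a b a' b' : F =1 G -> a = a' -> b = b' -> jet F a b -> jet G a' b'.
Proof. by move=> FG <- <-; exact: jet_eq. Qed.

Lemma jet_cst a : jet (fun=> a) a 0.
Proof.
exists 0%N, a%:P; split=> [t||]; rewrite ?hornerC //.
  by rewrite expr0 mul1r.
by rewrite derivC horner0.
Qed.

Let den d : {poly A} := (1 + 'X^2) ^+ d.

Lemma den_horner d x : (den d).[x] = (1 + x ^+ 2) ^+ d.
Proof. by rewrite /den horner_exp hornerD hornerXn hornerC. Qed.

(** Because of this, clearing denominators changes neither the value nor the derivative at 0. *)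
Lemma den_deriv d : (den d)^`().[0] = 0.
Proof.
rewrite /den deriv_exp -mulr_natr !hornerM derivD derivXn hornerD hornerMn.
by rewrite derivC horner0 hornerX mul0rn addr0 !mul0r.
Qed.

Lemma jetD F G a b a' b' : jet F a b -> jet G a' b' ->
  jet (fun t => F t + G t) (a + a') (b + b').
Proof.
move=> [d [P [FP P0 P1]]] [e [Q [GQ Q0 Q1]]].
exists (d + e)%N, (P * den e + Q * den d); split=> [t||].
- by rewrite hornerD !hornerM !den_horner -FP -GQ exprD; ring.
- by rewrite hornerD !hornerM !den_horner P0 Q0 expr0n addr0 !expr1n !mulr1.
rewrite derivD !derivM !hornerD !hornerM !den_deriv !den_horner P1 Q1.
by rewrite expr0n addr0 !expr1n !mulr1 !mulr0 !addr0.
Qed.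

Lemma jetM F G a b a' b' : jet F a b -> jet G a' b' ->
  jet (fun t => F t * G t) (a * a') (b * a' + a * b').
Proof.
move=> [d [P [FP P0 P1]]] [e [Q [GQ Q0 Q1]]].
exists (d + e)%N, (P * Q); split=> [t||].
- by rewrite hornerM -FP -GQ exprD; ring.
- by rewrite hornerM P0 Q0.
by rewrite derivM hornerD !hornerM P0 P1 Q0 Q1.
Qed.

Lemma jetZ (c : C) F a b : jet F a b -> jet (fun t => c *: F t) (c *: a) (c *: b).
Proof.
move/(jetM (jet_cst c%:MP)); rewrite mul0r add0r !mul_mpolyC.
by apply: jet_eq => t; rewrite mul_mpolyC.
Qed.

Lemma jet_sum I (r : seq I) (F : I -> R -> A) (a b : I -> A) :
  (forall i, jet (F i) (a i) (b i)) ->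
  jet (fun t => \sum_(i <- r) F i t) (\sum_(i <- r) a i) (\sum_(i <- r) b i).
Proof.
move=> Fi; elim: r => [|i r IHr].
  rewrite !big_nil; apply: jet_eq (jet_cst 0) => t; by rewrite big_nil.
rewrite !big_cons; apply: jet_eq (jetD (Fi i) IHr) => t; by rewrite big_cons.
Qed.

(** The numerator agrees with [c] times the denominator at all real points, hence as a
    polynomial. *)
Lemma jet_cst_deriv c a b : jet (fun=> c) a b -> b = 0.
Proof.
move=> [d [P [FP _ <-]]]; suff -> : P = den d * c%:P.
  by rewrite derivM hornerD !hornerM den_deriv derivC horner0 mul0r mulr0 addr0.
apply/eqP; rewrite -subr_eq0; apply/eqP; set Q := P - _.
apply: contraTeq isT => Qn0.
(* As many distinct points as the size of [Q], one more than its possible number of roots. *)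
pose rs := [seq real_pt i%:R | i <- iota 0 (size Q)].
have : (size rs < size Q)%N.
  apply: max_poly_roots => //.
    apply/allP=> _ /mapP[i _ ->]; rewrite /root hornerD hornerN hornerM hornerC.
    by rewrite den_horner FP subrr.
  rewrite map_inj_uniq ?iota_uniq // => i j /eqP.
  by rewrite mpolyC_eq => /eqP/complexI/eqP; rewrite eqr_nat => /eqP.
by rewrite size_map size_iota ltnn.
Qed.

End Jets.

Lemma sum_delta (C : pzRingType) (V : lmodType C) (I : finType) (i : I) (F : I -> V) :
  \sum_j (j == i)%:R *: F j = F i.
Proof.
rewrite (bigD1 i) //= eqxx scale1r big1 ?addr0 // => j ji.
by rewrite (negPf ji) scale0r.
Qed.

Lemma mpolyC_mul_ext (C : comNzRingType) n (E : finType) (a : C)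
    (z : ext E {mpoly C[n]}) S : a%:MP * z S = (a *: z) S.
Proof. by rewrite ffunE mul_mpolyC. Qed.

Lemma mpolyC_mul_extD (C : comNzRingType) n (E : finType) (a a' : C)
    (z z' : ext E {mpoly C[n]}) S :
  a%:MP * z S + a'%:MP * z' S = (a *: z + a' *: z') S.
Proof. by rewrite !mpolyC_mul_ext [RHS]ffunE. Qed.

Lemma ext_sum_apply (C : comNzRingType) n (E : finType) I (r : seq I)
    (F : I -> ext E {mpoly C[n]}) S : \sum_(i <- r) F i S = (\sum_(i <- r) F i) S.
Proof. by rewrite sum_ffunE. Qed.

Section InfinitesimalInvariance.
Variables (R : realType) (p q k : nat).
Local Notation C := (R[i])%C.
Local Notation E := ('I_p * 'I_q)%type.
Local Notation Pol := (Pol R p q k).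
Local Notation cochains := (ext E Pol).
Local Notation N := ((p + q) * k)%N.
Local Notation idx j i := (mxvec_index (j : 'I_(p + q)) (i : 'I_k)).
Implicit Types (x y : cochains) (b c : E) (j l : 'I_(p + q)).

Lemma PactC (h : 'M[R]_(p + q)) (a : C) : Pact h (a%:MP : Pol) = a%:MP.
Proof. by rewrite /Pact comp_mpolyC. Qed.

(** Polarisation operators: the matrix units of gl(p+q) acting on polynomials. *)
Definition eop j l (f : {mpoly C[N]}) : {mpoly C[N]} :=
  \sum_i 'X_(idx j i) * f^`M(idx l i).

Lemma eop_linear j l : linear (eop j l).
Proof.
move=> a f h; rewrite /eop scaler_sumr -big_split; apply: eq_bigr => i _ /=.
by rewrite linearP mulrDr scalerAr.
Qed.

Variables (g : R -> 'M[R]_(p + q)) (Z : 'M[C]_(p + q)).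
Hypothesis gK : forall t, inK (g t).
Hypothesis gZ : forall j l,
  jet (fun t => ((g t j l)%:C%C)%:MP_[N]) (j == l)%:R%:MP (Z j l)%:MP.

(** The derivative at 0 of [Pact (g t)], where [Z] is the derivative of [g]. The inverse in [Pact]
    is a transpose on [K], which accounts for the order of the indices. *)
Definition liepol (f : {mpoly C[N]}) : {mpoly C[N]} := \sum_l \sum_j Z l j *: eop l j f.

Lemma liepol_linear : linear liepol.
Proof.
move=> a f h; rewrite /liepol scaler_sumr -big_split; apply: eq_bigr => l _ /=.
rewrite scaler_sumr -big_split; apply: eq_bigr => j _ /=.
by rewrite eop_linear scalerDr !scalerA mulrC.
Qed.

Lemma eopC l j (a : C) : eop l j a%:MP = 0.
Proof. by rewrite /eop big1 // => i _; rewrite mderivC mulr0. Qed.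

Lemma eopM l j f h : eop l j (f * h) = eop l j f * h + f * eop l j h.
Proof.
rewrite /eop mulr_suml mulr_sumr -big_split; apply: eq_bigr => i _ /=.
by rewrite mderivM; ring.
Qed.

Lemma eopX l j j' i : eop l j 'X_(idx j' i) = (j == j')%:R *: 'X_(idx l i).
Proof.
rewrite /eop (bigD1 i) //= big1 ?addr0 => [|i' i'i]; rewrite mderivXU mxvec_index_eq.
  by rewrite eqxx andbT eq_sym mulrC mul_mpolyC.
by rewrite [i == _]eq_sym (negPf i'i) andbF mpolyC0 mulr0.
Qed.

Lemma jet_Pact (f : {mpoly C[N]}) : jet (fun t => Pact (g t) (f : Pol)) f (liepol f).
Proof.
elim/mpoly_alg_ind: f => [a|f h IHf IHh|f h IHf IHh|a].
- have -> : liepol a%:MP = 0.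
    by rewrite /liepol big1 // => l _; rewrite big1 // => j _; rewrite eopC scaler0.
  by apply: jet_eq (jet_cst _) => t; rewrite PactC.
- rewrite (linD liepol_linear); apply: jet_eq (jetD IHf IHh) => t.
  by rewrite (linD (@Pact_linear R p q k (g t))).
- have -> : liepol (f * h) = liepol f * h + f * liepol h.
    rewrite /liepol mulr_suml mulr_sumr -big_split; apply: eq_bigr => l _ /=.
    rewrite mulr_suml mulr_sumr -big_split; apply: eq_bigr => j _ /=.
    by rewrite eopM scalerDr scalerAl scalerAr.
  by apply: jet_eq (jetM IHf IHh) => t; rewrite PactM.
case/mxvec_indexP: a => j i.
have E1 : liepol 'X_(idx j i) =
    \sum_l ((Z l j)%:MP * 'X_(idx l i) + (l == j)%:R%:MP * 0).
  rewrite /liepol; apply: eq_bigr => l _; rewrite (bigD1 j) //= eopX eqxx scale1r.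
  rewrite mulr0 addr0 big1 ?addr0 ?mul_mpolyC // => j' jj'.
  by rewrite eopX (negPf jj') scale0r scaler0.
have E2 : 'X_(idx j i) = \sum_l (l == j)%:R%:MP * 'X_(idx l i) :> {mpoly C[N]}.
  rewrite (bigD1 j) //= eqxx mpolyC1 mul1r big1 ?addr0 // => l lj.
  by rewrite (negPf lj) mpolyC0 mul0r.
have J := jet_sum (index_enum _) (fun l => jetM (gZ l j) (jet_cst 'X_(idx l i))).
rewrite -E1 -E2 in J; apply: jet_eq J => t.
have := Pact_zmat (g t) j i; rewrite {1}/zmat mxE => ->.
apply: eq_bigr => l _; rewrite mul_mpolyC inK_inv // [in RHS]mxE.
by rewrite /zmat mxE.
Qed.

Definition ejet (F : R -> cochains) x y : Prop :=
  forall S, jet (fun t => F t S : {mpoly C[N]}) (x S) (y S).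

(** The product rule applied to [coadC], whose entries are products of an entry from each block. *)
Definition lieform c b : C := Z (lshift q b.1) (lshift q c.1) * (c.2 == b.2)%:R +
    (c.1 == b.1)%:R * Z (rshift p b.2) (rshift p c.2).

(** The derivation of the exterior algebra acting on generators by [lieform] and trivially on
    coefficients. *)
Definition lieext x : cochains :=
  \sum_c \sum_b lieform c b *: extmul b (contract c x).

Lemma lieext_linear : linear lieext.
Proof.
move=> a x y; rewrite /lieext scaler_sumr -big_split; apply: eq_bigr => c _ /=.
rewrite scaler_sumr -big_split; apply: eq_bigr => b _ /=.
by rewrite contract_linear extmul_linear scalerDr !scalerA mulrC.
Qed.

Lemma coadjointE (h : 'M[R]_(p + q)) c b : inK h -> coadjoint h c b =
  h (lshift q b.1) (lshift q c.1) * h (rshift p b.2) (rshift p c.2).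
Proof.
move=> hK; have [u [v [_ _ hE]]] := hK; rewrite hE in hK *.
by rewrite coadjoint_block // block_mxEul block_mxEdr.
Qed.

Lemma jet_coadC c b : jet (fun t => (coadC (g t) c b)%:MP_[N]) (c == b)%:R%:MP (lieform c b)%:MP.
Proof.
have -> : (c == b)%:R%:MP = (lshift q b.1 == lshift q c.1)%:R%:MP *
    (rshift p b.2 == rshift p c.2)%:R%:MP :> {mpoly C[N]}.
  rewrite -mpolyCM -natrM mulnb eq_lshift eq_rshift -xpair_eqE -!surjective_pairing.
  by rewrite eq_sym.
have -> : (lieform c b)%:MP = (Z (lshift q b.1) (lshift q c.1))%:MP *
   (rshift p b.2 == rshift p c.2)%:R%:MP + (lshift q b.1 == lshift q c.1)%:R%:MP *
   (Z (rshift p b.2) (rshift p c.2))%:MP :> {mpoly C[N]}.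
  by rewrite -!mpolyCM -mpolyCD eq_lshift eq_rshift [b.1 == _]eq_sym [b.2 == _]eq_sym.
apply: jet_eq (jetM (gZ _ _) (gZ _ _)) => t.
by rewrite -mpolyCM -rmorphM /coadC coadjointE.
Qed.

Lemma lieext_extmul c x :
  lieext (extmul c x) = \sum_b lieform c b *: extmul b x + extmul c (lieext x).
Proof.
transitivity (\sum_a \sum_b lieform a b *: ((a == c)%:R *: extmul b x +
    extmul c (extmul b (contract a x)))).
  apply: eq_bigr => a _; apply: eq_bigr => b _; congr (_ *: _).
  rewrite contract_extmulE (linB (@extmul_linear _ _ _ b)) (linZ (@extmul_linear _ _ _ b)) /=.
  by rewrite [in LHS]extmulC opprK.
under eq_bigr do under eq_bigr do rewrite scalerDr.
under eq_bigr do rewrite big_split /=.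
rewrite big_split /=; congr (_ + _).
  rewrite -[RHS](sum_delta c (fun a => \sum_b lieform a b *: extmul b x)).
  apply: eq_bigr => a _; rewrite scaler_sumr; apply: eq_bigr => b _.
  by rewrite !scalerA mulrC.
rewrite /lieext (lin_sum (@extmul_linear _ _ _ c)); apply: eq_bigr => a _.
rewrite (lin_sum (@extmul_linear _ _ _ c)); apply: eq_bigr => b _.
by rewrite (linZ (@extmul_linear _ _ _ c)).
Qed.

Lemma ejet_extmul b F x y : ejet F x y ->
  ejet (fun t => extmul b (F t)) (extmul b x) (extmul b y).
Proof.
move=> Fxy S.
apply: (jet_congr (fun t => esym (extmulE b (F t) S))
  (esym (extmulE b x S)) (esym (extmulE b y S))).
by case: ifP => _; [exact: jetZ | exact: jet_cst].
Qed.

Lemma ejet_Kact x : ejet (fun t => Kact (g t) x) x (lieext x + cmap liepol x).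
Proof.
move: x; apply: ext_ind => [x y IHx IHy||f|c x IHx] S.
- rewrite (linD lieext_linear) (linD (cmap_linear liepol_linear)) addrACA ffunE.
  rewrite [X in jet _ _ X]ffunE.
  apply: jet_eq (jetD (IHx S) (IHy S)) => t.
  by rewrite (linD (@Kact_linear R p q k (g t))) ffunE.
- rewrite (lin0 lieext_linear) (lin0 (cmap_linear liepol_linear)) addr0 ffunE.
  apply: jet_eq (jet_cst 0) => t.
  by rewrite (lin0 (@Kact_linear R p q k (g t))) ffunE.
- have -> : lieext (ext0 E f) = 0.
    rewrite /lieext big1 // => c _; rewrite big1 // => b _.
    by rewrite contract_ext0 (lin0 (@extmul_linear _ _ _ b)) scaler0.
  rewrite add0r (cmap_ext0 _ _ liepol_linear) !ffunE; case: ifP => S0.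
    by apply: jet_eq (jet_Pact f) => t; rewrite Kact_ext0 ffunE S0.
  by apply: jet_eq (jet_cst 0) => t; rewrite Kact_ext0 ffunE S0.
rewrite lieext_extmul (cmap_extmul c x liepol_linear) -addrA -(linD (@extmul_linear _ _ _ c)).
set y := lieext x + _ in IHx *.
have deltaE (z : cochains) : extmul c z = \sum_b (c == b)%:R *: extmul b z.
  rewrite -[LHS](sum_delta c (fun b => extmul b z)).
  by apply: eq_bigr => b _; rewrite eq_sym.
have xE := deltaE x; have yE := deltaE y.
have J b : jet (fun t => (coadC (g t) c b *: extmul b (Kact (g t) x)) S)
    (((c == b)%:R *: extmul b x) S)
    ((lieform c b *: extmul b x + (c == b)%:R *: extmul b y) S).
  apply: (jet_congr _ _ _ (jetM (jet_coadC c b) (ejet_extmul b IHx S))).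
  - by move=> t; exact: mpolyC_mul_ext.
  - exact: mpolyC_mul_ext.
  - exact: mpolyC_mul_extD.
have yE' : \sum_b (lieform c b *: extmul b x + (c == b)%:R *: extmul b y) =
    \sum_b lieform c b *: extmul b x + extmul c y by rewrite yE -big_split.
apply: (jet_congr _ (etrans (ext_sum_apply _ _ _) (congr1 (fun z : cochains => z S) (esym xE)))
  (etrans (ext_sum_apply _ _ _) (congr1 (fun z : cochains => z S) yE')) (jet_sum (index_enum _) J)).
move=> t; have E0 := congr1 (fun z : cochains => z S) (esym (Kact_extmul (g t) c x)).
exact: etrans (ext_sum_apply _ _ _) E0.
Qed.

(** For invariant [x] the curve of translates is constant, so its derivative vanishes. *)
Lemma invariant_lie x : Kinvariant x -> lieext x + cmap liepol x = 0.
Proof.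
move=> xi; apply/ffunP=> S; rewrite [RHS]ffunE; apply: (@jet_cst_deriv _ _ (x S) (x S)).
apply: jet_eq (ejet_Kact x S) => t.
by have -> := xi _ (gK t).
Qed.

End InfinitesimalInvariance.

Definition real_ptm (R : realType) n : {rmorphism R -> {mpoly R[i]%C[n]}} :=
  mpolyC n (R := R[i]%C) \o real_complex R.

Lemma jet_real (R : realType) n (f : R -> R) (Q : {poly R}) d :
    (forall t, (1 + t ^+ 2) ^+ d * f t = Q.[t]) ->
  jet (fun t => real_pt n (f t)) (real_pt n Q.[0]) (real_pt n Q^`().[0]).
Proof.
move=> fQ; pose phi := real_ptm R n.
have phi0 : real_pt n (0 : R) = 0 by exact: (rmorph0 phi).
exists d, (map_poly phi Q); split=> [t||].
- rewrite -[real_pt n t]/(phi t) horner_map -fQ /= -[real_pt n (f t)]/(phi (f t)).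
  by rewrite -[RHS]/(phi _) [RHS]rmorphM rmorphXn rmorphD rmorph1 rmorphXn.
- by rewrite -phi0 -[real_pt n (0 : R)]/(phi 0) horner_map.
by rewrite -phi0 -[real_pt n (0 : R)]/(phi 0) deriv_map horner_map.
Qed.

(** * Rational curves of plane rotations *)

Section Rotations.
Import Order.TTheory Num.Theory.
Variables (R : realType) (n : nat) (a b : 'I_n).
Hypothesis ab : a != b.

Definition rot_gen : 'M[R]_n := delta_mx a b - delta_mx b a.
Let P : 'M[R]_n := delta_mx a a + delta_mx b b.

(* The coefficients are cos - 1 and sin in the rational parametrisation of the circle. *)
Definition half_rot (t : R) : 'M[R]_n :=
  1%:M + (- (2 * t ^+ 2) / (1 + t ^+ 2)) *: P + (2 * t / (1 + t ^+ 2)) *: rot_gen.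

(* Squaring makes the determinant 1 without computing that of half_rot. *)
Definition plane_rot t := half_rot t *m half_rot t.

Let mul_delta (i j k l : 'I_n) :
  delta_mx i j *m delta_mx k l = (j == k)%:R *: (delta_mx i l : 'M[R]_n).
Proof. by rewrite mul_delta_mx_cond scaler_nat. Qed.

Lemma half_rot_orth t : half_rot t *m (half_rot t)^T = 1%:M.
Proof.
have ba : (b == a) = false by rewrite eq_sym (negPf ab).
have PP : P *m P = P.
  rewrite /P mulmxDl !mulmxDr !mul_delta !eqxx ba (negPf ab) !scale1r !scale0r.
  by rewrite addr0 add0r.
have PX : P *m rot_gen = rot_gen.
  rewrite /P /rot_gen mulmxDl !mulmxBr !mul_delta !eqxx ba (negPf ab) !scale1r !scale0r.
  by rewrite subr0 sub0r.
have XP : rot_gen *m P = rot_gen.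
  rewrite /P /rot_gen mulmxBl !mulmxDr !mul_delta !eqxx ba (negPf ab) !scale1r !scale0r.
  by rewrite addr0 add0r.
have XX : rot_gen *m rot_gen = - P.
  rewrite /P /rot_gen mulmxBl !mulmxBr !mul_delta !eqxx ba (negPf ab) !scale1r !scale0r.
  by rewrite subr0 sub0r opprD.
have t1 : 1 + t ^+ 2 != 0 by rewrite gt_eqF // ltr_pwDl // sqr_ge0.
rewrite /half_rot; set u := - _ / _; set s := 2 * t / _.
(* With cosine [1 + u] and sine [s], this says that their squares add up to 1. *)
have us : 2 * u + u ^+ 2 + s ^+ 2 = 0 by rewrite /u /s; field.
have PT : P^T = P by apply/matrixP=> i j; rewrite !mxE ![(j == _) && _]andbC.
have XT : rot_gen^T = - rot_gen.
  by apply/matrixP=> i j; rewrite !mxE opprB ![(j == _) && _]andbC.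
move: (P) (rot_gen) PP PX XP XX PT XT => P' X PP PX XP XX PT XT.
have Tl : linear (@trmx R n n) by move=> c A B; apply/matrixP=> i j; rewrite !mxE.
rewrite !(linD Tl) !(linZ Tl) /= trmx1 PT XT scalerN.
rewrite !(mulmxDl, mulmxDr, mulmxN) -!(scalemxAl, scalemxAr) !mul1mx !mulmx1 PP PX XP XX.
apply/matrixP=> i j; rewrite !mxE; set d := (i == j)%:R.
transitivity (d + (2 * u + u ^+ 2 + s ^+ 2) * P' i j); first by ring.
by rewrite us mul0r addr0.
Qed.

Lemma plane_rot_SO t : SO (plane_rot t).
Proof.
have o := half_rot_orth t; split.
  by rewrite /plane_rot trmx_mul mulmxA -(mulmxA (half_rot t)) o mulmx1.
have := congr1 determinant o; rewrite det_mulmx det_tr det1 => <-.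
by rewrite /plane_rot det_mulmx.
Qed.

Lemma jet_half_rot N i j : jet (fun t => real_pt N (half_rot t i j))
  (real_pt N (i == j)%:R) (real_pt N (2 * rot_gen i j)).
Proof.
(* The entry of [half_rot] multiplied by its denominator. *)
pose Q : {poly R} := (1 + 'X^2) * ((i == j)%:R)%:P - 'X^2 * (2 * P i j)%:P +
  'X * (2 * rot_gen i j)%:P.
have Q0 : Q.[0] = (i == j)%:R.
  by rewrite /Q !(hornerD, hornerN, hornerM, hornerC, hornerXn, hornerX); ring.
have Q1 : Q^`().[0] = 2 * rot_gen i j.
  rewrite /Q !derivE !(hornerD, hornerN, hornerM, hornerC, hornerXn, hornerX, hornerMn) /=; ring.
rewrite -Q0 -Q1; apply: (jet_real _ (d := 1)) => t.
have t1 : 1 + t ^+ 2 != 0 by rewrite gt_eqF // ltr_pwDl // sqr_ge0.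
rewrite /Q !(hornerD, hornerN, hornerM, hornerC, hornerXn, hornerX) /half_rot.
by move: (P) (rot_gen) => P' X; rewrite !mxE; field.
Qed.

(** Each of the two factors passes through the identity with derivative [2 * rot_gen], whence the
    constant 4. *)
Lemma jet_plane_rot N i j : jet (fun t => real_pt N (plane_rot t i j))
  (real_pt N (i == j)%:R) (real_pt N (4 * rot_gen i j)).
Proof.
pose phi := real_ptm R N.
have J l := jetM (jet_half_rot N i l) (jet_half_rot N l j).
apply: (jet_congr _ _ _ (jet_sum (index_enum _) J)) => [t||].
- rewrite -[RHS]/(phi _) mxE [RHS]rmorph_sum; apply: eq_bigr => l _.
  by rewrite [RHS]rmorphM.
- rewrite -[RHS]/(phi _) -(sum_delta j (fun l => (i == l)%:R : R^o)) [RHS]rmorph_sum.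
  apply: eq_bigr => l _; rewrite -[LHS]/(phi _ * phi _) -[RHS]/(phi _) -rmorphM.
  by congr (phi _); rewrite mulrC.
rewrite -[RHS]/(phi _).
have -> : 4 * rot_gen i j =
    \sum_l (2 * rot_gen i l * (l == j)%:R + (i == l)%:R * (2 * rot_gen l j)).
  rewrite big_split /=.
  have -> : \sum_l 2 * rot_gen i l * (l == j)%:R = 2 * rot_gen i j.
    rewrite -[RHS](sum_delta j (fun l => 2 * rot_gen i l : R^o)).
    by apply: eq_bigr => l _; rewrite mulrC.
  have -> : \sum_l (i == l)%:R * (2 * rot_gen l j) = 2 * rot_gen i j.
    rewrite -[RHS](sum_delta i (fun l => 2 * rot_gen l j : R^o)).
    by apply: eq_bigr => l _; rewrite eq_sym.
  by ring.
rewrite [RHS]rmorph_sum; apply: eq_bigr => l _.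
by rewrite [RHS]rmorphD; congr (_ + _); rewrite [RHS]rmorphM.
Qed.

End Rotations.

Section WeilLieAlgebra.
Variables (R : realType) (p q k : nat).
Local Notation C := (R[i])%C.
Local Notation E := ('I_p * 'I_q)%type.
Local Notation Pol := (Pol R p q k).
Local Notation cochains := (ext E Pol).
Local Notation N := ((p + q) * k)%N.
Local Notation eop := (@eop R p q k).
Implicit Types (x y : cochains).

(** The total action of a matrix unit of gl(p), on coefficients and on forms. Only antisymmetric
    combinations come from so(p). *)
Definition Wpos (a a' : 'I_p) y : cochains :=
  cmap (eop (lshift q a) (lshift q a')) y +
  \sum_m extmul (a, m) (contract (a', m) y).

Definition Wneg (m m' : 'I_q) y : cochains :=
  cmap (eop (rshift p m) (rshift p m')) y +
  \sum_a extmul (a, m) (contract (a, m') y).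

Lemma invariant_block (u : R -> 'M[R]_p) (v : R -> 'M[R]_q) (X : 'M[R]_p) (Y : 'M[R]_q) y :
    (forall t, SO (u t)) -> (forall t, SO (v t)) ->
    (forall i j, jet (fun t => real_pt N (u t i j)) (real_pt N (i == j)%:R) (real_pt N (X i j))) ->
    (forall i j, jet (fun t => real_pt N (v t i j)) (real_pt N (i == j)%:R) (real_pt N (Y i j))) ->
    Kinvariant y ->
  \sum_a \sum_a' (X a a')%:C%C *: Wpos a a' y +
  \sum_m \sum_m' (Y m m')%:C%C *: Wneg m m' y = 0.
Proof.
move=> uO vO uX vY yi; pose g t := block_mx (u t) 0 0 (v t).
pose Z : 'M[C]_(p + q) := \matrix_(i, j) (block_mx X 0 0 Y i j)%:C%C.
have gK t : inK (g t) by exists (u t), (v t).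
have natE (e : bool) : real_pt N (e%:R : R) = (e%:R : C)%:MP.
  by rewrite /real_pt rmorph_nat.
have gZ j l : jet (fun t => ((g t j l)%:C%C)%:MP_[N]) (j == l)%:R%:MP (Z j l)%:MP.
  rewrite /Z mxE /g; case: (split_ordP j) => j' ->; case: (split_ordP l) => l' ->.
  - rewrite block_mxEul eq_lshift -natE; apply: jet_eq (uX j' l') => t.
    by rewrite block_mxEul.
  - rewrite block_mxEur eq_lrshift -natE mxE; apply: jet_eq (jet_cst 0) => t.
    by rewrite block_mxEur mxE.
  - rewrite block_mxEdl eq_rlshift -natE mxE; apply: jet_eq (jet_cst 0) => t.
    by rewrite block_mxEdl mxE.
  rewrite block_mxEdr eq_rshift -natE; apply: jet_eq (vY j' l') => t.
  by rewrite block_mxEdr.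
rewrite -[RHS](invariant_lie gK gZ yi).
have ZX a a' : Z (lshift q a) (lshift q a') = (X a a')%:C%C.
  by rewrite mxE block_mxEul.
have ZY m m' : Z (rshift p m) (rshift p m') = (Y m m')%:C%C.
  by rewrite mxE block_mxEdr.
have Z0 a m : Z (lshift q a) (rshift p m) = 0 by rewrite mxE block_mxEur mxE.
have Z0' a m : Z (rshift p m) (lshift q a) = 0 by rewrite mxE block_mxEdl mxE.
have -> : cmap (liepol Z) y =
    \sum_a \sum_a' (X a a')%:C%C *: cmap (eop (lshift q a) (lshift q a')) y +
    \sum_m \sum_m' (Y m m')%:C%C *: cmap (eop (rshift p m) (rshift p m')) y.
  have -> : cmap (liepol Z) y = \sum_l \sum_j Z l j *: cmap (eop l j) y.
    apply/ffunP=> S; rewrite cmapE /liepol sum_ffunE; apply: eq_bigr => l _.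
    rewrite sum_ffunE; apply: eq_bigr => j _.
    by rewrite [RHS]ffunE cmapE.
  rewrite big_split_ord /=; congr (_ + _); apply: eq_bigr => a _.
    rewrite big_split_ord /= [X in _ + X]big1 ?addr0 => [|m _]; last by rewrite Z0 scale0r.
    by apply: eq_bigr => a' _; rewrite ZX.
  rewrite big_split_ord /= big1 ?add0r => [|m _]; last by rewrite Z0' scale0r.
  by apply: eq_bigr => a' _; rewrite ZY.
have -> : lieext Z y =
    \sum_a \sum_a' (X a a')%:C%C *: (\sum_m extmul (a, m) (contract (a', m) y)) +
    \sum_m \sum_m' (Y m m')%:C%C *: (\sum_a extmul (a, m) (contract (a, m') y)).
  rewrite /lieext /lieform.
  under eq_bigr do under eq_bigr do rewrite scalerDl.
  under eq_bigr do rewrite big_split /=.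
  rewrite big_split /=; congr (_ + _).
    transitivity (\sum_c1 \sum_c2 \sum_b1 \sum_b2 ((c2 == b2)%:R *:
       ((X b1 c1)%:C%C *: extmul (b1, b2) (contract (c1, c2) y)))).
      rewrite [RHS]pair_bigA; apply: eq_bigr => -[c1 c2] _ /=.
      rewrite [RHS]pair_bigA; apply: eq_bigr => -[b1 b2] _ /=.
      by rewrite ZX scalerA mulrC.
    rewrite [RHS]exchange_big; apply: eq_bigr => c1 _ /=.
    rewrite [LHS]exchange_big /=; apply: eq_bigr => b1 _.
    rewrite [RHS]scaler_sumr; apply: eq_bigr => c2 _.
    rewrite -[RHS](sum_delta c2
      (fun b2 => (X b1 c1)%:C%C *: extmul (b1, b2) (contract (c1, c2) y))).
    by apply: eq_bigr => b2 _; rewrite eq_sym.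
  transitivity (\sum_c1 \sum_c2 \sum_b1 \sum_b2 ((c1 == b1)%:R *:
       ((Y b2 c2)%:C%C *: extmul (b1, b2) (contract (c1, c2) y)))).
    rewrite [RHS]pair_bigA; apply: eq_bigr => -[c1 c2] _ /=.
    rewrite [RHS]pair_bigA; apply: eq_bigr => -[b1 b2] _ /=.
    by rewrite ZY scalerA.
  rewrite [RHS]exchange_big [LHS]exchange_big; apply: eq_bigr => c2 _ /=.
  transitivity (\sum_c1 \sum_b2 (Y b2 c2)%:C%C *: extmul (c1, b2) (contract (c1, c2) y)).
    apply: eq_bigr => c1 _; rewrite [LHS]exchange_big; apply: eq_bigr => b2 _ /=.
    rewrite -[RHS](sum_delta c1
      (fun b1 => (Y b2 c2)%:C%C *: extmul (b1, b2) (contract (c1, c2) y))).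
    by apply: eq_bigr => b1 _; rewrite eq_sym.
  by rewrite [LHS]exchange_big; apply: eq_bigr => b2 _; rewrite scaler_sumr.
rewrite addrACA -!big_split /=; congr (_ + _).
  apply: eq_bigr => a _; rewrite -big_split; apply: eq_bigr => a' _ /=.
  by rewrite -scalerDr addrC.
apply: eq_bigr => a _; rewrite -big_split; apply: eq_bigr => a' _ /=.
by rewrite -scalerDr addrC.
Qed.

Lemma SO1 n : SO (1%:M : 'M[R]_n).
Proof. by split; [rewrite trmx1 mulmx1 | rewrite det1]. Qed.

Lemma jet_id n (i j : 'I_n) : jet (fun=> real_pt N ((1%:M : 'M[R]_n) i j))
  (real_pt N (i == j)%:R) (real_pt N ((0 : 'M[R]_n) i j)).
Proof.
have z0 : real_pt N (0 : R) = 0 := rmorph0 (real_ptm R N).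
by rewrite !mxE z0; exact: jet_cst.
Qed.

Lemma rot_gen_sum n (V : lmodType C) (a b : 'I_n) (F : 'I_n -> 'I_n -> V) :
  \sum_i \sum_j ((4 *: rot_gen R a b) i j)%:C%C *: F i j = 4 *: (F a b - F b a).
Proof.
have dE (c d : 'I_n) : \sum_i \sum_j (i == c)%:R *: ((j == d)%:R *: F i j) = F c d.
  rewrite -[RHS](sum_delta d (F c)) -[RHS](sum_delta c (fun i => \sum_j (j == d)%:R *: F i j)).
  by apply: eq_bigr => i _; rewrite scaler_sumr.
rewrite -(dE a b) -(dE b a) -sumrB scaler_sumr; apply: eq_bigr => i _.
rewrite -sumrB scaler_sumr; apply: eq_bigr => j _.
rewrite !mxE rmorphM rmorphB !rmorph_nat !scalerA -scalerBl scalerA.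
by rewrite -!natrM !mulnb.
Qed.

Lemma four_eq0 (V : lmodType C) (x : V) : 4 *: x = 0 -> x = 0.
Proof. by move/eqP; rewrite scaler_eq0 Num.Theory.pnatr_eq0 => /eqP. Qed.

(** The curve rotates the plane of [a] and [a'] and is the identity on the negative part. *)
Lemma Wpos_sym a a' y : Kinvariant y -> Wpos a a' y = Wpos a' a y.
Proof.
move=> yi; have [->//|aa'] := eqVneq a a'.
have := @invariant_block (plane_rot a a') (fun=> 1%:M) (4 *: rot_gen R a a') 0 y
  (plane_rot_SO aa') (fun=> SO1 q).
move=> /(_ _ (@jet_id q) yi) H; apply/eqP; rewrite -subr_eq0; apply/eqP; apply: four_eq0.
rewrite -(rot_gen_sum a a' (fun i j => Wpos i j y)) -[RHS]H => [|i j]; last first.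
  have -> : (4 *: rot_gen R a a') i j = 4 * rot_gen R a a' i j by rewrite mxE.
  exact: jet_plane_rot.
rewrite [X in _ = _ + X]big1 ?addr0 // => m _; rewrite big1 // => m' _.
by rewrite mxE rmorph0 scale0r.
Qed.

Lemma Wneg_sym m m' y : Kinvariant y -> Wneg m m' y = Wneg m' m y.
Proof.
move=> yi; have [->//|mm'] := eqVneq m m'.
have := @invariant_block (fun=> 1%:M) (plane_rot m m') 0 (4 *: rot_gen R m m') y
  (fun=> SO1 p) (plane_rot_SO mm') (@jet_id p).
move=> /(_ _ yi) H; apply/eqP; rewrite -subr_eq0; apply/eqP; apply: four_eq0.
rewrite -(rot_gen_sum m m' (fun i j => Wneg i j y)) -[RHS]H => [|i j]; last first.
  have -> : (4 *: rot_gen R m m') i j = 4 * rot_gen R m m' i j by rewrite mxE.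
  exact: jet_plane_rot.
rewrite [X in _ = X + _]big1 ?add0r // => a _; rewrite big1 // => a' _.
by rewrite mxE rmorph0 scale0r.
Qed.

End WeilLieAlgebra.

(** * Algebraic identities for the curvature *)

Lemma extmul3_rev (C : comNzRingType) (E : finType) (M : lmodType C) (a b c : E)
    (x : ext E M) :
  extmul a (extmul b (extmul c x)) = - extmul c (extmul b (extmul a x)).
Proof.
rewrite [extmul b (extmul c x)]extmulC (linN (@extmul_linear _ _ _ a)) extmulC opprK.
rewrite [extmul a (extmul b x)]extmulC (linN (@extmul_linear _ _ _ c)).
by [].
Qed.

Lemma sum_diagonal3 (C : pzRingType) (V : lmodType C) (I : finType) (a b c : C)
    (F G : I -> I -> V) (z : V) :
  \sum_i \sum_j ((i == j)%:R *: (a *: F i j) + (i == j)%:R *: (b *: G i j) +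
    (i == j)%:R *: (c *: z)) =
  a *: (\sum_i F i i) + b *: (\sum_i G i i) + c *: (#|I|%:R *: z).
Proof.
rewrite scaler_nat -sumr_const !scaler_sumr -!big_split; apply: eq_bigr => i _ /=.
rewrite -[RHS](sum_delta i (fun j => a *: F i j + b *: G i j + c *: z)).
by apply: eq_bigr => j _; rewrite !scalerDr eq_sym.
Qed.

Lemma derivation2_mul (A : comNzRingType) (dl dr : A -> A) (xl xr el er h : A) :
    {morph dl : x y / x + y} ->
    (forall x y, dl (x * y) = dl x * y + x * dl y) ->
    (forall x y, dr (x * y) = dr x * y + x * dr y) ->
    dl xl = el -> dl xr = 0 -> dl er = 0 -> dr xl = 0 -> dr xr = er ->
  dl (dr (xl * (xr * h))) = xl * (xr * dl (dr h)) +
    (el * (xr * dr h) + er * (xl * dl h) + el * er * h).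
Proof.
move=> dlD dlM drM lxl lxr ler rxl rxr.
rewrite drM rxl mul0r add0r drM rxr dlM lxl dlD !dlM ler lxr; ring.
Qed.

Lemma cmap_comm (C : comNzRingType) (E : finType) (M : lmodType C)
    (f1 f2 g1 g2 u v : M -> M) (a b c d : C) (y : ext E M) :
    (forall m, f1 (f2 m) = g1 (g2 m) + (a *: u m + b *: v m + c *: (d *: m))) ->
  cmap f1 (cmap f2 y) - cmap g1 (cmap g2 y) =
  a *: cmap u y + b *: cmap v y + c *: (d *: y).
Proof.
by move=> H; apply/ffunP=> S; rewrite !ffunE H addrAC subrr add0r.
Qed.

(** The term in [z] occurs only for [b = c], where the two wedge factors are equal. *)
Lemma extmul2_split (C : comNzRingType) (E : finType) (M : lmodType C)
    (F G X Y : E -> E -> ext E M) (z : ext E M) :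
    (forall b c, F b c - G b c = X b c + Y b c + (b == c)%:R *: z) ->
  \sum_b \sum_c extmul b (extmul c (F b c)) - \sum_b \sum_c extmul b (extmul c (G b c)) =
  \sum_b \sum_c extmul b (extmul c (X b c)) + \sum_b \sum_c extmul b (extmul c (Y b c)).
Proof.
move=> FG; have Al b := @extmul_linear C E M b.
rewrite -sumrB -big_split; apply: eq_bigr => b _ /=.
rewrite -sumrB -big_split; apply: eq_bigr => c _ /=.
rewrite -(linB (Al b)) -(linB (Al c)) FG !(linD (Al _)) -[RHS]addr0; congr (_ + _).
have [->|bc] := eqVneq b c; first by rewrite extmul_sqr.
by rewrite scale0r !(lin0 (Al _)).
Qed.

(* Invariance trades the Lie algebra part e of each term for exterior algebra
   operators; the two resulting cubic expressions are reverses of each other. *)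
Lemma curvature_cancel (C : numClosedFieldType) (I J : finType) (M : lmodType C)
    (y : ext (I * J)%type M) (en : J -> J -> ext (I * J)%type M)
    (ep : I -> I -> ext (I * J)%type M) :
    (forall n m, en n m + \sum_a extmul (a, n) (contract (a, m) y) =
                 en m n + \sum_a extmul (a, m) (contract (a, n) y)) ->
    (forall a b, ep a b + \sum_m extmul (a, m) (contract (b, m) y) =
                 ep b a + \sum_m extmul (b, m) (contract (a, m) y)) ->
  \sum_b \sum_c extmul b (extmul c ((b.1 == c.1)%:R *: en c.2 b.2)) +
  \sum_b \sum_c extmul b (extmul c ((b.2 == c.2)%:R *: ep c.1 b.1)) = 0.
Proof.
move=> enS epS; have Al b := @extmul_linear C (I * J)%type M b.
pose A a m := @extmul C (I * J)%type M (a, m).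
have lN a m := linN (Al (a, m)); have lS a m := lin_sum (Al (a, m)).
have -> : \sum_b \sum_c extmul b (extmul c ((b.1 == c.1)%:R *: en c.2 b.2)) =
    - \sum_a \sum_m \sum_n \sum_b A a m (A a n (A b n (contract (b, m) y))).
  transitivity (\sum_a \sum_m \sum_n A a m (A a n (en n m))).
    rewrite [RHS]pair_bigA; apply: eq_bigr => -[a m] _ /=.
    transitivity (\sum_b \sum_n (b == a)%:R *: A a m (A b n (en n m))).
      rewrite [RHS]pair_bigA; apply: eq_bigr => -[b n] _ /=.
      by rewrite (linZ (Al (b, n))) (linZ (Al (a, m))) eq_sym.
    rewrite -[RHS](sum_delta a (fun b => \sum_n A a m (A b n (en n m)))).
    by apply: eq_bigr => b _; rewrite scaler_sumr.
  rewrite -sumrN; apply: eq_bigr => a _.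
  (* The full operator is symmetric by hypothesis, so its double sum is zero; subtracting it
     replaces [en] by minus the exterior part. *)
  rewrite -[LHS]subr0 -[X in _ - X](@extmul2_sym _ _ _ _ (fun m => (a, m))
    (fun m n => en n m + \sum_b A b n (contract (b, m) y))); last by move=> m n; exact: enS.
  rewrite -sumrB -sumrN; apply: eq_bigr => m _; rewrite -sumrB -sumrN.
  apply: eq_bigr => n _; rewrite -(linB (Al _)) -(linB (Al _)) opprD addrA subrr sub0r.
  by rewrite (lN a n) lS (lN a m) lS.
have -> : \sum_b \sum_c extmul b (extmul c ((b.2 == c.2)%:R *: ep c.1 b.1)) =
    - \sum_b \sum_n \sum_a \sum_m A b n (A a n (A a m (contract (b, m) y))).
  transitivity (\sum_b \sum_n \sum_a A b n (A a n (ep a b))).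
    rewrite [RHS]pair_bigA; apply: eq_bigr => -[b n] _ /=.
    transitivity (\sum_a \sum_m (m == n)%:R *: A b n (A a m (ep a b))).
      rewrite [RHS]pair_bigA; apply: eq_bigr => -[a m] _ /=.
      by rewrite (linZ (Al (a, m))) (linZ (Al (b, n))) eq_sym.
    apply: eq_bigr => a _; exact: (sum_delta n (fun m => A b n (A a m (ep a b)))).
  have E0 : \sum_b \sum_n \sum_a A b n (A a n (ep a b + \sum_m A a m (contract (b, m) y))) = 0.
    rewrite exchange_big big1 //= => n _.
    rewrite (@extmul2_sym _ _ _ _ (fun b => (b, n))) // => b a; exact: epS.
  rewrite -[LHS]subr0 -[X in _ - X]E0 -sumrB -sumrN; apply: eq_bigr => b _.
  rewrite -sumrB -sumrN; apply: eq_bigr => n _; rewrite -sumrB -sumrN.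
  apply: eq_bigr => a _; rewrite -(linB (Al _)) -(linB (Al _)) opprD addrA subrr sub0r.
  by rewrite (lN a n) lS (lN b n) lS.
have -> : \sum_b \sum_n \sum_a \sum_m A b n (A a n (A a m (contract (b, m) y))) =
    - \sum_a \sum_m \sum_n \sum_b A a m (A a n (A b n (contract (b, m) y))).
  rewrite -sumrN.
  transitivity (\sum_b \sum_a \sum_m \sum_n A b n (A a n (A a m (contract (b, m) y)))).
    apply: eq_bigr => b _; rewrite [LHS]exchange_big /=; apply: eq_bigr => a _.
    by rewrite [LHS]exchange_big.
  rewrite [LHS]exchange_big /=; apply: eq_bigr => a _.
  rewrite [LHS]exchange_big /= -sumrN; apply: eq_bigr => m _.
  rewrite [LHS]exchange_big /= -sumrN; apply: eq_bigr => n _.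
  by rewrite -sumrN; apply: eq_bigr => b _; exact: extmul3_rev.
by rewrite opprK addNr.
Qed.

(** * The differential squares to zero on invariants *)

Section SquareZero.
Variables (R : realType) (p q k : nat).
Local Notation C := (R[i])%C.
Local Notation E := ('I_p * 'I_q)%type.
Local Notation Pol := (Pol R p q k).
Local Notation cochains := (ext E Pol).
Local Notation N := ((p + q) * k)%N.
Local Notation idx j i := (mxvec_index (j : 'I_(p + q)) (i : 'I_k)).
Local Notation eop := (@eop R p q k).
Implicit Types (y : cochains).

(** By the Leibniz rule only equal columns contribute to the commutator. A single contraction leaves
    a polarisation operator; the double one leaves a scalar, and [k] counts the columns. *)
Lemma lap_qmul (b c : E) (f : {mpoly C[N]}) :
  lap b (qmul c f : Pol) = qmul c (lap b f) +
    ((b.1 == c.1)%:R *: eop (rshift p c.2) (rshift p b.2) f +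
     (b.2 == c.2)%:R *: eop (lshift q c.1) (lshift q b.1) f +
     (b == c)%:R *: (k%:R *: f)).
Proof.
pose xl i : {mpoly C[N]} := 'X_(idx (lshift q c.1) i).
pose xr i : {mpoly C[N]} := 'X_(idx (rshift p c.2) i).
pose dl i (h : {mpoly C[N]}) := h^`M(idx (lshift q b.1) i).
pose dr i (h : {mpoly C[N]}) := h^`M(idx (rshift p b.2) i).
have D i (h : {mpoly C[N]}) j : dl i (dr i (xl j * (xr j * h))) =
    xl j * (xr j * dl i (dr i h)) + ((i == j)%:R *: ((b.1 == c.1)%:R *: (xr j * dr i h)) +
    (i == j)%:R *: ((b.2 == c.2)%:R *: (xl j * dl i h)) +
    (i == j)%:R *: (((b.1 == c.1) && (b.2 == c.2))%:R *: h)).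
  rewrite (@derivation2_mul _ (dl i) (dr i) (xl j) (xr j)
    (((i == j) && (b.1 == c.1))%:R%:MP) (((i == j) && (b.2 == c.2))%:R%:MP)).
  - congr (_ + (_ + _ + _)).
    + by rewrite mul_mpolyC scalerA -natrM mulnb.
    + by rewrite mul_mpolyC scalerA -natrM mulnb.
    by rewrite -mpolyCM mul_mpolyC scalerA -!natrM !mulnb andbACA andbb.
  - exact: mderivD.
  - exact: mderivM.
  - exact: mderivM.
  - by rewrite /dl /xl mderivXU mxvec_index_eq eq_lshift andbC [j == i]eq_sym [c.1 == _]eq_sym.
  - by rewrite /dl /xr mderivXU mxvec_index_eq eq_rlshift mpolyC0.
  - exact: mderivC.
  - by rewrite /dr /xl mderivXU mxvec_index_eq eq_lrshift mpolyC0.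
  - by rewrite /dr /xr mderivXU mxvec_index_eq eq_rshift andbC [j == i]eq_sym [c.2 == _]eq_sym.
have -> : lap b (qmul c f : Pol) = \sum_i \sum_j dl i (dr i (xl j * (xr j * f))).
  rewrite qmulE /lap; apply: eq_bigr => i _.
  rewrite (lin_sum (@mderiv_is_linear _ _ (idx (rshift p b.2) i))).
  by rewrite (lin_sum (@mderiv_is_linear _ _ (idx (lshift q b.1) i))).
under eq_bigr do under eq_bigr do rewrite D.
under eq_bigr do rewrite big_split /=.
rewrite big_split /=; congr (_ + _).
  rewrite qmulE exchange_big; apply: eq_bigr => j _ /=.
  by rewrite /lap !mulr_sumr.
rewrite (sum_diagonal3 _ _ _ (fun i j => xr j * dr i f) (fun i j => xl j * dl i f)).
by rewrite card_ord -xpair_eqE -!surjective_pairing.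
Qed.

Lemma ext_comp_sum (T S : E -> Pol -> Pol) y :
    (forall c, linear (T c)) -> (forall c, linear (S c)) ->
  \sum_b extmul b (cmap (T b) (\sum_c extmul c (cmap (S c) y))) =
  \sum_b \sum_c extmul b (extmul c (cmap (T b) (cmap (S c) y))).
Proof.
move=> Tl Sl; apply: eq_bigr => b _.
rewrite (lin_sum (cmap_linear (Tl b))) (lin_sum (@extmul_linear _ _ _ b)).
by apply: eq_bigr => c _; rewrite (cmap_extmul c _ (Tl b)).
Qed.

Lemma d0_d0 y : d0 (d0 y) = 0.
Proof.
rewrite /d0 ext_comp_sum; try exact: qmul_linear.
apply: (@extmul2_sym _ _ _ _ id) => b c.
rewrite !cmap_comp; apply: eq_cmap => f; rewrite /= /qmul.
by rewrite mulrCA.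
Qed.

Lemma d1_d1 y : d1 (d1 y) = 0.
Proof.
rewrite /d1 ext_comp_sum; try exact: lap_linear.
apply: (@extmul2_sym _ _ _ _ id) => b c.
rewrite !cmap_comp; apply: eq_cmap => f; rewrite /= /lap.
have L (b1 c1 : E) (h : {mpoly C[N]}) : lap b1 (lap c1 h : Pol) = \sum_i \sum_j
    h^`M(idx (rshift p c1.2) j)^`M(idx (lshift q c1.1) j)
     ^`M(idx (rshift p b1.2) i)^`M(idx (lshift q b1.1) i).
  rewrite /lap; apply: eq_bigr => i _.
  rewrite (lin_sum (@mderiv_is_linear _ _ (idx (rshift p b1.2) i))).
  by rewrite (lin_sum (@mderiv_is_linear _ _ (idx (lshift q b1.1) i))).
rewrite [LHS]L [RHS]L exchange_big; apply: eq_bigr => i _; apply: eq_bigr => j _ /=.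
move: (idx _ _) (idx _ _) (idx _ _) (idx _ _) => i1 i2 i3 i4.
rewrite [f^`M(i1)^`M(i2)^`M(i3)]mderiv_comm [in LHS]mderiv_comm.
by rewrite [f^`M(i1)^`M(i3)]mderiv_comm [f^`M(i3)^`M(i1)^`M(i4)]mderiv_comm.
Qed.

Lemma d0_d1_anticomm y : d1 (d0 y) + d0 (d1 y) =
  \sum_b \sum_c extmul b (extmul c
    ((b.1 == c.1)%:R *: cmap (eop (rshift p c.2) (rshift p b.2)) y)) +
  \sum_b \sum_c extmul b (extmul c
    ((b.2 == c.2)%:R *: cmap (eop (lshift q c.1) (lshift q b.1)) y)).
Proof.
have e1 : d1 (d0 y) = \sum_b \sum_c extmul b (extmul c (cmap (lap b) (cmap (qmul c) y))).
  by rewrite /d1 /d0; apply: ext_comp_sum; [exact: lap_linear | exact: qmul_linear].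
have e0 : d0 (d1 y) = - \sum_b \sum_c extmul b (extmul c (cmap (qmul c) (cmap (lap b) y))).
  rewrite [LHS](ext_comp_sum y (@qmul_linear R p q k) (@lap_linear R p q k)).
  rewrite [LHS]exchange_big -sumrN; apply: eq_bigr => b _ /=; rewrite -sumrN.
  by apply: eq_bigr => c _; rewrite extmulC.
rewrite e1 e0; apply: (extmul2_split (z := k%:R *: y)) => b c.
exact: (cmap_comm y (lap_qmul b c)).
Qed.

(** The squares of [d0] and [d1] vanish identically; the mixed term is the curvature, which
    [Wneg_sym] and [Wpos_sym] cancel. *)
Lemma diff_diff y : Kinvariant y -> diff (diff y) = 0.
Proof.
move=> yi; have H1 := linB (@d1_linear R p q k) (d1 y) (d0 y).
have H0 := linB (@d0_linear R p q k) (d1 y) (d0 y).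
have cancel (V : zmodType) (a b c d : V) : a = 0 -> d = 0 -> b + c = 0 -> a - b - (c - d) = 0.
  by move=> -> -> bc; rewrite sub0r subr0 -opprD bc oppr0.
have E1 := etrans (congr1 (@d1 R p q k) (diffE y)) H1.
have E0 := etrans (congr1 (@d0 R p q k) (diffE y)) H0.
apply: etrans (diffE (diff y)) _; apply: etrans (congr2 (fun a b => a - b) E1 E0) _.
apply: cancel; [exact: d1_d1 | exact: d0_d0 |].
apply: etrans (d0_d1_anticomm y) _.
apply: (curvature_cancel (y := y) (en := fun n m => cmap (eop (rshift p n) (rshift p m)) y)
  (ep := fun a b => cmap (eop (lshift q a) (lshift q b)) y)).
- by move=> n m; exact: Wneg_sym.
- by move=> a b; exact: Wpos_sym.
Qed.

End SquareZero.

(** * Invariance of the volume form *)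

Section TopForm.
Variables (C : numClosedFieldType) (V : lmodType C).

Lemma foldr_allpairs (I J : Type) (H : I * J -> V -> V) z (s : seq I) (t : seq J) :
  foldr H z [seq (i, j) | i <- s, j <- t] =
  foldr (fun i x => foldr (fun j => H (i, j)) x t) z s.
Proof. by elim: s => //= i s IHs; rewrite foldr_cat IHs foldr_map. Qed.

Lemma foldr_allpairsr (I J : Type) (H : I * J -> V -> V) z (s : seq I) (t : seq J) :
  foldr H z [seq (i, j) | j <- t, i <- s] =
  foldr (fun j x => foldr (fun i => H (i, j)) x s) z t.
Proof. by elim: t => //= j t IHt; rewrite foldr_cat IHt foldr_map. Qed.

Lemma eq_foldr2 (I : Type) (G H : I -> V -> V) z s :
  (forall i x, G i x = H i x) -> foldr G z s = foldr H z s.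
Proof. by move=> GH; elim: s => //= i s ->. Qed.

Lemma perm_enum_pairs (I J : finType) :
  perm_eq (enum {: I * J}) [seq (i, j) | i <- enum I, j <- enum J].
Proof.
apply: uniq_perm; rewrite ?enum_uniq ?allpairs_uniq ?enum_uniq //; first by move=> [? ?] [? ?].
by move=> [i j]; rewrite mem_enum; apply/esym/allpairsP; exists (i, j); rewrite !mem_enum.
Qed.

Lemma perm_enum_pairsr (I J : finType) :
  perm_eq (enum {: I * J}) [seq (i, j) | j <- enum J, i <- enum I].
Proof.
apply: uniq_perm; rewrite ?enum_uniq ?allpairs_uniq ?enum_uniq //.
  by move=> [? ?] [? ?] _ _ [-> ->].
by move=> [i j]; rewrite mem_enum; apply/esym/allpairsP; exists (j, i); rewrite !mem_enum.
Qed.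

Lemma foldr_det1 n (G : 'I_n -> V -> V) (A : 'M[C]_n) z : anticommuting G ->
  \det A = 1 ->
  foldr (fun i x => \sum_j A i j *: G j x) z (enum 'I_n) = foldr G z (enum 'I_n).
Proof. by move=> aG A1; rewrite anticommuting_det // A1 scale1r. Qed.

(* Along enum of the pairs in row-major order v acts first, block by block; the
   remaining operators G are then read in column-major order, where u acts. *)
Lemma foldr_tensor_det1 p q (A : 'I_p * 'I_q -> V -> V) (u : 'M[C]_p) (v : 'M[C]_q) z :
    anticommuting A -> \det u = 1 -> \det v = 1 ->
  foldr (fun c x => \sum_c' (u c.1 c'.1 * v c.2 c'.2) *: A c' x) z (enum {: 'I_p * 'I_q}) =
  foldr A z (enum {: 'I_p * 'I_q}).
Proof.
move=> aA u1 v1; have [Al _ _] := aA.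
pose w (c c' : 'I_p * 'I_q) := (c.2 == c'.2)%:R * u c.1 c'.1.
pose G c x := \sum_c' w c c' *: A c' x.
have aG : anticommuting G by exact: anticommuting_comb.
have sub (H : 'I_p * 'I_q -> V -> V) : anticommuting H ->
    (forall i, anticommuting (fun j => H (i, j))) /\ (forall j, anticommuting (fun i => H (i, j))).
  by case=> Hl HC HS; split=> i; split.
have GE i j x : G (i, j) x = \sum_i' u i i' *: A (i', j) x.
  transitivity (\sum_i' \sum_j' ((j == j')%:R * u i i') *: A (i', j') x).
    by rewrite pair_bigA; apply: eq_bigr => -[].
  apply: eq_bigr => i' _; rewrite (bigD1 j) //= eqxx mul1r big1 ?addr0 // => j' jj'.
  by rewrite eq_sym (negPf jj') mul0r scale0r.
have FE i j x : \sum_c' (u i c'.1 * v j c'.2) *: A c' x = \sum_j' v j j' *: G (i, j') x.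
  transitivity (\sum_i' \sum_j' (u i i' * v j j') *: A (i', j') x).
    by rewrite pair_bigA; apply: eq_bigr => -[].
  rewrite [LHS]exchange_big; apply: eq_bigr => j' _ /=.
  by rewrite GE scaler_sumr; apply: eq_bigr => i' _; rewrite scalerA mulrC.
pose F c x := \sum_c' (u c.1 c'.1 * v c.2 c'.2) *: A c' x.
have aF : anticommuting F by exact: (anticommuting_comb (fun c c' => u c.1 c'.1 * v c.2 c'.2) aA).
transitivity (foldr G z (enum {: 'I_p * 'I_q})).
  have [e eP] := @anticommuting_perm _ C _ _ (perm_enum_pairs 'I_p 'I_q).
  rewrite (eP _ F z aF) (eP _ G z aG) !foldr_allpairs; congr (_ *: _).
  apply: eq_foldr2 => i x; rewrite -(foldr_det1 _ (proj1 (sub G aG) i) v1).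
  by apply: eq_foldr2 => j y; exact: FE.
have [e eP] := @anticommuting_perm _ C _ _ (perm_enum_pairsr 'I_p 'I_q).
rewrite (eP _ G z aG) (eP _ A z aA) !foldr_allpairsr; congr (_ *: _).
apply: eq_foldr2 => j x; rewrite -(foldr_det1 _ (proj2 (sub A aA) j) u1).
by apply: eq_foldr2 => i y; exact: GE.
Qed.

End TopForm.

Section VolumeForm.
Variables (R : realType) (p q k : nat).
Local Notation C := (R[i])%C.
Local Notation E := ('I_p * 'I_q)%type.
Local Notation Pol := (Pol R p q k).

(** Both blocks have determinant 1, so only the coefficient is moved. *)
Lemma Kact_vol (g : 'M[R]_(p + q)) (f : Pol) : inK g ->
  Kact g (wedge (enum {: E}) f) = wedge (enum {: E}) (Pact g f).
Proof.
move=> gK; have [u [v [[_ u1] [_ v1] gE]]] := gK.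
transitivity (foldr (fun c x => \sum_c' coadC g c c' *: extmul c' x)
    (ext0 E (Pact g f)) (enum {: E})).
  elim: (enum _) => [|c s IHs] /=; first exact: Kact_ext0.
  by rewrite Kact_extmul IHs.
(* The coadjoint coefficients involve the transposed blocks. *)
pose U : 'M[C]_p := \matrix_(i, j) (u j i)%:C%C.
pose W : 'M[C]_q := \matrix_(i, j) (v j i)%:C%C.
have U1 : \det U = 1.
  rewrite -[LHS]det_tr (_ : U^T = map_mx (real_complex R) u).
    by rewrite det_map_mx u1 rmorph1.
  by apply/matrixP=> i j; rewrite !mxE.
have W1 : \det W = 1.
  rewrite -[LHS]det_tr (_ : W^T = map_mx (real_complex R) v).
    by rewrite det_map_mx v1 rmorph1.
  by apply/matrixP=> i j; rewrite !mxE.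
apply: etrans _ (@foldr_tensor_det1 C (ext E Pol) p q _ U W _
  (@extmul_anticommuting C E Pol) U1 W1).
apply: eq_foldr2 => c x; apply: eq_bigr => c' _; congr (_ *: _).
by rewrite /coadC gE coadjoint_block ?rmorphM ?mxE // -gE.
Qed.

End VolumeForm.

(** * Induction on the degree *)

Section Tail.
Variables (R : realType) (p q k : nat).
Local Notation C := (R[i])%C.
Local Notation E := ('I_p * 'I_q)%type.
Local Notation Pol := (Pol R p q k).
Local Notation cochains := (ext E Pol).
Local Notation N := ((p + q) * k)%N.
Local Notation homdeg := (@homdeg R p q k).
Local Notation homdeg_pred := (@homdeg_pred R p q k).
Implicit Types (x y : cochains).

Definition etail d x : cochains := cmap (@mtail C N d) x.

Lemma mtail_linear d : linear (@mtail C N d).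
Proof. exact: mfilter_linear. Qed.

Lemma etail_linear d : linear (etail d).
Proof. exact: (cmap_linear (@mtail_linear d)). Qed.

Lemma mtail_qmul d c (f : {mpoly C[N]}) :
  mtail d.+2 (qmul c (f : Pol) : {mpoly C[N]}) = qmul c (mtail d f).
Proof.
rewrite !qmulE (lin_sum (@mtail_linear d.+2)); apply: eq_bigr => i _.
by rewrite !mtail_mulX.
Qed.

(** The truncated [d.-2] is correct for small [d], since [lap] kills all terms of degree below 2. *)
Lemma mtail_lap d c (f : {mpoly C[N]}) :
  lap c (mtail d f : Pol) = mtail d.-2 (lap c f : {mpoly C[N]}).
Proof.
have D e j (h : {mpoly C[N]}) : (mtail e h)^`M(j) = mtail e.-1 h^`M(j).
  case: e => [|e]; last by rewrite mtail_mderiv.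
  have id0 (h' : {mpoly C[N]}) : mtail 0 h' = h'.
    by apply/mpolyP=> m; rewrite mcoeff_mfilter.
  by rewrite !id0.
rewrite /lap (lin_sum (@mtail_linear d.-2)); apply: eq_bigr => i _.
by rewrite !D.
Qed.

Lemma d0_etail d x : d0 (etail d x) = etail d.+2 (d0 x).
Proof.
rewrite /d0 (lin_sum (@etail_linear d.+2)); apply: eq_bigr => c _.
rewrite /etail (cmap_extmul c _ (@mtail_linear d.+2)); congr (extmul c _).
by apply/ffunP=> S; rewrite !cmapE mtail_qmul.
Qed.

Lemma d0s_etail d x : d0s (etail d x) = etail d.-2 (d0s x).
Proof.
rewrite /d0s (lin_sum (@etail_linear d.-2)); apply: eq_bigr => c _.
rewrite /etail (cmap_contract c _ (@mtail_linear d.-2)); congr (contract c _).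
by apply/ffunP=> S; rewrite !cmapE mtail_lap.
Qed.

Lemma etail_eq0 P d x : filt C N P d x -> etail d x = 0.
Proof.
move=> xd; apply/ffunP=> S; rewrite cmapE [RHS]ffunE; apply/mtail_eq0.
by case: (xd S).
Qed.

Lemma hom_lower l n x : homdeg l n.+2 x -> etail n x = 0 -> homdeg l n x.
Proof.
move=> xl x0 S; split; last by case: (xl S).
apply/mtail_eq0; have := congr1 (fun z : cochains => z S) x0.
by rewrite cmapE [X in _ = X -> _]ffunE.
Qed.

Lemma homS l d x : homdeg l d x -> homdeg_pred l.+1 d x.
Proof. by move=> xl S; have [xd xS] := xl S; split=> // nS; apply: xS; rewrite -eqSS. Qed.

Lemma hom_predS l d x : homdeg_pred l.+1 d x -> homdeg l d x.
Proof. by move=> xl S; have [xd xS] := xl S; split=> // nS; apply: xS; rewrite eqSS. Qed.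

Lemma Kinv_lin a x y : Kinvariant x -> Kinvariant y -> Kinvariant (a *: x + y).
Proof. by move=> xi yi g gK; rewrite (@Kact_linear R p q k g) (xi g gK) (yi g gK). Qed.

Lemma KinvD x y : Kinvariant x -> Kinvariant y -> Kinvariant (x + y).
Proof. by move=> xi yi; rewrite -[x]scale1r; exact: Kinv_lin. Qed.

Lemma KinvB x y : Kinvariant x -> Kinvariant y -> Kinvariant (x - y).
Proof. by move=> xi yi; rewrite addrC -scaleN1r; exact: Kinv_lin. Qed.

Lemma Kinv0 : Kinvariant (0 : cochains).
Proof. by move=> g _; rewrite (lin0 (@Kact_linear R p q k g)). Qed.

Lemma Kinv_d0 x : Kinvariant x -> Kinvariant (d0 x).
Proof. by move=> xi g gK; rewrite (Kact_d0 x gK) (xi g gK). Qed.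

Lemma Kinv_d1 x : Kinvariant x -> Kinvariant (d1 x).
Proof. by move=> xi g gK; rewrite (Kact_d1 x gK) (xi g gK). Qed.

Lemma Kinv_diff x : Kinvariant x -> Kinvariant (diff x).
Proof. by move=> xi; rewrite diffE; apply: KinvB; [exact: Kinv_d1 | exact: Kinv_d0]. Qed.

End Tail.

Section Filtration.
Variables (R : realType) (p q k : nat).
Hypothesis hpq : (p * q <= k)%N.
Local Notation C := (R[i])%C.
Local Notation E := ('I_p * 'I_q)%type.
Local Notation Pol := (Pol R p q k).
Local Notation cochains := (ext E Pol).
Local Notation N := ((p + q) * k)%N.
Local Notation d0 := (@d0 R p q k).
Local Notation d1 := (@d1 R p q k).
Local Notation d0s := (@d0s R p q k).
Local Notation diff := (@diff R p q k).
Local Notation homdeg := (@homdeg R p q k).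
Local Notation homdeg_pred := (@homdeg_pred R p q k).
Implicit Types (x y : cochains).

Let d0_lin := @d0_linear R p q k.
Let diff_lin := @diff_linear R p q k.

Lemma hom_homogeneous l d x : homdeg l d x -> homogeneous l x.
Proof. by move=> xl S; case: (xl S) => _. Qed.

Lemma hom_d1_pred l n y : homdeg_pred l n y -> homdeg l n (d1 y).
Proof. by move=> yl; apply: d1_hom; apply: filt_le yl; exact/leqW. Qed.

Lemma homD l n x y : homdeg l n x -> homdeg l n y -> homdeg l n (x + y).
Proof. by move=> xl yl; rewrite -[x]scale1r; exact: submodP. Qed.

(* A d0s-closed element whose d0 has no top part vanishes in top degree, by
   exactness of the Koszul complex. *)
Lemma harmonic_lower l n h : (l < p * q)%N -> homdeg l n.+2 h -> d0s h = 0 ->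
  etail n.+2 (d0 h) = 0 -> homdeg l n h.
Proof.
move=> lpq hl h0 d0h; apply: (hom_lower hl).
apply: (harmonic_eq0 hpq lpq).
- move=> S nS; rewrite cmapE (hom_homogeneous hl nS).
  exact: (lin0 (@mtail_linear R p q k n)).
- by rewrite d0_etail.
by rewrite d0s_etail h0 (lin0 (@etail_linear R p q k n.-2)).
Qed.

(** Adding [diff y] exchanges the high part [d0 y] for [d1 y], of lower degree. *)
Lemma hodge_sub_diff (x y h : cochains) : x = d0 y + h -> x + diff y = h + d1 y.
Proof. by move=> ->; rewrite diffE addrC addrA subrK addrC. Qed.

Lemma cocycle_exact l n x : (l < p * q)%N -> homdeg l n x -> Kinvariant x ->
  diff x = 0 -> exists y, [/\ exists d, homdeg_pred l d y, Kinvariant y & x = diff y].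
Proof.
move=> lpq; elim: n x => [|n IHn] x xl xi x0.
  exists 0; split; [by exists 0%N; exact: submod0 | exact: Kinv0 |].
  rewrite (lin0 diff_lin); apply/ffunP=> S; rewrite [RHS]ffunE.
  by apply/mpolyP=> m; have [xS _] := xl S; rewrite xS // mcoeff0.
(* The weakened bound gives [y], and with it [d1 y], the bound [n], one below that of [x]. *)
have xl2 : homdeg l n.+2 x by apply: filt_le xl.
have [y [h [yl yi hl hi [h0 xE]]]] := hodge_invariant xl2 xi.
(* The cocycle condition reads [d0 x = d1 x], so [d0 h] has no part in high degree and
   [harmonic_lower] applies. *)
have d0h : d0 h = d1 x.
  have : d1 x - d0 x = 0 by rewrite -diffE.
  by move/eqP; rewrite subr_eq0 => /eqP ->; rewrite xE (linD d0_lin) d0_d0 add0r.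
have hn : homdeg l n h.
  apply: (harmonic_lower lpq hl h0); rewrite d0h.
  apply: (@etail_eq0 _ _ _ _ (fun S : {set E} => #|S| == l.+1)).
  by apply: (@filt_le _ _ _ _ n); [exact/leqW | exact: (d1_hom (homS xl2))].
pose x' := x + diff y.
have x'E : x' = h + d1 y by exact: (hodge_sub_diff xE).
have x'l : homdeg l n x' by rewrite x'E; apply: homD; [exact: hn | exact: hom_d1_pred].
have x'i : Kinvariant x' by apply: KinvD; [exact: xi | exact: Kinv_diff].
have x'0 : diff x' = 0 by rewrite /x' (linD diff_lin) x0 add0r; exact: diff_diff.
have [z [[d zl] zi zE]] := IHn x' x'l x'i x'0.
exists (z - y); split; [|exact: KinvB|].
  exists (maxn d n); rewrite addrC -scaleN1r; apply: submodP.
    by apply: filt_le yl; exact: leq_maxr.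
  by apply: filt_le zl; exact: leq_maxl.
by rewrite (linB diff_lin) -zE /x' addrK.
Qed.

(** The last clause is Fischer orthogonality to the image of [d0], that is, in top degree, to the
    multiples of the generators. *)
Definition harmonic x := [/\ homogeneous (p * q)%N x, Kinvariant x & d0s x = 0].

Lemma harmonic_add x y : harmonic x -> harmonic y -> harmonic (x + y).
Proof.
move=> [xl xi x0] [yl yi y0]; split; last by rewrite (linD (@d0s_linear R p q k)) x0 y0 addr0.
  by move=> S nS; rewrite ffunE xl // yl // addr0.
exact: KinvD.
Qed.

Lemma harmonic0 : harmonic 0.
Proof.
split; [by move=> S _; rewrite ffunE | exact: Kinv0 |].
exact: (lin0 (@d0s_linear R p q k)).
Qed.

(** Each round sets the harmonic part aside and passes on [d1 y], which has a smaller degree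
    bound. *)
Lemma harmonic_spanning n x : homdeg (p * q)%N n x -> Kinvariant x ->
  exists h y, [/\ harmonic h, exists d, homdeg_pred (p * q)%N d y, Kinvariant y &
    x = h + diff y].
Proof.
elim: n x => [|n IHn] x xl xi.
  exists 0, 0; split; [exact: harmonic0 | by exists 0%N; exact: submod0 | exact: Kinv0 |].
  rewrite (lin0 diff_lin) addr0; apply/ffunP=> S; rewrite [RHS]ffunE.
  by apply/mpolyP=> m; have [xS _] := xl S; rewrite xS // mcoeff0.
have xl2 : homdeg (p * q)%N n.+2 x by apply: filt_le xl.
have [y [h [yl yi hl hi [h0 xE]]]] := hodge_invariant xl2 xi.
have [h' [z [h'H [d zl] zi zE]]] := IHn (d1 y) (hom_d1_pred yl) (Kinv_d1 yi).
exists (h + h'), (z - y); split.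
- apply: harmonic_add; last exact: h'H.
  by split; [exact: (hom_homogeneous hl) | exact: hi | exact: h0].
- exists (maxn d n); rewrite addrC -scaleN1r; apply: submodP.
    by apply: filt_le yl; exact: leq_maxr.
  by apply: filt_le zl; exact: leq_maxl.
- exact: KinvB.
have := hodge_sub_diff xE; rewrite zE (linB diff_lin) !addrA => <-.
by rewrite addrK.
Qed.

(** The top part of [h = diff y] comes from [d0] alone; being exact and killed by [d0s], it
    vanishes. The primitive [y] can then be changed by a coboundary to one of lower degree with the
    same differential. *)
Lemma harmonic_independent l n h y : (p * q)%N = l.+1 -> homdeg_pred (p * q)%N n y ->
  Kinvariant y -> harmonic h -> h = diff y -> h = 0.
Proof.
move=> pql; rewrite {1}pql => yl yi hH; have [hl hi h0] := hH.
have {yl} yl : homdeg l n y by exact: hom_predS.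
elim: n y yl yi => [|n IHn] y yl yi hE.
  have y0 : y = 0.
    apply/ffunP=> S; rewrite [RHS]ffunE.
    by apply/mpolyP=> m; have [yS _] := yl S; rewrite yS // mcoeff0.
  by rewrite hE y0 (lin0 diff_lin).
have lpq : (l < p * q)%N by rewrite pql.
have yl2 : homdeg l n.+2 y by apply: filt_le yl.
have [z [w [zl zi wl wi [w0 yE]]]] := hodge_invariant yl2 yi.
have tail_d1 : etail n.+2 (d1 y) = 0.
  apply: (@etail_eq0 _ _ _ _ (fun S : {set E} => #|S| == l.+1)).
  by apply: (@filt_le _ _ _ _ n); [exact/leqW | exact: (d1_hom (homS yl2))].
have tail_h : etail n.+2 h = d0 (- etail n y).
  apply: etrans (congr1 (etail n.+2) (etrans hE (diffE y))) _.
  apply: etrans (linB (@etail_linear R p q k n.+2) _ _) _.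
  apply: etrans (congr1 (fun z : cochains => z - _) tail_d1) _; rewrite sub0r.
  by rewrite (linN d0_lin) d0_etail.
have tail_h0 : etail n.+2 h = 0.
  apply: (harmonic_d0_eq0 (u := - etail n y)); last exact: tail_h.
  by rewrite d0s_etail h0 (lin0 (@etail_linear R p q k _)).
have tail_d0 : etail n.+2 (d0 w) = 0.
  have d0w : d0 w = d0 y.
    apply/esym; apply: etrans (congr1 d0 yE) _; apply: etrans (linD d0_lin _ _) _.
    exact: etrans (congr1 (fun t : cochains => t + d0 w) (d0_d0 z)) (add0r _).
  rewrite d0w; apply: etrans (esym (d0_etail n y)) _.
  have := linN d0_lin (etail n y); rewrite -tail_h tail_h0 => /esym/eqP.
  by rewrite oppr_eq0 => /eqP.
have wn : homdeg l n w := harmonic_lower lpq wl w0 tail_d0.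
(* The new primitive equals [w + d1 z], bounded by [n]; its differential is unchanged because [z] is
   invariant. *)
apply: (IHn (y + diff z)).
- by rewrite (hodge_sub_diff yE); apply: homD; [exact: wn | exact: hom_d1_pred].
- by apply: KinvD; [exact: yi | exact: Kinv_diff].
by rewrite (linD diff_lin) (diff_diff zi) addr0.
Qed.

End Filtration.

(** * The cohomology *)

Section LinearBijections.
Variable C : pzRingType.
Local Open Scope quotient_scope.

Lemma inj_surj_bij (A B : Type) (f : A -> B) :
  injective f -> (forall b, exists a, f a = b) -> bijective f.
Proof.
move=> fi fs; pose g b := projT1 (cid (fs b)).
have gK : cancel g f by move=> b; exact: (projT2 (cid (fs b))).
by exists g => // a; apply: fi; rewrite gK.
Qed.

Lemma linear_bij_transfer (X A B : lmodType C) (phi : X -> A) (psi : X -> B) :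
    linear phi -> linear psi -> bijective phi -> bijective psi ->
  exists f : {linear A -> B}, bijective f.
Proof.
move=> phil psil [g phiK gK] [h psiK hK].
have fl : linear (psi \o g).
  move=> a x y /=; rewrite -psil; congr psi.
  by apply: (can_inj phiK); rewrite phil !gK.
pose F : {linear A -> B} := HB.pack (psi \o g) (GRing.isLinear.Build C A B *:%R (psi \o g) fl).
exists F; by exists (phi \o h) => x /=; rewrite ?psiK ?gK // phiK hK.
Qed.

Lemma subr_exchange (U : zmodType) (a b c d : U) : a - b - (c - d) = a - c - (b - d).
Proof. by rewrite 2!opprB -2!addrA; congr (_ + _); rewrite addrCA [RHS]addrCA [- b - c]addrC. Qed.

Lemma quot_pi0 (U : lmodType C) (W : submodule U) :
  \pi_(quot_module W) 0 = 0 :> quot_module W.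
Proof. by rewrite -[RHS](scale0r (\pi_(quot_module W) 0)) -quot_piZ scale0r. Qed.

Lemma submod_val_linear (U : lmodType C) (W : submodule U) :
  linear (fun x : submod_type W => val x : U).
Proof. by move=> a x y; rewrite linearP. Qed.

Lemma submod_valB (U : lmodType C) (W : submodule U) (x y : submod_type W) :
  val (x - y) = val x - val y :> U.
Proof. exact: (linB (@submod_val_linear U W)). Qed.

Lemma submod_valP (U : lmodType C) (W : submodule U) (x : submod_type W) : W (val x).
Proof. exact/submod_predP/(valP x). Qed.

Definition submod_elem (U : lmodType C) (W : submodule U) (u : U) (Wu : W u) :
  submod_type W := Sub u (introT (submod_predP W u) Wu).

Lemma subquotient_complement (U : lmodType C) (Z B H : submodule U) :
    (forall h, H h -> Z h) -> (forall h, H h -> B h -> h = 0) ->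
    (forall z, Z z -> exists h, H h /\ B (z - h)) ->
  exists phi : submod_type H -> subquotient Z B, linear phi /\ bijective phi.
Proof.
move=> HZ HB ZH.
pose phi (h : submod_type H) : subquotient Z B :=
  \pi_(subquotient Z B) (submod_elem (HZ _ (submod_valP h))).
exists phi; split.
  move=> a x y; rewrite /phi -quot_piZ -quot_piD; congr (\pi__ _).
  by apply: val_inj; rewrite [RHS]submod_val_linear; exact: submod_val_linear.
apply: inj_surj_bij => [x y /eqP/quot_eqP xy|].
  apply/val_inj/eqP; rewrite -subr_eq0; apply/eqP/HB.
    by rewrite -submod_valB; exact: submod_valP.
  pose e t := submod_elem (HZ _ (submod_valP (W := H) t)).
  have : B (val (e x - e y)) by exact: xy.
  by rewrite submod_valB.
elim/quotW => z; have [h [Hh Bh]] := ZH _ (submod_valP z).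
pose e t := submod_elem (HZ _ (submod_valP (W := H) t)).
exists (submod_elem Hh); apply/eqP/quot_eqP.
suff : B (val (e (submod_elem Hh) - z)) by [].
rewrite submod_valB /= -opprB -scaleN1r -[_ *: _]addr0; apply: submodP; last exact: submod0.
exact: Bh.
Qed.

Lemma submod_iso (U V : lmodType C) (H : submodule U) (W : submodule V) (f : U -> V) :
    linear f -> (forall h, H h -> W (f h)) -> (forall h, H h -> f h = 0 -> h = 0) ->
    (forall w, W w -> exists h, H h /\ f h = w) ->
  exists psi : submod_type H -> submod_type W, linear psi /\ bijective psi.
Proof.
move=> fl fW f0 Wf.
pose psi (h : submod_type H) : submod_type W := submod_elem (fW _ (submod_valP h)).
exists psi; split.
  move=> a x y; apply: val_inj; rewrite [RHS]submod_val_linear -fl.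
  by congr f; exact: submod_val_linear.
apply: inj_surj_bij => [x y /(congr1 val) /= fxy|w].
  apply/val_inj/eqP; rewrite -subr_eq0; apply/eqP; apply: f0.
    by rewrite -submod_valB; exact: submod_valP.
  by rewrite (linB fl) fxy subrr.
have [h [Hh fh]] := Wf _ (submod_valP w).
by exists (submod_elem Hh); apply: val_inj.
Qed.

End LinearBijections.

Section Cohomology.
Local Open Scope quotient_scope.
Variables (R : realType) (p q k : nat).
Hypotheses (hp : (1 <= p)%N) (hq : (1 <= q)%N) (hpq : (p * q <= k)%N).
Local Notation C := (R[i])%C.
Local Notation E := ('I_p * 'I_q)%type.
Local Notation Pol := (Pol R p q k).
Local Notation cochains := (ext E Pol).
Local Notation N := ((p + q) * k)%N.
Local Notation d0 := (@d0 R p q k).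
Local Notation d1 := (@d1 R p q k).
Local Notation d0s := (@d0s R p q k).
Local Notation diff := (@diff R p q k).
Local Notation homdeg := (@homdeg R p q k).
Local Notation homdeg_pred := (@homdeg_pred R p q k).
Local Notation L := (p * q)%N.
Implicit Types (x y h : cochains).

Lemma card_E : #|{: E}| = L.
Proof. by rewrite card_prod !card_ord. Qed.

Lemma homogeneous_homdeg l x : homogeneous l x -> exists d, homdeg l d x.
Proof. by move=> xl; apply: filt_bound => S; exact: xl. Qed.

Lemma coboundaries_diff l d y : homdeg_pred l d y -> Kinvariant y ->
  coboundaries R p q k l (diff y).
Proof.
move=> yl yi; case: l yl => [|l] yl /=.
  (* In degree 0 the condition [#|S|.+1 == 0] holds for no set. *)
  have -> : y = 0 by apply/ffunP=> S; rewrite [RHS]ffunE; case: (yl S) => _ ->.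
  exact: (lin0 (@diff_linear R p q k)).
exists y => //; split=> [S nS|]; last exact: yi.
by case: (yl S) => _; apply; rewrite eqSS.
Qed.

Lemma coboundariesP l x : coboundaries R p q k l x ->
  exists y, [/\ exists d, homdeg_pred l d y, Kinvariant y & x = diff y].
Proof.
case: l => [->|l [y [yl yi] ->]].
  exists 0; split; [by exists 0%N; exact: submod0 | exact: Kinv0 |].
  by rewrite (lin0 (@diff_linear R p q k)).
exists y; split=> //; have [d yd] := homogeneous_homdeg yl.
by exists d; exact: homS.
Qed.

Lemma cocycle_coboundary l x : l <> L -> cocycles R p q k l x ->
  coboundaries R p q k l x.
Proof.
move=> lL [[xl xi] x0]; have [d xd] := homogeneous_homdeg xl.
have [lpq|lpq|//] := ltngtP l L.
  have [y [[e yl] yi ->]] := cocycle_exact hpq lpq xd xi x0.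
  exact: coboundaries_diff yl yi.
(* Above degree pq no set has the required cardinality. *)
have -> : x = 0.
  apply/ffunP=> S; rewrite [RHS]ffunE; apply: xl.
  by rewrite neq_ltn (leq_ltn_trans (max_card _)) // card_E.
exact: submod0.
Qed.

Lemma cohomology_eq0 l (x : cohomology R p q k l) : l <> L -> x = 0.
Proof.
move=> lL; elim/quotW: x => z; rewrite -[RHS]quot_pi0.
apply/eqP/quot_eqP; rewrite subr0.
by apply: cocycle_coboundary => //; exact/submod_predP/(valP z).
Qed.

Lemma extmul_top c x : homogeneous L x -> extmul c x = 0.
Proof.
move=> xl; apply/ffunP=> S; rewrite extmulE [RHS]ffunE; case: ifP => // cS.
rewrite xl ?scaler0 // -card_E -cardsT; apply: contraFneq (setD11 c S) => SE.
suff -> : S :\ c = setT by rewrite inE.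
by apply/eqP; rewrite eqEcard subsetT SE leqnn.
Qed.

Lemma cmap_homogeneous (f : Pol -> Pol) l x : linear f -> homogeneous l x ->
  homogeneous l (cmap f x).
Proof. by move=> fl xl S nS; rewrite cmapE xl // (lin0 fl). Qed.

Lemma d0_top x : homogeneous L x -> d0 x = 0.
Proof.
move=> xl; rewrite /d0 big1 // => c _; apply: extmul_top.
by apply: cmap_homogeneous xl; exact: qmul_linear.
Qed.

Lemma d1_top x : homogeneous L x -> d1 x = 0.
Proof.
move=> xl; rewrite /d1 big1 // => c _; apply: extmul_top.
by apply: cmap_homogeneous xl; exact: lap_linear.
Qed.

Lemma diff_top x : homogeneous L x -> diff x = 0.
Proof. by move=> xl; rewrite diffE d0_top // d1_top // subr0. Qed.

Lemma wedge_topE (M : lmodType C) (m : M) :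
  wedge (enum {: E}) m = [ffun S : {set E} => if S == setT then m else 0].
Proof. by rewrite enumT -enum_setT wedge_enum. Qed.

Lemma wedge_top_homogeneous (m : Pol) : homogeneous L (wedge (enum {: E}) m).
Proof.
move=> S nS; rewrite wedge_topE ffunE; case: eqP => // SE.
by rewrite SE cardsT card_E eqxx in nS.
Qed.

Lemma homogeneous_top x : homogeneous L x -> x = wedge (enum {: E}) (x setT).
Proof.
move=> xl; apply/ffunP=> S; rewrite wedge_topE ffunE.
case: (altP (S =P setT)) => [-> //|ST]; apply: xl.
by apply: contraNneq ST => SL; rewrite eqEcard subsetT cardsT card_E SL leqnn.
Qed.

Lemma qideal_d0 x : qideal R p q k (d0 x setT).
Proof.
pose h (c : E) : Pol := esign C setT c *: x (setT :\ c).
exists h; rewrite /d0 sum_ffunE; apply: eq_bigr => c _.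
by rewrite extmulE inE cmapE /h /qmul -scalerAl mulrC.
Qed.

Lemma d0_qideal (f : Pol) : qideal R p q k f ->
  exists u, wedge (enum {: E}) f = d0 u.
Proof.
(* Top forms are [d0]-closed, so by [koszul_contract] contracting by [c] and applying [d0]
   multiplies them by the generator of index [c]. *)
case=> h ->; exists (\sum_c contract c (wedge (enum {: E}) (h c))).
rewrite (lin_sum (@wedge_linear _ _ _ _)) (lin_sum (@d0_linear R p q k)).
apply: eq_bigr => c _; rewrite (d0E hpq) koszul_contract -(d0E hpq).
rewrite (d0_top (wedge_top_homogeneous _)) (lin0 (@contract_linear _ _ _ c)) subr0.
apply/ffunP=> S; rewrite cmapE !wedge_topE !ffunE.
case: ifP => _; last by rewrite (lin0 (@kmul_linear _ _ _ _ _ c)).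
by rewrite /kmul -qpoly_lead mulrC.
Qed.

Lemma harmonic_scale a x : harmonic x -> harmonic (a *: x).
Proof.
move=> [xl xi x0]; split.
- by move=> S nS; rewrite ffunE xl // scaler0.
- by rewrite -[a *: x]addr0; apply: Kinv_lin; [exact: xi | exact: Kinv0].
by rewrite (linZ (@d0s_linear R p q k)) x0; exact: scaler0.
Qed.

Definition harmonics : submodule cochains := @Submodule _ _ (@harmonic R p q k)
  (@harmonic0 R p q k) (fun a x y xH yH => harmonic_add (harmonic_scale a xH) yH).

Lemma harmonic_cocycle h : harmonic h -> cocycles R p q k L h.
Proof. by case=> hl hi _; split; [split | exact: diff_top]. Qed.

Local Notation X := (submod_type harmonics).

Lemma harmonics_cohomology : exists phi : X -> cohomology R p q k L,
  linear phi /\ bijective phi.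
Proof.
have pq_gt0 : (0 < L)%N by rewrite muln_gt0 hp.
apply: (@subquotient_complement _ _ (cocycles R p q k L) (coboundaries R p q k L) harmonics).
- exact: harmonic_cocycle.
- move=> h hH /coboundariesP[y [[d yl] yi hE]].
  exact: (harmonic_independent hpq (esym (prednK pq_gt0)) yl yi hH hE).
move=> z [[zl zi] _]; have [d zd] := homogeneous_homdeg zl.
have [h [y [hH [e yl] yi zE]]] := harmonic_spanning zd zi.
exists h; split; first exact: hH.
by rewrite zE [h + _]addrC addrK; exact: coboundaries_diff yl yi.
Qed.

Local Notation Q := (Polq R p q k).

Lemma quot_pi_linear (K : pzRingType) (U : lmodType K) (W : submodule U) :
  linear (fun u : U => \pi_(quot_module W) u).
Proof. by move=> a u v; rewrite -quot_piZ -quot_piD. Qed.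

Lemma vol_inj : injective (@vol R p q k).
Proof.
move=> x y /(congr1 (fun z : ext E Q => z setT)).
by rewrite /vol !wedge_topE !ffunE eqxx.
Qed.

Lemma harmonic_vol_invariant h : harmonic h ->
  Polq_invariants_vol R p q k (vol (\pi_Q (h setT))).
Proof.
case=> hl hi _; exists (\pi_Q (h setT)) => // g gK.
rewrite Polq_act_pi //; congr (\pi_Q _).
have := hi g gK; rewrite {1}(homogeneous_top hl) (Kact_vol _ gK).
move/(congr1 (fun z : cochains => z setT)).
by rewrite wedge_topE ffunE eqxx.
Qed.

(** A harmonic form with coefficient in the ideal is [d0]-exact, hence zero. Conversely the Hodge
    projection changes a top form only by an element of the ideal times the volume form. *)
Lemma harmonics_invariants : exists psi : X -> submod_type (Polq_invariants_vol R p q k),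
  linear psi /\ bijective psi.
Proof.
apply: (@submod_iso _ _ _ harmonics (Polq_invariants_vol R p q k)
  (fun h : cochains => vol (\pi_Q (h setT)))).
- move=> a x y; rewrite /vol !ffunE.
  by rewrite (quot_pi_linear (qideal R p q k)) wedge_linear.
- exact: harmonic_vol_invariant.
- move=> h [hl hi h0] hv; have qh : qideal R p q k (h setT).
    have /vol_inj : vol (\pi_Q (h setT)) = vol (\pi_Q 0).
      by rewrite hv quot_pi0 /vol (lin0 (@wedge_linear _ _ _ _)).
    by move/eqP/quot_eqP; rewrite subr0.
  have [u hu] := d0_qideal qh.
  by apply: (harmonic_d0_eq0 h0 (u := u)); rewrite -hu -homogeneous_top.
move=> _ [x xi ->]; elim/quotW: x xi => f fi.
have fl := wedge_top_homogeneous f; have [d fd] := homogeneous_homdeg fl.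
have fd2 : homdeg L d.+2 (wedge (enum {: E}) f) by apply: filt_le fd; exact/leqW.
(* The form is invariant only modulo the ideal, so [hodge_invariant] does not apply; the invariance
   of the projection is recovered below. *)
have [u ul h0] := hodge fd2.
pose h := wedge (enum {: E}) f - d0 u.
have hl : homogeneous L h.
  by move=> S nS; rewrite /h !ffunE fl // (hom_homogeneous (d0_hom ul)) // subr0.
exists h; split.
  split=> // g gK; apply/eqP; rewrite -subr_eq0; apply/eqP.
  have fg : \pi_Q (Pact g f) = \pi_Q f by rewrite -Polq_act_pi //; exact: fi.
  have [v hv] := d0_qideal (elimT (quot_eqP _ _ _) (introT eqP fg)).
  (* The failure of invariance of [f] is [d0 v] and that of [d0 u] is [d0 (Kact g u - u)], so
     [Kact g h - h] is exact; it is also killed by [d0s]. *)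
  apply: (harmonic_d0_eq0 (u := v - (Kact g u - u))).
    rewrite (linB (@d0s_linear R p q k)) -(Kact_d0s _ gK) h0.
    by rewrite (lin0 (@Kact_linear R p q k g)) subr0.
  rewrite (linB (@d0_linear R p q k)) -hv (linB (@d0_linear R p q k)).
  rewrite (linB (@wedge_linear _ _ _ _)) -(Kact_vol f gK) -(Kact_d0 u gK).
  rewrite /h (linB (@Kact_linear R p q k g)).
  exact: subr_exchange.
congr (vol _); apply/eqP/quot_eqP; rewrite /h !ffunE wedge_topE ffunE eqxx.
have -> : f - d0 u setT - f = (-1) *: (d0 u setT) + 0.
  by rewrite addr0 scaleN1r addrAC subrr sub0r.
by apply: submodP; [exact: qideal_d0 | exact: submod0].
Qed.

End Cohomology.

Unset Implicit Arguments.

Theorem theorem1p0p2 (R : realType) (p q k : nat)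
  (hp : (1 <= p)%N) (hq : (1 <= q)%N) (hk : (1 <= k)%N)
  (hpq : (p * q <= k)%N) (l : nat) :
  (l <> (p * q)%N -> forall x : cohomology R p q k l, x = 0) /\
  (l = (p * q)%N ->
    exists f : {linear cohomology R p q k l ->
                  submod_type (Polq_invariants_vol R p q k)},
      bijective f).
Proof.
split=> [lpq x|->]; first exact: cohomology_eq0.
have [phi [phil phib]] := harmonics_cohomology R hp hq hpq.
have [psi [psil psib]] := harmonics_invariants R hpq.
exact: (linear_bij_transfer phil psil phib psib).
Qed.
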